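(* Let $\pi$ be a uniformly random permutation of $[N]$, $M_1,\dots,M_H\in\mathbb R^{N\times N}$ deterministic matrices satisfying Condition S1 with $|M_h(i,j)|\le B_N$ for all $h,i,j$, and $\Gamma=(\Gamma_1,\dots,\Gamma_H)^\top$ with $\Gamma_h=\sum_iM_h(i,\pi(i))$. Let $\xi_H\sim\mathcal N(0,I_H)$ and $\mathcal A$ the class of all Borel convex subsets of $\mathbb R^H$. There is a universal constant $C>0$ such that $$\sup_{A\in\mathcal A}|\mathbb P\{\Gamma\in A\}-\mathbb P\{\xi_H\in A\}|\le CH^{13/4}NB_N(B_N^2+N^{-1})+CH^{3/4}B_N+CH^{13/8}N^{1/4}B_N^{3/2}+CH^{11/8}N^{1/2}B_N^2.$$ In particular, if $B_N\le KN^{-1/2}$ for a constant $K$, then the left side is at most $C_KH^{13/4}N^{-1/2}$ for a constant $C_K$ depending only on $K$.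
   Context: Condition S1: each $M_h$ has all row sums and column sums equal to zero, $\mathrm{Tr}(M_h^\top M_h)=N-1$, and $\mathrm{Tr}(M_h^\top M_l)=0$ for $h\ne l$.
   Formalization: The formal theorem assumes N ≥ 2; for N = 1 Condition S1 forces every M_h = 0, so with B_N = 0 and A = {0} the left side is 1 while the stated bound is 0. *)

(* Defs.v *)
From HB Require Import structures.
From mathcomp Require Import all_boot all_order all_algebra all_fingroup.
From mathcomp Require Import all_classical all_reals all_analysis.
Set Implicit Arguments. Unset Strict Implicit. Unset Printing Implicit Defensive.
Import Order.TTheory GRing.Theory Num.Theory.
Import numFieldNormedType.Exports.
Local Open Scope classical_set_scope.
Local Open Scope ring_scope.

Definition conditionS1 {R : realType} (N H : nat) (M : 'I_H -> 'M[R]_N) : Prop :=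
  [/\ (forall h i, \sum_j M h i j = 0),
      (forall h j, \sum_i M h i j = 0),
      (forall h, \tr ((M h)^T *m M h) = N%:R - 1) &
      (forall h l, h != l -> \tr ((M h)^T *m M l) = 0)].

Definition Gamma {R : realType} (N H : nat) (M : 'I_H -> 'M[R]_N)
  (s : {perm 'I_N}) : 'rV[R]_H :=
  \row_h \sum_i M h i (s i).

Definition perm_prob {R : realType} (N H : nat) (M : 'I_H -> 'M[R]_N)
  (A : set 'rV[R]_H) : R :=
  (N`!%:R)^-1 * \sum_(s : {perm 'I_N}) \1_A (Gamma M s).

Definition vcons {R : realType} (n : nat) (x : R) (v : 'I_n -> R) : 'I_n.+1 -> R :=
  fun i => match unlift ord0 i with None => x | Some j => v j end.

(* E[f(xi)] for xi ~ N(0, I_n), as an iterated integral against the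
   standard normal density on each coordinate (product measure). *)
Fixpoint gauss_int {R : realType} (n : nat) : (('I_n -> R) -> \bar R) -> \bar R :=
  match n with
  | 0 => fun f => f (fun _ => 0)
  | n'.+1 => fun f =>
      (\int[@lebesgue_measure R]_x
         ((normal_pdf 0 1 x)%:E * gauss_int (fun v => f (vcons x v))))%E
  end.

Definition gauss_prob {R : realType} (H : nat) (A : set 'rV[R]_H) : \bar R :=
  gauss_int (fun v : 'I_H -> R => (\1_A (\row_i v i) : R)%:E).

Definition borel_set {R : realType} (H : nat) (A : set 'rV[R]_H) : Prop :=
  <<s [set U : set 'rV[R]_H | open U] >> A.

(* Main.v *)
Require Import Defs.
From HB Require Import structures.
From mathcomp Require Import all_boot all_order all_algebra all_fingroup.
From mathcomp Require Import all_classical all_reals all_analysis.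
From mathcomp Require Import measurable_realfun.
From mathcomp Require Import ring lra.
Set Implicit Arguments. Unset Strict Implicit. Unset Printing Implicit Defensive.
Import Order.TTheory GRing.Theory Num.Theory.
Import numFieldNormedType.Exports.
Local Open Scope classical_set_scope.
Local Open Scope ring_scope.

(** Stein's method for the exchangeable pair [(pi, pi o (i j))], run along a rotation. Put [W :=
    Gamma], let [Z] be standard normal, [A] open convex and [u(th) := P(cos th W + sin th Z \in A)],
    so that [u(pi/2)] is the Gaussian probability of [A]. The exchangeable pair expresses [u'(th)]
    as the mean over [Z] of [1_A(cos th W + sin th Z) * Qf], where [Qf] consists of the fluctuations
    of the second and third moments of the increments of [W], of size [N^(1/2) B^2] and [N^(1/2)
    B^3] by an Efron-Stein bound, and of a fourth order remainder. Since [Qf] has mean zero in [Z],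
    the indicator may be replaced by its increment between [cos th W] and [cos th W + sin th Z],
    which vanishes unless [W] lies in a shell around the boundary of a dilate of [A]. If [kap] is
    the supremum of the error over open convex sets, such a shell has probability at most [2 kap]
    plus its Gaussian measure. Integrating over [th >= th0] with [sin th0] of order [H^2 N B^3] and
    removing the remaining smoothing gives [kap <= kap / 2 + C H^(13/4) N B^3]. The normalisation
    forces [N B^2 >= 1/2], which makes this quantity dominate the lower order errors. *)

(** * Gaussian measure *)

(** Two devices keep logarithms and extra powers of H out. First, the increment of the indicator has
    first moment of order kap + H^(5/4) sin th, and the fluctuation of the second moments is paired
    with it by a weighted AM-GM inequality whose weight grows like (sin th)^(-1/2). The part free of
    kap is then of order (sin th)^(-1/2), integrable down to 0, where Cauchy-Schwarz against the
    constant 1 would give 1 / sin th and a logarithm. Second, sets are dilated and eroded by cubes: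
    a shell of width r is peeled off one coordinate at a time and costs H r, while a coordinate of Z
    costs H^(1/4) through a functional with dimension-free moments. Smoothing at scale eps = sin th0
    thus costs H^(5/4) eps. What fixes eps is the coefficient of kap after integration, of order H
    N^(1/2) B^2 eps^(-1/2) + H^4 N B^4 eps^(-2). Since N B^2 >= 1/2, and H eps may be assumed at
    most 1/2, a large multiple of H^2 N B^3 makes it small, and H^(5/4) eps becomes H^(13/4) N
    B^3. *)

Section gauss1.
Context {R : realType}.
Local Notation lam := (@lebesgue_measure R).
Local Open Scope ereal_scope.

(** The Radon-Nikodym derivative and [normal_pdf] integrate to the same value over every measurable
    set, hence agree almost everywhere. *)
Lemma ge0_integral_normal_prob (f : R -> \bar R) (m s : R) :
  measurable_fun [set: R] f -> (forall x, 0 <= f x) ->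
  \int[normal_prob m s]_x f x = \int[lam]_x (f x * (normal_pdf m s x)%:E).
Proof.
move=> mf f0.
have dom := normal_prob_dominates m s.
rewrite -(Radon_Nikodym_SigmaFinite.change_of_variables dom f0 measurableT)//.
apply: ae_eq_integral => //.
- apply: emeasurable_funM => //; apply: (measurable_int lam).
  exact: Radon_Nikodym_SigmaFinite.f_integrable.
- apply: emeasurable_funM => //=; apply/measurableT_comp => //=.
  exact: measurable_normal_pdf.
- apply: ae_eqe_mul2l => /=.
  apply: integral_ae_eq => //=.
  + exact: Radon_Nikodym_SigmaFinite.f_integrable.
  + by apply/measurable_funTS/measurableT_comp =>//; exact: measurable_normal_pdf.
  + by move=> E _ mE; rewrite -Radon_Nikodym_SigmaFinite.f_integral.
Qed.

(** Lebesgue measure is determined by its values on half-open intervals, and its pushforward under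
    the affine map, scaled by [s], has the same values there. *)
Lemma ge0_integral_affine (f : R -> \bar R) (m s : R) : (0 < s)%R ->
  measurable_fun [set: R] f -> (forall x, 0 <= f x) ->
  \int[lam]_x f x = s%:E * \int[lam]_x f (m + s * x)%R.
Proof.
move=> s0 mf f0.
pose phi := (fun x : R => (m + s * x)%R) : measurableTypeR R -> measurableTypeR R.
have mphi : measurable_fun setT phi.
  by apply: measurable_funD => //; apply: measurable_funM.
pose sn := NngNum (ltW s0).
pose nu_ : {measure set (measurableTypeR R) -> \bar R} := mscale sn (pushforward lam phi).
pose nu := nu_ mphi.
have lamE A : measurable A -> lam A = nu A.
  apply: lebesgue_measure_unique => _ [[a b]] _ <-.
  change (lam `]a, b] = s%:E * lam (phi @^-1` `]a, b])).
  have -> : phi @^-1` `]a, b] = `]((a - m) / s)%R, ((b - m) / s)%R]%classic.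
    apply/seteqP; split => x; rewrite /phi /= !in_itv/= => /andP[h1 h2]; apply/andP; split.
    - by rewrite ltr_pdivrMr// mulrC ltrBlDl.
    - by rewrite ler_pdivlMr// mulrC lerBrDl.
    - by move: h1; rewrite ltr_pdivrMr// mulrC ltrBlDl.
    - by move: h2; rewrite ler_pdivlMr// mulrC lerBrDl.
  rewrite !lebesgue_measure_itv/= !lte_fin.
  rewrite ltr_pM2r ?invr_gt0// ltrD2r.
  case: ifPn => _; last by rewrite mule0.
  by rewrite -!EFinB -EFinM; congr EFin; field; rewrite gt_eqF.
transitivity (\int[nu]_x f x).
  by apply: eq_measure_integral => A mA _; exact: lamE.
rewrite /nu ge0_integral_mscale//=.
by rewrite ge0_integral_pushforward.
Qed.

(* Density of [m + s X] relative to that of [X], for [X] standard normal. *)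
Definition affw (m s y : R) : R := (s^-1 * expR (y ^+ 2 / 2 - (y - m) ^+ 2 / (2 * s ^+ 2)))%R.

Lemma affw_ge0 (m s y : R) : (0 < s)%R -> (0 <= affw m s y)%R.
Proof. by move=> s0; rewrite mulr_ge0 ?expR_ge0// invr_ge0 ltW. Qed.

Lemma measurable_affw (m s : R) : measurable_fun setT (affw m s).
Proof.
apply: measurable_funM => //; apply: measurableT_comp => //.
apply: measurable_funB; apply: measurable_funM => //;
  apply: measurable_funX => //; exact: measurable_funB.
Qed.

Lemma normal_pdf_affw (m s y : R) : (0 < s)%R ->
  (s^-1 * normal_pdf 0 1 ((y - m) / s) = affw m s y * normal_pdf 0 1 y)%R.
Proof.
move=> s0; rewrite !normal_pdfE ?oner_eq0// /affw.
rewrite -mulrA; congr (_ * _)%R.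
rewrite [RHS]mulrCA; congr (_ * _)%R; rewrite /normal_fun -expRD; congr expR.
by field; rewrite gt_eqF.
Qed.

Lemma ge0_gauss1_affine (f : R -> \bar R) (m s : R) : (0 < s)%R ->
  measurable_fun [set: R] f -> (forall x, 0 <= f x) ->
  \int[normal_prob 0 1]_x f (m + s * x)%R =
  \int[normal_prob 0 1]_x (f x * (affw m s x)%:E).
Proof.
move=> s0 mf f0.
have mphi : measurable_fun setT (fun x : R => (m + s * x)%R).
  by apply: measurable_funD => //; apply: measurable_funM.
rewrite !ge0_integral_normal_prob//; last 3 first.
- apply: emeasurable_funM => //; apply: measurableT_comp => //; exact: measurable_affw.
- by move=> x; rewrite mule_ge0// lee_fin affw_ge0.
- exact: measurableT_comp.
have mn (g : R -> R) : measurable_fun setT g -> measurable_fun setT (fun x => (normal_pdf 0 1 (g x))%:E).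
  by move=> mg; apply: measurableT_comp => //; apply: measurableT_comp => //; exact: measurable_normal_pdf.
rewrite [RHS](@ge0_integral_affine _ m s)//; last 2 first.
- apply: emeasurable_funM; last exact: mn.
  by apply: emeasurable_funM => //; apply: measurableT_comp => //; exact: measurable_affw.
- by move=> x; rewrite !mule_ge0 ?lee_fin ?affw_ge0 ?normal_pdf_ge0.
rewrite -ge0_integralZl//; last 3 first.
- apply: emeasurable_funM; last exact: mn.
  apply: emeasurable_funM; first exact: measurableT_comp.
  apply: measurableT_comp => //; apply: measurableT_comp => //; exact: measurable_affw.
- by move=> x _; rewrite !mule_ge0 ?lee_fin ?affw_ge0 ?normal_pdf_ge0.
- by rewrite lee_fin ltW.
apply: eq_integral => x _.
rewrite -[in RHS]muleA [RHS]muleCA -[in RHS]EFinM; congr (_ * _%:E).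
rewrite -normal_pdf_affw// mulrA divff ?gt_eqF// mul1r.
by congr (normal_pdf _ _ _); field; rewrite gt_eqF.
Qed.

End gauss1.

Section gaussn.
Context {R : realType}.
Local Open Scope ereal_scope.

Definition tcons n (p : measurableTypeR R * n.-tuple R) : n.+1.-tuple R := [the n.+1.-tuple R of (p.1 : R) :: p.2].

Lemma measurable_tcons n : measurable_fun setT (@tcons n).
Proof.
exact: measurable_cons.
Qed.

HB.instance Definition _ n := isMeasurableFun.Build _ _ _ _ (@tcons n) (@measurable_tcons n).

(** Built on tuples, which carry the product sigma-algebra; [rv] transports functions of row vectors
    to them, and [rmeas] is measurability along [rv]. *)
Fixpoint gaussn n : probability (n.-tuple R) R :=
  match n with
  | 0 => dirac [tuple]
  | n'.+1 => distribution (normal_prob 0 1 \x gaussn n') (@tcons n')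
  end.

Lemma ge0_integral_gaussnS n (f : n.+1.-tuple R -> \bar R) :
  measurable_fun setT f -> (forall x, 0 <= f x) ->
  \int[gaussn n.+1]_t f t =
  \int[normal_prob 0 1]_x \int[gaussn n]_t f (tcons (x, t)).
Proof.
move=> mf f0.
rewrite /= ge0_integral_distribution//.
rewrite fubini_tonelli1//; last by move=> x; exact: f0.
by apply: measurableT_comp => //; exact: measurable_tcons.
Qed.

Lemma ge0_integral_gaussnS_sym n (f : n.+1.-tuple R -> \bar R) :
  measurable_fun setT f -> (forall x, 0 <= f x) ->
  \int[gaussn n.+1]_t f t =
  \int[gaussn n]_t \int[normal_prob 0 1]_x f (tcons (x, t)).
Proof.
move=> mf f0.
rewrite /= ge0_integral_distribution//.
rewrite fubini_tonelli2//; last by move=> x; exact: f0.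
by apply: measurableT_comp => //; exact: measurable_tcons.
Qed.

Definition rv n (t : n.-tuple R) : 'rV[R]_n := \row_i tnth t i.

Definition rvc n (a : R) (v : 'rV[R]_n) : 'rV[R]_n.+1 := \row_i vcons a (v 0%R) i.

Definition rvtl n (v : 'rV[R]_n.+1) : 'rV[R]_n := \row_i v 0%R (lift ord0 i).

Lemma rvc0 n a (v : 'rV[R]_n) : rvc a v 0%R ord0 = a.
Proof. by rewrite mxE /vcons unlift_none. Qed.

Lemma rvcS n a (v : 'rV[R]_n) i : rvc a v 0%R (lift ord0 i) = v 0%R i.
Proof. by rewrite mxE /vcons liftK. Qed.

Lemma rvP n (u v : 'rV[R]_n) : (forall i, u 0%R i = v 0%R i) -> u = v.
Proof. by move=> uv; apply/rowP. Qed.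

Lemma rvSP n (u v : 'rV[R]_n.+1) : u 0%R ord0 = v 0%R ord0 ->
  (forall i, u 0%R (lift ord0 i) = v 0%R (lift ord0 i)) -> u = v.
Proof.
move=> uv0 uvS; apply: rvP => i.
by case: (unliftP ord0 i) => [j ->|->].
Qed.

Lemma rv_tcons n a (t : n.-tuple R) : rv (tcons (a, t)) = rvc a (rv t).
Proof.
by apply: rvSP => [|i]; rewrite ?rvc0 ?rvcS !mxE /tcons/= ?tnth0 ?tnthS.
Qed.

Lemma measurable_rv_coord n (i : 'I_n) : measurable_fun setT (fun t : n.-tuple R => rv t 0%R i).
Proof.
rewrite (_ : (fun _ => _) = (fun t => tnth t i)); first exact: measurable_tnth.
by apply/funext => t; rewrite mxE.
Qed.

Definition rmeas n d (T : measurableType d) (f : 'rV[R]_n -> T) :=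
  measurable_fun setT (fun t : n.-tuple R => f (rv t)).

Lemma rmeas_cons n d (T : measurableType d) (f : 'rV[R]_n.+1 -> T) :
  rmeas f -> measurable_fun setT (fun p : measurableTypeR R * n.-tuple R => f (rvc p.1 (rv p.2))).
Proof.
move=> mf.
rewrite (_ : (fun _ => _) = (fun t => f (rv t)) \o @tcons n); last first.
  by apply/funext => -[a t]; rewrite /= rv_tcons.
by apply: measurableT_comp => //; exact: measurable_tcons.
Qed.

Lemma rmeas_cons2 n d (T : measurableType d) (f : 'rV[R]_n.+1 -> T) a :
  rmeas f -> rmeas (fun v => f (rvc a v)).
Proof.
move=> mf; rewrite /rmeas.
apply: (@measurableT_comp _ _ _ _ _ _ (fun p : measurableTypeR R * n.-tuple R => f (rvc p.1 (rv p.2))) _ (fun t => (a, t))).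
  exact: rmeas_cons.
exact: pair1_measurable.
Qed.

Lemma gaussn0E (f : 'rV[R]_0 -> \bar R) : rmeas f -> \int[gaussn 0]_t f (rv t) = f 0%R.
Proof.
move=> mf; rewrite /= integral_dirac//= diracT mul1e.
by congr f; apply: rvP => -[].
Qed.

Lemma ge0_gaussnS n (f : 'rV[R]_n.+1 -> \bar R) : rmeas f -> (forall v, 0 <= f v) ->
  \int[gaussn n.+1]_t f (rv t) =
  \int[normal_prob 0 1]_x \int[gaussn n]_t f (rvc x (rv t)).
Proof.
move=> mf f0; rewrite ge0_integral_gaussnS//.
by apply: eq_integral => a _; apply: eq_integral => t _; rewrite rv_tcons.
Qed.

Lemma ge0_gaussnS_sym n (f : 'rV[R]_n.+1 -> \bar R) : rmeas f -> (forall v, 0 <= f v) ->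
  \int[gaussn n.+1]_t f (rv t) =
  \int[gaussn n]_t \int[normal_prob 0 1]_x f (rvc x (rv t)).
Proof.
move=> mf f0; rewrite ge0_integral_gaussnS_sym//.
by apply: eq_integral => a _; apply: eq_integral => t _; rewrite rv_tcons.
Qed.

Lemma measurable_gaussnS n (f : 'rV[R]_n.+1 -> \bar R) : rmeas f -> (forall v, 0 <= f v) ->
  measurable_fun setT (fun x : R => \int[gaussn n]_t f (rvc x (rv t))).
Proof.
move=> mf f0.
have := @measurable_fun_fubini_tonelli_F _ _ (measurableTypeR R) (n.-tuple R) R (gaussn n)
  (fun p => f (rvc p.1 (rv p.2))).
by apply => //; exact: rmeas_cons.
Qed.

Definition nw n (x : 'rV[R]_n) (s : R) (v : 'rV[R]_n) : R :=
  (\prod_i affw (x 0 i) s (v 0 i))%R.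

Lemma nw_ge0 n (x : 'rV[R]_n) (s : R) (v : 'rV[R]_n) : (0 < s)%R -> (0 <= nw x s v)%R.
Proof. by move=> s0; apply: prodr_ge0 => i _; exact: affw_ge0. Qed.

Lemma rmeas_nw n (x : 'rV[R]_n) s : rmeas (nw x s).
Proof.
apply: measurable_prod => i _.
apply: measurableT_comp => //; first exact: measurable_affw.
exact: measurable_rv_coord.
Qed.

Lemma nwS n (x : 'rV[R]_n.+1) s a v :
  nw x s (rvc a v) = (affw (x 0 ord0) s a * nw (rvtl x) s v)%R.
Proof.
rewrite /nw big_ord_recl rvc0; congr (_ * _)%R.
by apply: eq_bigr => i _; rewrite rvcS mxE.
Qed.

(** Moves the dependence on [x] and [s] from the argument of [f] into a smooth weight, which can
    later be differentiated even when [f] is an indicator. *)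
Lemma ge0_gaussn_affine n (f : 'rV[R]_n -> \bar R) (x : 'rV[R]_n) (s : R) : (0 < s)%R ->
  rmeas f -> (forall v, 0 <= f v) ->
  \int[gaussn n]_t f (x + s *: rv t)%R =
  \int[gaussn n]_t (f (rv t) * (nw x s (rv t))%:E).
Proof.
move=> s0; elim: n f x => [|n IH] f x mf f0.
  transitivity (f 0%R).
    rewrite (_ : (fun t => _) = (fun t => f (rv t))); first exact: gaussn0E.
    by apply/funext => t; congr f; apply: rvP => -[].
  rewrite (@gaussn0E (fun v => f v * (nw x s v)%:E)).
    by rewrite /nw big_ord0 mule1.
  apply: emeasurable_funM => //; apply: measurableT_comp => //; exact: rmeas_nw.
have mfn : rmeas (fun v => f v * (nw x s v)%:E).
  apply: emeasurable_funM => //; apply: measurableT_comp => //; exact: rmeas_nw.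
have maff : rmeas (fun v => f (x + s *: v)%R).
  rewrite /rmeas.
  pose g (t : n.+1.-tuple R) : n.+1.-tuple R := [tuple (x 0 i + s * tnth t i)%R | i < n.+1].
  rewrite (_ : (fun _ => _) = (fun t => f (rv t)) \o g).
    apply: measurableT_comp => //; apply/measurable_fun_tnthP => i.
    rewrite (_ : _ \o _ = (fun t => x 0 i + s * tnth t i)%R).
      by apply: measurable_funD => //; apply: measurable_funM => //; exact: measurable_tnth.
    by apply/funext => t /=; rewrite tnth_mktuple.
  by apply/funext => t /=; congr f; apply: rvP => i; rewrite !mxE tnth_mktuple.
rewrite (@ge0_gaussnS n (fun v => f (x + s *: v)%R))//.
rewrite (@ge0_gaussnS n (fun v => f v * (nw x s v)%:E))//; last first.
  by move=> v; rewrite mule_ge0// lee_fin nw_ge0.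
pose h (b : R) := \int[gaussn n]_t (f (rvc b (rv t)) * (nw (rvtl x) s (rv t))%:E).
transitivity (\int[normal_prob 0 1]_a h (x 0 ord0 + s * a)%R).
  apply: eq_integral => a _; rewrite /h -(IH (fun v => f (rvc _ v)) (rvtl x)).
  - apply: eq_integral => t _; congr f; apply: rvSP => [|i].
      by rewrite !mxE /vcons !unlift_none.
    by rewrite !mxE /vcons !liftK !mxE.
  - exact: rmeas_cons2.
  - by move=> v.
rewrite ge0_gauss1_affine//; last 2 first.
- pose k (v : 'rV[R]_n.+1) := f v * (nw (rvtl x) s (rvtl v))%:E.
  rewrite (_ : h = fun b => \int[gaussn n]_t k (rvc b (rv t))).
    apply: measurable_gaussnS.
      apply: emeasurable_funM => //; apply: measurableT_comp => //.
      apply: measurable_prod => i _.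
      apply: measurableT_comp => //; first exact: measurable_affw.
      rewrite (_ : (fun _ => _) = (fun t => rv t 0%R (lift ord0 i))).
        exact: measurable_rv_coord.
      by apply/funext => t; rewrite !mxE.
    by move=> v; rewrite mule_ge0// lee_fin nw_ge0.
  apply/funext => b; apply: eq_integral => t _; congr (_ * (nw _ _ _)%:E).
  by apply: rvP => i; rewrite [RHS]mxE rvcS.
- by move=> b; apply: integral_ge0 => t _; rewrite mule_ge0// lee_fin nw_ge0.
apply: eq_integral => a _.
rewrite /h muleC -ge0_integralZl//; last 3 first.
- apply: emeasurable_funM; first exact: rmeas_cons2.
  by apply: measurableT_comp => //; exact: rmeas_nw.
- by move=> t _; rewrite mule_ge0// lee_fin nw_ge0.
- by rewrite lee_fin affw_ge0.
apply: eq_integral => t _.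
by rewrite nwS EFinM muleCA.
Qed.

End gaussn.

Section mono.
Local Open Scope ereal_scope.

(* No measurability is assumed: the nonnegative integral is a supremum over the simple functions below the integrand. *)
Lemma ge0_le_integral_nomeas d (T : measurableType d) (R : realType)
    (mu : {measure set T -> \bar R}) (f g : T -> \bar R) :
  (forall x, 0 <= f x) -> (forall x, f x <= g x) ->
  \int[mu]_x f x <= \int[mu]_x g x.
Proof.
move=> f0 fg.
have g0 x : 0 <= g x by exact: le_trans (fg x).
rewrite !ge0_integralTE//.
apply: ereal_sup_le => _ /= [h hf <-].
by exists h => // x; exact: le_trans (hf x) (fg x).
Qed.

End mono.

Section bridge.
Context {R : realType}.
Local Open Scope ereal_scope.

Lemma gauss_int_ge0 n (f : ('I_n -> R) -> \bar R) : (forall v, 0 <= f v) -> 0 <= gauss_int f.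
Proof.
elim: n f => [|n IH] f f0 /=; first exact: f0.
apply: integral_ge0 => x _; rewrite mule_ge0 ?lee_fin ?normal_pdf_ge0//.
by apply: IH => v.
Qed.

(** Holds for arbitrary nonnegative integrands, so that a set can be squeezed between open ones
    inside [gauss_int]. *)
Lemma le_gauss_int n (f g : ('I_n -> R) -> \bar R) :
  (forall v, 0 <= f v) -> (forall v, f v <= g v) -> gauss_int f <= gauss_int g.
Proof.
elim: n f g => [|n IH] f g f0 fg /=; first exact: fg.
apply: ge0_le_integral_nomeas => x.
  by rewrite mule_ge0 ?lee_fin ?normal_pdf_ge0// gauss_int_ge0.
by rewrite lee_wpmul2l ?lee_fin ?normal_pdf_ge0//; apply: IH.
Qed.

Lemma gauss_intE n (f : 'rV[R]_n -> \bar R) : rmeas f -> (forall v, 0 <= f v) ->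
  gauss_int (fun v : 'I_n -> R => f (\row_i v i)%R) = \int[gaussn n]_t f (rv t).
Proof.
elim: n f => [|n IH] f mf f0.
  by rewrite gaussn0E//=; congr f; apply: rvP => -[].
rewrite ge0_gaussnS// ge0_integral_normal_prob//; last 2 first.
- exact: measurable_gaussnS.
- by move=> x; apply: integral_ge0.
apply: eq_integral => x _ /=; rewrite muleC; congr (_ * _).
rewrite -(IH (fun v => f (rvc x v)))//; last exact: rmeas_cons2.
congr gauss_int; apply/funext => v; congr f; apply: rvP => i; rewrite !mxE.
by congr (vcons _ _ _); apply/funext => j; rewrite mxE.
Qed.

End bridge.

Section openmeas.
Context {R : realType}.

Lemma ball_rvP n (x y : 'rV[R]_n) (e : R) : 0 < e ->
  (forall i, `|x 0 i - y 0 i| < e) -> ball x e y.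
Proof.
move=> e0 xy; split => // i j; rewrite (ord1 i).
by rewrite -ball_normE /=; exact: xy.
Qed.

Lemma open_rvP n (A : set 'rV[R]_n) : open A ->
  forall x, A x -> exists2 e : R, 0 < e & forall y : 'rV[R]_n, (forall i, `|x 0 i - y 0 i| < e) -> A y.
Proof.
move=> oA x Ax.
have /nbhs_ballP[e /= e0 eA] : nbhs x A by exact: open_nbhs_nbhs.
by exists e => // y xy; apply: eA; exact: ball_rvP.
Qed.

Lemma rvP_open n (A : set 'rV[R]_n) :
  (forall x, A x -> exists2 e : R, 0 < e & forall y : 'rV[R]_n, (forall i, `|x 0 i - y 0 i| < e) -> A y) ->
  open A.
Proof.
move=> h; rewrite openE => x /h[e e0 eA]; apply/nbhs_ballP; exists e => // y [_ xy].
by apply: eA => i; have := xy 0 i; rewrite -ball_normE.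
Qed.

(** An open set is the countable union of the cubes with rational centre and half-side 1 / (k + 1)
    that it contains. *)
Lemma open_measurable_rv n (A : set 'rV[R]_n) : open A ->
  measurable [set t : n.-tuple R | A (rv t)].
Proof.
move=> oA.
pose box (p : n.-tuple rat * nat) := [set t : n.-tuple R |
  forall i, (ratr (tnth p.1 i) : R) - p.2.+1%:R^-1 < tnth t i < ratr (tnth p.1 i) + p.2.+1%:R^-1].
pose P := [set p | box p `<=` [set t : n.-tuple R | A (rv t)]].
have mbox p : measurable (box p).
  rewrite (_ : box p = \bigcap_(i in [set: 'I_n]) [set t : n.-tuple R |
    (ratr (tnth p.1 i) : R) - p.2.+1%:R^-1 < tnth t i < ratr (tnth p.1 i) + p.2.+1%:R^-1]); last first.
    apply/seteqP; split => t /=; first by move=> h i _; exact: h.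
    by move=> h i; exact: h.
  apply: fin_bigcap_measurable => // i _.
  rewrite (_ : [set t : n.-tuple R | _] = (fun t : n.-tuple R => tnth t i) @^-1` `]
     ((ratr (tnth p.1 i) : R) - p.2.+1%:R^-1), (ratr (tnth p.1 i) + p.2.+1%:R^-1)[%classic); last first.
    by apply/seteqP; split => t /=; rewrite in_itv.
  by rewrite -[X in measurable X]setTI; apply: measurable_tnth.
rewrite (_ : [set t | _] = \bigcup_(p in P) box p); last first.
  apply/seteqP; split => t /=; last by move=> [p Pp]; exact: Pp.
  move=> At; have [e e0 eA] := open_rvP oA At.
  (* Half of [e], because the cube is centred at a rational point near [t] and not at [t] itself. *)
  have [k] : exists k : nat, 0 + k.+1%:R^-1 < e / 2 by apply: ltr_add_invr; rewrite divr_gt0.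
  rewrite add0r => ke.
  have q i : {q : rat | tnth t i - k.+1%:R^-1 < ratr q < tnth t i + k.+1%:R^-1}.
    apply: cid.
    have /rat_in_itvoo[r] : tnth t i - k.+1%:R^-1 < tnth t i + k.+1%:R^-1.
      by rewrite ltrD2l gt0_cp// invr_gt0.
    by rewrite in_itv/=; exists r.
  exists ([tuple sval (q i) | i < n], k).
    move=> s /= h; apply: eA => i; rewrite !mxE.
    have := h i; rewrite tnth_mktuple; case: (q i) => /= r /andP[h1 h2] /andP[h3 h4].
    move: (k.+1%:R^-1) ke h1 h2 h3 h4 => u ke h1 h2 h3 h4.
    by rewrite ltr_norml; apply/andP; split; lra.
  move=> i /=; rewrite tnth_mktuple; case: (q i) => /= r /andP[h1 h2].
  by rewrite ltrBlDr h2 -ltrBlDr h1.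
rewrite bigcup_mkcond; apply: countable_bigcupT_measurable => // p.
by case: ifPn => _ //; exact: mbox.
Qed.

End openmeas.

(** * Gaussian expectations and exponential moments *)

Section expect.
Context {R : realType}.

Lemma rmeas_affine n d (T : measurableType d) (f : 'rV[R]_n -> T) (x : 'rV[R]_n) (s : R) :
  rmeas f -> rmeas (fun v => f (x + s *: v)).
Proof.
move=> mf; rewrite /rmeas.
pose g (t : n.-tuple R) : n.-tuple R := [tuple x 0 i + s * tnth t i | i < n].
rewrite (_ : (fun _ => _) = (fun t => f (rv t)) \o g); last first.
  by apply/funext => t /=; congr f; apply: rvP => i; rewrite !mxE tnth_mktuple.
apply: measurableT_comp => //; apply/measurable_fun_tnthP => i.
rewrite (_ : _ \o _ = (fun t => x 0 i + s * tnth t i)); last first.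
  by apply/funext => t /=; rewrite tnth_mktuple.
by apply: measurable_funD => //; apply: measurable_funM => //; exact: measurable_tnth.
Qed.

Definition gI n (f : 'rV[R]_n -> R) := (gaussn n).-integrable setT (fun t => (f (rv t))%:E).
Definition gE n (f : 'rV[R]_n -> R) : R := \int[gaussn n]_t f (rv t).

Lemma gI_meas n (f : 'rV[R]_n -> R) : gI f -> rmeas f.
Proof. by move=> /measurable_int/measurable_EFinP. Qed.

Lemma gI_le n (f g : 'rV[R]_n -> R) : rmeas f -> (forall v, `|f v| <= g v) -> gI g -> gI f.
Proof.
move=> mf fg; apply: le_integrable => //; first exact/measurable_EFinP.
by move=> t _ /=; rewrite lee_fin (le_trans (fg _))// ler_norm.
Qed.

Lemma gI_cst n (c : R) : @gI n (fun=> c).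
Proof. exact: finite_measure_integrable_cst. Qed.

Lemma gI_D n (f g : 'rV[R]_n -> R) : gI f -> gI g -> gI (fun v => f v + g v).
Proof.
move=> fi gi; rewrite /gI.
by under eq_fun do rewrite EFinD; exact: integrableD.
Qed.

Lemma gI_B n (f g : 'rV[R]_n -> R) : gI f -> gI g -> gI (fun v => f v - g v).
Proof.
move=> fi gi; rewrite /gI.
by under eq_fun do rewrite EFinB; exact: integrableB.
Qed.

Lemma gI_Z n (c : R) (f : 'rV[R]_n -> R) : gI f -> gI (fun v => c * f v).
Proof.
move=> fi; rewrite /gI.
by under eq_fun do rewrite EFinM; exact: integrableZl.
Qed.

Lemma gI_sum n (I : Type) (r : seq I) (P : pred I) (f : I -> 'rV[R]_n -> R) :
  (forall i, P i -> gI (f i)) -> gI (fun v => \sum_(i <- r | P i) f i v).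
Proof.
move=> h; elim: r => [|i r IH].
  under [X in gI X]eq_fun do rewrite big_nil.
  exact: gI_cst.
have [Pi|/negbTE nPi] := boolP (P i).
  under [X in gI X]eq_fun do rewrite big_cons Pi.
  by apply: gI_D => //; exact: h.
by under [X in gI X]eq_fun do rewrite big_cons nPi.
Qed.

Lemma gE_cst n (c : R) : @gE n (fun=> c) = c.
Proof.
rewrite /gE Rintegral_cst//; rewrite (_ : fine _ = fine 1%E) ?mulr1//.
by congr fine; exact: probability_setT.
Qed.

Lemma gE_D n (f g : 'rV[R]_n -> R) : gI f -> gI g ->
  gE (fun v => f v + g v) = gE f + gE g.
Proof. by move=> fi gi; rewrite /gE RintegralD. Qed.

Lemma gE_B n (f g : 'rV[R]_n -> R) : gI f -> gI g ->
  gE (fun v => f v - g v) = gE f - gE g.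
Proof. by move=> fi gi; rewrite /gE RintegralB. Qed.

Lemma gE_Z n (c : R) (f : 'rV[R]_n -> R) : gI f -> gE (fun v => c * f v) = c * gE f.
Proof. by move=> fi; rewrite /gE RintegralZl. Qed.

Lemma gE_sum n (I : Type) (r : seq I) (P : pred I) (f : I -> 'rV[R]_n -> R) :
  (forall i, P i -> gI (f i)) ->
  gE (fun v => \sum_(i <- r | P i) f i v) = \sum_(i <- r | P i) gE (f i).
Proof.
move=> h; elim: r => [|i r IH].
  under [X in gE X]eq_fun do rewrite big_nil.
  by rewrite gE_cst big_nil.
have [Pi|/negbTE nPi] := boolP (P i).
  under [X in gE X]eq_fun do rewrite big_cons Pi.
  by rewrite gE_D ?IH ?big_cons ?Pi//; [exact: h | exact: gI_sum].
under [X in gE X]eq_fun do rewrite big_cons nPi.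
by rewrite big_cons nPi.
Qed.

Lemma gE_le n (f g : 'rV[R]_n -> R) : gI f -> gI g -> (forall v, f v <= g v) -> gE f <= gE g.
Proof. by move=> fi gi fg; apply: le_Rintegral. Qed.

Lemma gE_norm n (f g : 'rV[R]_n -> R) : rmeas f -> gI g -> (forall v, `|f v| <= g v) ->
  `|gE f| <= gE g.
Proof.
move=> mf gi fg; have fi := gI_le mf fg gi.
rewrite ler_norml -[- gE g]mulN1r -gE_Z//; apply/andP; split; apply: gE_le => //.
- exact: gI_Z.
- by move=> v; rewrite mulN1r; have := fg v; rewrite ler_norml => /andP[].
- by move=> v; exact: le_trans (ler_norm _) (fg v).
Qed.

Lemma gE_ge0 n (f : 'rV[R]_n -> R) : (forall v, 0 <= f v) -> 0 <= gE f.
Proof. by move=> f0; apply: Rintegral_ge0. Qed.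

Lemma gEK n (f : 'rV[R]_n -> R) : gI f -> (\int[gaussn n]_t (f (rv t))%:E)%E = (gE f)%:E.
Proof. by move=> fi; rewrite /gE /Rintegral fineK//; exact: integrable_fin_num. Qed.

Lemma gI_affine_inv n (f : 'rV[R]_n -> R) (x : 'rV[R]_n) (s : R) : 0 < s ->
  rmeas f -> gI (fun v => f (x + s *: v)) -> gI (fun v => f v * nw x s v).
Proof.
move=> s0 mf /integrableP[_ fi]; apply/integrableP; split.
  by apply/measurable_EFinP; apply: measurable_funM => //; exact: rmeas_nw.
move: fi; rewrite (ge0_gaussn_affine x s0 (f := fun v => `|f v|%:E)%E)//; last first.
  by apply/measurable_EFinP; apply: measurableT_comp.
by under eq_integral do rewrite -EFinM -{1}(ger0_norm (nw_ge0 x _ s0)) -normrM.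
Qed.

Lemma gE_affine n (f : 'rV[R]_n -> R) (x : 'rV[R]_n) (s : R) : 0 < s ->
  rmeas f -> gE (fun v => f (x + s *: v)) = gE (fun v => f v * nw x s v).
Proof.
move=> s0 mf; rewrite /gE /Rintegral; congr fine.
rewrite [LHS]integralE [RHS]integralE; congr (_ - _)%E.
- under eq_integral do rewrite funeposE -EFin_max.
  under [RHS]eq_integral do rewrite funeposE -EFin_max.
  rewrite (@ge0_gaussn_affine R n (fun v => (Num.max (f v) 0)%:E) x s s0)//; last 2 first.
  + by apply/measurable_EFinP; apply: measurable_maxr.
  + by move=> v; rewrite lee_fin le_max lexx orbT.
  by apply: eq_integral => t _; rewrite -EFinM maxr_pMl ?nw_ge0// mul0r.
- under eq_integral do rewrite funenegE -EFinN -EFin_max.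
  under [RHS]eq_integral do rewrite funenegE -EFinN -EFin_max.
  rewrite (@ge0_gaussn_affine R n (fun v => (Num.max (- f v) 0)%:E) x s s0)//; last 2 first.
  + by apply/measurable_EFinP; apply: measurable_maxr => //; exact: measurableT_comp.
  + by move=> v; rewrite lee_fin le_max lexx orbT.
  by apply: eq_integral => t _; rewrite -EFinM maxr_pMl ?nw_ge0// mul0r mulNr.
Qed.

Lemma ge0_gaussn_marginal n (i : 'I_n) (f : R -> \bar R) :
  measurable_fun [set: R] f -> (forall x, 0 <= f x)%E ->
  (\int[gaussn n]_t f (rv t 0%R i) = \int[normal_prob 0 1]_x f x)%E.
Proof.
move=> mf f0; have mfi m (j : 'I_m) : rmeas (fun v : 'rV[R]_m => f (v 0 j)).
  by apply: measurableT_comp => //; exact: measurable_rv_coord.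
elim: n i => [[]//|n IH] i.
rewrite (@ge0_gaussnS _ n (fun v => f (v 0 i)))//.
case: (unliftP ord0 i) => [j ->|->].
  under eq_integral do under eq_integral do rewrite rvcS.
  rewrite IH integral_cst// [X in (_ * X)%E](_ : _ = 1%E) ?mule1//.
  exact: probability_setT.
apply: eq_integral => x _.
under eq_integral do rewrite rvc0.
rewrite integral_cst// [X in (_ * X)%E](_ : _ = 1%E) ?mule1//.
exact: probability_setT.
Qed.

Definition expmom (c : R) : R := \int[normal_prob 0 1]_x expR (c * `|x|).

(** Completing the square makes [expR (b * x)] a multiple of [affw b 1], the relative density of a
    shifted normal, which has mass 1; the exponential of c|x| is below the sum of two such
    functions. *)
Lemma expmom_fin (c : R) : ((\int[normal_prob (0:R) 1]_x (expR (c * `|x|))%:E)%E = (expmom c)%:E).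
Proof.
have mexp (b : R) : measurable_fun [set: R] (fun x : R => (expR (b * x))%:E).
  by apply/measurable_EFinP; apply: measurableT_comp => //; exact: measurable_funM.
have mexpn (b : R) : measurable_fun [set: R] (fun x : R => (expR (b * `|x|))%:E).
  apply/measurable_EFinP; apply: measurableT_comp => //; apply: measurable_funM => //.
have fin b : (\int[normal_prob (0:R) 1]_x (expR (b * x))%:E < +oo)%E.
    have h : (\int[normal_prob (0:R) 1]_x (affw b 1 x)%:E = 1)%E.
      transitivity (\int[normal_prob (0:R) 1]_x (1 * (affw b 1 x)%:E))%E.
        by under [RHS]eq_integral do rewrite mul1e.
      rewrite -(@ge0_gauss1_affine R (fun=> 1%E) b 1 ltr01)//.
      rewrite integral_cst// [X in (1 * X)%E](_ : _ = 1%E) ?mule1//.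
      exact: probability_setT.
    have -> : (\int[normal_prob (0:R) 1]_x (expR (b * x))%:E =
       \int[normal_prob (0:R) 1]_x ((expR (b ^+ 2 / 2))%:E * (affw b 1 x)%:E))%E.
      apply: eq_integral => x _; rewrite -EFinM; congr EFin.
      by rewrite /affw invr1 mul1r -expRD; congr expR; field.
    rewrite ge0_integralZl//; first by rewrite h mule1 ltry.
    - by apply/measurable_EFinP; exact: measurable_affw.
    - by move=> x _; rewrite lee_fin affw_ge0.
rewrite /expmom /Rintegral fineK// ge0_fin_numE; last first.
  by apply: integral_ge0 => x _; rewrite lee_fin expR_ge0.
apply: (@le_lt_trans _ _ (\int[normal_prob (0:R) 1]_x ((expR (c * x))%:E + (expR (- c * x))%:E))%E).
  apply: ge0_le_integral => //.
  - exact: mexpn.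
  - by apply: emeasurable_funD; exact: mexp.
  move=> x _; rewrite -EFinD lee_fin.
  have [x0|x0] := ler0P x; last by rewrite lerDl expR_ge0.
  by rewrite mulNr -mulrN lerDr expR_ge0.
rewrite ge0_integralD//.
- by rewrite lte_add_pinfty.
- exact: mexp.
- exact: mexp.
Qed.

Lemma gexp n (i : 'I_n) (c : R) : gI (fun v => expR (c * `|v 0 i|)) /\
  gE (fun v => expR (c * `|v 0 i|)) = expmom c.
Proof.
have mexpn (b : R) : measurable_fun [set: R] (fun x : R => (expR (b * `|x|))%:E).
  apply/measurable_EFinP; apply: measurableT_comp => //; apply: measurable_funM => //.
have h : (\int[gaussn n]_t (expR (c * `|rv t 0%R i|))%:E = (expmom c)%:E)%E.
  by rewrite -expmom_fin -(ge0_gaussn_marginal i).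
split; last by rewrite /gE /Rintegral h.
apply/integrableP; split.
  apply: (measurableT_comp (mexpn c)) => //; exact: measurable_rv_coord.
under eq_integral do rewrite gee0_abs ?lee_fin ?expR_ge0//.
by rewrite h ltry.
Qed.

End expect.

(** * Gaussian measure of convex shells *)

Section slab.
Context {R : realType}.
Local Open Scope ereal_scope.

(** The density is at most 1 / sqrt(2 pi), hence at most 1/2 because pi >= 2. *)
Lemma normal_prob_itv (c r : R) : (0 <= r)%R ->
  normal_prob (0:R) 1 `[c, (c + r)%R] <= (r / 2)%:E.
Proof.
move=> r0; rewrite /normal_prob.
apply: (@le_trans _ _ (\int[lebesgue_measure]_(x in `[c, (c + r)%R]) (2^-1)%:E)).
  apply: ge0_le_integral => //=.
  - by move=> x _; rewrite lee_fin normal_pdf_ge0.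
  - apply/measurable_funTS/measurableT_comp => //; exact: measurable_normal_pdf.
  move=> x _; rewrite lee_fin (le_trans (normal_pdf_ub _ _ _)) ?oner_eq0//.
  rewrite /normal_peak lef_pV2 ?posrE ?ltr0n// ?sqrtr_gt0.
    rewrite -(@ler_pXn2r _ 2) ?nnegrE// ?sqrtr_ge0// sqr_sqrtr.
      by have := pi_ge2 R; rewrite expr1n mul1r -mulr_natr; nra.
    by rewrite mulrn_wge0// mulr_ge0 ?pi_ge0.
  by rewrite mulrn_wgt0// mulr_gt0 ?pi_gt0 ?expr1n.
rewrite integral_cst//= lebesgue_measure_itv/= lte_fin.
case: ifPn => _; last by rewrite mule0 lee_fin divr_ge0.
by rewrite -EFinB -EFinM lee_fin addrAC subrr add0r mulrC.
Qed.

Lemma diam_sub_itv (E : set R) (r : R) : (0 <= r)%R ->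
  (forall x y, E x -> E y -> (y - x <= r)%R) -> exists c, E `<=` `[c, (c + r)%R].
Proof.
move=> r0 dE; have [->|/set0P[x0 Ex0]] := eqVneq E set0; first by exists 0%R.
exists (inf E) => x Ex /=; rewrite in_itv/=; apply/andP; split.
  apply: ge_inf => //; exists (x - r)%R => y Ey.
  by have := dE _ _ Ey Ex; rewrite lerBlDr lerBlDl.
rewrite -lerBlDr; apply: lb_le_inf; first by exists x0.
by move=> y Ey; have := dE _ _ Ey Ex; rewrite lerBlDr lerBlDl.
Qed.

(** [I] is an interval. Its points that leave it when moved right by [r] lie within distance [r] of
    each other, and so do those that leave it when moved left; each of the two pieces has mass at
    most [r / 2]. *)
Lemma normal_prob_erosion (I : set R) (r : R) : (0 <= r)%R -> measurable I ->
  measurable [set x | I (x + r)%R /\ I (x - r)%R] ->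
  (forall x y z, I x -> I y -> (x <= z <= y)%R -> I z) ->
  normal_prob (0:R) 1 I <= normal_prob (0:R) 1 [set x | I (x + r)%R /\ I (x - r)%R] + r%:E.
Proof.
move=> r0 mI mJ cI; set J := [set x | _].
have [c1 h1] : exists c, [set x | I x /\ ~ I (x + r)%R] `<=` `[c, (c + r)%R].
  apply: diam_sub_itv => // x y [Ix nx] [Iy ny].
  rewrite leNgt; apply/negP => h; apply: nx; apply: (cI x y) => //.
  by rewrite lerDl r0/= -lerBrDl ltW.
have [c2 h2] : exists c, [set x | I x /\ ~ I (x - r)%R] `<=` `[c, (c + r)%R].
  apply: diam_sub_itv => // x y [Ix nx] [Iy ny].
  rewrite leNgt; apply/negP => h; apply: ny; apply: (cI x y) => //.
  by rewrite gerBl r0 andbT lerBrDr -lerBrDl ltW.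
have IJ : I `<=` J `|` (`[c1, (c1 + r)%R] `|` `[c2, (c2 + r)%R]).
  move=> x Ix; have [p1|n1] := pselect (I (x + r)%R); last by right; left; apply: h1.
  by have [p2|n2] := pselect (I (x - r)%R); [left | right; right; apply: h2].
apply: (@le_trans _ _ (normal_prob (0:R) 1 (J `|` (`[c1, (c1 + r)%R] `|` `[c2, (c2 + r)%R])))).
  by apply: le_measure; rewrite ?inE//; apply: measurableU => //; apply: measurableU.
apply: le_trans; first by apply: measureU2 => //; apply: measurableU.
rewrite leeD2l//; apply: le_trans; first exact: measureU2.
rewrite (_ : r = (r / 2 + r / 2)%R); last by field.
by rewrite EFinD; apply: leeD; rewrite -?splitr; exact: normal_prob_itv.
Qed.

End slab.

Lemma eq_indic (R : realType) (T U : Type) (A : set T) (B : set U) (x : T) (y : U) :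
  (A x <-> B y) -> \1_A x = \1_B y :> R.
Proof.
move=> AB; rewrite !indicE; have [Ax|nAx] := pselect (A x).
  by rewrite !mem_set//; exact/AB.
by rewrite !memNset// => /AB.
Qed.

Lemma lerp_lt (R : realType) (t a b r : R) :
  0 <= t <= 1 -> a < r -> b < r -> t * a + (1 - t) * b < r.
Proof.
move=> /andP[t0 t1] ar br.
have [->|tn0] := eqVneq t 0; first by rewrite mul0r add0r subr0 mul1r.
rewrite [ltRHS](_ : r = t * r + (1 - t) * r); last by ring.
apply: ltr_leD; first by rewrite ltr_pM2l// lt_neqAle eq_sym tn0.
by rewrite ler_wpM2l ?subr_ge0// ltW.
Qed.

Lemma lerp_norm_lt (R : realType) (t a b r : R) :
  0 <= t <= 1 -> `|a| < r -> `|b| < r -> `|t * a + (1 - t) * b| < r.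
Proof.
move=> t01; rewrite !ltr_norml => /andP[a1 a2] /andP[b1 b2]; apply/andP; split.
  have h : t * - a + (1 - t) * - b < r by apply: lerp_lt => //; rewrite ltrNl.
  by rewrite -ltrN2 opprK opprD -!mulrN.
exact: lerp_lt.
Qed.

Section shell.
Context {R : realType}.

Definition cvx n (A : set 'rV[R]_n) :=
  forall x y (t : R), 0 <= t <= 1 -> A x -> A y -> A (t *: x + (1 - t) *: y).

Definition ei n (i : 'I_n) : 'rV[R]_n := delta_mx 0 i.

Lemma eiE n (i j : 'I_n) : ei i 0 j = (j == i)%:R.
Proof. by rewrite mxE eqxx. Qed.

(** For convex [A] the two endpoints already put the whole segment of half-length [r] inside [A]
    ([ero1P]), and a condition on two points visibly preserves openness. *)
Definition ero1 n (i : 'I_n) (r : R) (A : set 'rV[R]_n) :=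
  [set x | A (x + r *: ei i) /\ A (x - r *: ei i)].

Lemma ero1_cvx n (i : 'I_n) r A : cvx A -> cvx (ero1 i r A).
Proof.
move=> cA x y t t01 [x1 x2] [y1 y2]; split.
- have := cA _ _ t t01 x1 y1; congr A; apply/rowP => j; rewrite !mxE; ring.
- have := cA _ _ t t01 x2 y2; congr A; apply/rowP => j; rewrite !mxE; ring.
Qed.

Lemma open_transl n (u : 'rV[R]_n) (A : set 'rV[R]_n) : open A -> open [set x | A (x + u)].
Proof.
move=> oA; apply: rvP_open => x /= /(open_rvP oA)[e e0 eA]; exists e => // y xy.
by apply: eA => i; rewrite !mxE opprD addrACA subrr addr0.
Qed.

Lemma ero1_open n (i : 'I_n) r A : open A -> open (ero1 i r A).
Proof.
by move=> oA; apply: openI; [exact: open_transl | exact: (@open_transl _ (- (r *: ei i)) A)].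
Qed.

Lemma rmeas_indic n (A : set 'rV[R]_n) : open A -> rmeas (\1_A : _ -> R).
Proof.
move=> oA; rewrite /rmeas.
rewrite (_ : (fun _ => _) = \1_[set t : n.-tuple R | A (rv t)]).
  by apply: measurable_indic; exact: open_measurable_rv.
by apply/funext => t; exact: eq_indic.
Qed.

Lemma rmeas_indicE n (A : set 'rV[R]_n) : open A -> rmeas (fun v => (\1_A v : R)%:E).
Proof. by move=> oA; apply/measurable_EFinP; exact: rmeas_indic. Qed.

Lemma slice_open n (A : set 'rV[R]_n.+1) (x : R) : open A -> open [set v | A (rvc x v)].
Proof.
move=> oA; apply: rvP_open => v /= /(open_rvP oA)[e e0 eA]; exists e => // y xy.
apply: eA => i; case: (unliftP ord0 i) => [j ->|->]; first by rewrite !rvcS.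
by rewrite !rvc0 subrr normr0.
Qed.

Lemma rvc_comb n (x y a b : R) (u v : 'rV[R]_n) :
  rvc (a * x + b * y) (a *: u + b *: v) = a *: rvc x u + b *: rvc y v.
Proof.
apply: rvSP => [|i].
  by rewrite rvc0 !mxE /vcons !unlift_none.
by rewrite rvcS !mxE /vcons !liftK.
Qed.

Lemma slice_cvx n (A : set 'rV[R]_n.+1) (x : R) : cvx A -> cvx [set v | A (rvc x v)].
Proof.
move=> cA u v t t01 Au Av /=.
have := cA _ _ t t01 Au Av; rewrite -rvc_comb; congr (A (rvc _ _)); ring.
Qed.

Lemma line_open n (A : set 'rV[R]_n.+1) (v : 'rV[R]_n) : open A -> open [set x : R | A (rvc x v)].
Proof.
move=> oA; rewrite openE => x /= /(open_rvP oA)[e e0 eA]; apply/nbhs_ballP; exists e => // y.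
rewrite -ball_normE/= => xy; apply: eA => i.
case: (unliftP ord0 i) => [j ->|->]; last by rewrite !rvc0.
by rewrite !rvcS subrr normr0.
Qed.

Lemma integral_line n (A : set 'rV[R]_n.+1) (v : 'rV[R]_n) : open A ->
  (\int[normal_prob (0:R) 1]_x (\1_A (rvc x v))%:E = normal_prob (0:R) 1 [set x | A (rvc x v)])%E.
Proof.
move=> oA; have mA : measurable [set x | A (rvc x v)] by apply: open_measurable; exact: line_open.
by rewrite -[X in normal_prob _ _ X]setIT -integral_indic.
Qed.

Lemma rvc_ei0 n (x r : R) (v : 'rV[R]_n) : rvc x v + r *: ei ord0 = rvc (x + r) v.
Proof.
apply: rvSP => [|i]; first by rewrite rvc0 mxE rvc0 mxE eiE eqxx mulr1.
by rewrite rvcS mxE rvcS mxE eiE -val_eqE /= mulr0 addr0.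
Qed.

Lemma rvc_eiS n (i : 'I_n) (x r : R) (v : 'rV[R]_n) :
  rvc x v + r *: ei (lift ord0 i) = rvc x (v + r *: ei i).
Proof.
apply: rvSP => [|j]; first by rewrite rvc0 mxE rvc0 mxE eiE -val_eqE /= mulr0 addr0.
by rewrite rvcS !mxE /vcons !liftK/= (inj_eq lift_inj).
Qed.

(** Fubini reduces this to a line: in the first direction the first coordinate is integrated
    innermost and [normal_prob_erosion] applies to each line section; any other direction is a
    direction of the slices at a fixed first coordinate, where induction applies. *)
Lemma ero1_shell n (i : 'I_n) (r : R) (A : set 'rV[R]_n) : 0 <= r -> open A -> cvx A ->
  (\int[gaussn n]_t (\1_A (rv t))%:E <= \int[gaussn n]_t (\1_(ero1 i r A) (rv t))%:E + r%:E)%E.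
Proof.
move=> r0; elim: n i A => [[]//|n IH] i A oA cA.
have oE := @ero1_open _ i r _ oA.
have ind0 m (B : set 'rV[R]_m) v : (0 <= (\1_B v : R)%:E)%E by rewrite lee_fin.
have meas m (B : set 'rV[R]_m) : open B -> measurable_fun setT (fun t : m.-tuple R => (\1_B (rv t) : R)%:E).
  exact: rmeas_indicE.
case: (unliftP ord0 i) oE => [j ->|->] oE.
  rewrite (@ge0_gaussnS _ n (fun v => (\1_A v)%:E))//; last exact: rmeas_indicE.
  rewrite (@ge0_gaussnS _ n (fun v => (\1_(ero1 (lift ord0 j) r A) v)%:E))//; last exact: rmeas_indicE.
  have -> : r%:E = (\int[normal_prob (0:R) 1]_x r%:E)%E.
    by rewrite integral_cst// [X in (_ * X)%E](_ : _ = 1%E) ?mule1//; exact: probability_setT.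
  rewrite -ge0_integralD//; last 2 first.
  - by move=> x _; apply: integral_ge0.
  - by apply: (@measurable_gaussnS _ n (fun v => (\1_(ero1 (lift ord0 j) r A) v)%:E)) => //; exact: rmeas_indicE.
  apply: ge0_le_integral => //.
  - by move=> x _; apply: integral_ge0.
  - by apply: (@measurable_gaussnS _ n (fun v => (\1_A v)%:E)) => //; exact: rmeas_indicE.
  - apply: emeasurable_funD => //.
    by apply: (@measurable_gaussnS _ n (fun v => (\1_(ero1 (lift ord0 j) r A) v)%:E)) => //; exact: rmeas_indicE.
  move=> x _; have := IH j [set v | A (rvc x v)] (slice_open oA) (slice_cvx cA).
  congr (_ <= _ + _)%E.
  apply: eq_integral => t _; congr (_%:E); apply: eq_indic.
  by rewrite /ero1/= -!scaleNr !rvc_eiS.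
rewrite (@ge0_gaussnS_sym _ n (fun v => (\1_A v)%:E))//; last exact: rmeas_indicE.
rewrite (@ge0_gaussnS_sym _ n (fun v => (\1_(ero1 ord0 r A) v)%:E))//; last exact: rmeas_indicE.
have mG (B : set 'rV[R]_n.+1) : open B -> measurable_fun setT
   (fun t : n.-tuple R => \int[normal_prob (0:R) 1]_x (\1_B (rvc x (rv t)))%:E)%E.
  move=> oB.
  have := @measurable_fun_fubini_tonelli_G _ _ (measurableTypeR R) (n.-tuple R) R (normal_prob (0:R) 1)
    (fun p => (\1_B (rvc p.1 (rv p.2)))%:E).
  apply => //; apply: (@rmeas_cons _ n _ _ (fun v => (\1_B v)%:E)); exact: rmeas_indicE.
have -> : r%:E = (\int[gaussn n]_x r%:E)%E.
  by rewrite integral_cst// [X in (_ * X)%E](_ : _ = 1%E) ?mule1//; exact: probability_setT.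
rewrite -ge0_integralD//; last 2 first.
- by move=> x _; apply: integral_ge0.
- exact: mG.
apply: ge0_le_integral => //.
- by move=> x _; apply: integral_ge0.
- exact: mG.
- by apply: emeasurable_funD => //; exact: mG.
move=> t _; rewrite !integral_line//.
have -> : [set x | ero1 ord0 r A (rvc x (rv t))] =
    [set x | [set x | A (rvc x (rv t))] (x + r) /\ [set x | A (rvc x (rv t))] (x - r)].
  by apply/seteqP; split => x; rewrite /ero1/= -!scaleNr !rvc_ei0.
have mI : measurable [set x | A (rvc x (rv t))] by apply: open_measurable; exact: line_open.
apply: normal_prob_erosion => //.
  have := @open_measurable _ _ (@line_open _ _ (rv t) oE).
  congr measurable; apply/seteqP; split => x; by rewrite /ero1/= -!scaleNr !rvc_ei0.
move=> x y z /= Ax Ay /andP[xz zy].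
have [xy|xy] := ltP x y; last first.
  by have -> : z = x by apply/le_anti; rewrite xz (le_trans zy xy).
have d0 : 0 < y - x by rewrite subr_gt0.
have := cA _ _ ((y - z) / (y - x)) _ Ax Ay; rewrite -rvc_comb => h.
rewrite (_ : z = (y - z) / (y - x) * x + (1 - (y - z) / (y - x)) * y); last by field; rewrite gt_eqF.
rewrite (_ : rv t = (y - z) / (y - x) *: rv t + (1 - (y - z) / (y - x)) *: rv t); last first.
  by rewrite -scalerDl subrKC scale1r.
apply: h; rewrite divr_ge0 ?subr_ge0 ?(ltW xy)//= ler_pdivrMr// mul1r.
by rewrite lerD2l lerN2.
Qed.

Definition eroL n (r : R) (l : seq 'I_n) (A : set 'rV[R]_n) := foldr (fun i => ero1 i r) A l.

Lemma eroL_open n r (l : seq 'I_n) A : open A -> open (eroL r l A).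
Proof. by move=> oA; elim: l => //= i l IH; exact: ero1_open. Qed.

Lemma eroL_cvx n r (l : seq 'I_n) A : cvx A -> cvx (eroL r l A).
Proof. by move=> oA; elim: l => //= i l IH; exact: ero1_cvx. Qed.

Lemma eroL_shell n (r : R) (l : seq 'I_n) (A : set 'rV[R]_n) : 0 <= r -> open A -> cvx A ->
  (\int[gaussn n]_t (\1_A (rv t))%:E <=
   \int[gaussn n]_t (\1_(eroL r l A) (rv t))%:E + (r *+ size l)%:E)%E.
Proof.
move=> r0 oA cA; elim: l => [|i l IH] /=; first by rewrite mulr0n adde0.
apply: (le_trans IH); rewrite mulrS EFinD addeA leeD2r//.
by apply: ero1_shell => //; [exact: eroL_open | exact: eroL_cvx].
Qed.

Lemma ero1P n (i : 'I_n) (r u : R) (A : set 'rV[R]_n) (x : 'rV[R]_n) :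
  cvx A -> `|u| <= r -> ero1 i r A x -> A (x + u *: ei i).
Proof.
move=> cA ur [A1 A2].
have [r0|r0] := ltP 0 r; last first.
  have u0 : `|u| <= 0 by exact: le_trans ur r0.
  have uE : u = 0 by apply/eqP; rewrite -normr_le0.
  have rE : r = 0 by apply/le_anti; rewrite r0 -(normr0 R) -{1}uE ur.
  by move: A1; rewrite rE uE.
have := cA _ _ ((r + u) / (2 * r)) _ A1 A2.
rewrite (_ : _ *: _ + _ = x + u *: ei i); last first.
  by apply/rowP => j; rewrite !mxE; field; rewrite gt_eqF.
apply; move: ur; rewrite ler_norml => /andP[h1 h2].
by rewrite divr_ge0 ?ler_pdivrMr ?mul1r ?mulr_gt0//=; lra.
Qed.

Lemma eroLP n (r : R) (l : seq 'I_n) (A : set 'rV[R]_n) (x u : 'rV[R]_n) :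
  cvx A -> (forall i, `|u 0 i| <= r) -> eroL r l A x -> A (x + \sum_(i <- l) u 0 i *: ei i).
Proof.
move=> cA ur; elim: l x => [|i l IH] x /=; first by rewrite big_nil addr0.
move=> /(ero1P (eroL_cvx cA) (ur i)) /IH; congr A.
by rewrite big_cons addrA.
Qed.

Definition ero n (r : R) (A : set 'rV[R]_n) := eroL r (enum 'I_n) A.

Lemma eroP n (r : R) (A : set 'rV[R]_n) (x u : 'rV[R]_n) :
  cvx A -> (forall i, `|u 0 i| <= r) -> ero r A x -> A (x + u).
Proof.
move=> cA ur /(eroLP cA ur); congr (A (x + _)).
rewrite big_enum/= {2}(row_sum_delta u).
by apply: eq_bigr => i _; rewrite /ei.
Qed.

Lemma ero_shell n (r : R) (A : set 'rV[R]_n) : 0 <= r -> open A -> cvx A ->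
  (\int[gaussn n]_t (\1_A (rv t))%:E <=
   \int[gaussn n]_t (\1_(ero r A) (rv t))%:E + (n%:R * r)%:E)%E.
Proof.
move=> r0 oA cA; have := eroL_shell (enum 'I_n) r0 oA cA.
by rewrite size_enum_ord mulr_natl.
Qed.

(** The open neighbourhood of [A] in the sup norm. Cubes are used because they split into coordinate
    moves, which [ero1] measures one by one. *)
Definition cub n (r : R) (A : set 'rV[R]_n) :=
  [set x : 'rV[R]_n | exists2 y, A y & forall i, `|x 0 i - y 0 i| < r].

Lemma cub_open n r (A : set 'rV[R]_n) : open (cub r A).
Proof.
apply: rvP_open => x [y Ay xy].
have [m mr xm] : exists2 m : R, m < r & forall i, `|x 0 i - y 0 i| <= m.
  (* The maximum below needs a seed coordinate; in dimension 0 any number below [r] serves. *)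
  case: n A x y Ay xy => [|n] A x y Ay xy; first by exists (r - 1); [rewrite gtrBl|case].
  exists (\big[Order.max/`|x 0 ord0 - y 0 ord0|]_i `|x 0 i - y 0 i|).
    by apply: bigmax_lt => // i _; exact: xy.
  by move=> i; exact: le_bigmax.
exists (r - m) => [|z xz]; first by rewrite subr_gt0.
exists y => // i.
have := xz i; have := xm i; have := ler_normD (z 0 i - x 0 i) (x 0 i - y 0 i).
rewrite addrA subrK [in `|z 0 i - x 0 i|]distrC; lra.
Qed.

Lemma cub_cvx n r (A : set 'rV[R]_n) : cvx A -> cvx (cub r A).
Proof.
move=> cA x y t t01 [x' Ax' xx'] [y' Ay' yy'].
exists (t *: x' + (1 - t) *: y'); first exact: cA.
move=> i; have := lerp_norm_lt t01 (xx' i) (yy' i); rewrite !mxE.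
by congr (`|_| < _); ring.
Qed.

(* Interpolates between [cub r A] ([l] empty) and [A] ([l] exhausting ['I_n]), so that the erosion
   [ero r] can be undone one coordinate at a time. *)
Definition cubL n (r : R) (l : seq 'I_n) (A : set 'rV[R]_n) :=
  [set x : 'rV[R]_n | exists y, [/\ A y, forall i, `|x 0 i - y 0 i| < r &
     forall i, i \in l -> x 0 i = y 0 i]].

(** The witnesses for the two shifted points have their coordinate [i] strictly above and strictly
    below that of [x]. The convex combination that matches [x] in coordinate [i] stays close to [x]
    in all others and keeps the matches already obtained. *)
Lemma ero1_cubL n r (i : 'I_n) (l : seq 'I_n) A : cvx A ->
  ero1 i r (cubL r l A) `<=` cubL r (i :: l) A.
Proof.
move=> cA x [[y [Ay xy yl]] [z [Az xz zl]]].
have := xy i; rewrite !mxE !eqxx/= mulr1 ltr_norml => /andP[y1 y2].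
have := xz i; rewrite !mxE !eqxx/= mulr1 ltr_norml => /andP[z1 z2].
have d : 0 < y 0 i - z 0 i by lra.
pose t := (x 0 i - z 0 i) / (y 0 i - z 0 i).
have t0 : 0 <= t by rewrite divr_ge0 ?(ltW d)//; lra.
have t1 : t <= 1 by rewrite ler_pdivrMr//; lra.
have E j : (t *: y + (1 - t) *: z) 0 j = t * y 0 j + (1 - t) * z 0 j by rewrite !mxE.
have Ei : x 0 i = (t *: y + (1 - t) *: z) 0 i by rewrite E /t; field; rewrite gt_eqF.
have H j : j != i -> (x + r *: ei i) 0 j = x 0 j /\ (x - r *: ei i) 0 j = x 0 j.
  by move=> ji; rewrite !mxE /= (negbTE ji) mulr0 subr0 addr0.
exists (t *: y + (1 - t) *: z); split.
- by apply: cA => //; rewrite t0 t1.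
- move=> j; have [->|ji] := eqVneq j i.
    by rewrite -Ei subrr normr0; lra.
  have [h1 h2] := H j ji; have a := xy j; have b := xz j; rewrite h1 in a; rewrite h2 in b.
  have t01 : 0 <= t <= 1 by rewrite t0.
  by have := lerp_norm_lt t01 a b; rewrite E; congr (`|_| < _); ring.
- move=> j; rewrite inE => /orP[/eqP->//|jl].
  have [->//|ji] := eqVneq j i.
  have [h1 h2] := H j ji; have := yl j jl; have := zl j jl; rewrite h1 h2 E => <- <-; ring.
Qed.

Lemma eroS n r (i : 'I_n) (A B : set 'rV[R]_n) : A `<=` B -> ero1 i r A `<=` ero1 i r B.
Proof. by move=> AB x [h1 h2]; split; exact: AB. Qed.

(** Lets the shell outside [A] be measured as an erosion shell inside [cub r A]. *)
Lemma ero_cub n r (A : set 'rV[R]_n) : cvx A -> ero r (cub r A) `<=` A.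
Proof.
move=> cA.
have h (l : seq 'I_n) : eroL r l (cub r A) `<=` cubL r l A.
  elim: l => [|i l IH] /=; first by move=> x [y Ay xy]; exists y; split.
  by apply: subset_trans (ero1_cubL cA); exact: eroS.
move=> x /h[y [Ay _ xy]]; rewrite (_ : x = y)//.
by apply: rvP => i; apply: xy; rewrite mem_enum.
Qed.

Lemma sub_cub n r (A : set 'rV[R]_n) : 0 < r -> A `<=` cub r A.
Proof. by move=> r0 x Ax; exists x => // i; rewrite subrr normr0. Qed.

End shell.

(** * Averages over permutations *)

Section permavg.
Context {R : realType}.

Definition pavg N (f : {perm 'I_N} -> R) : R := (N`!%:R)^-1 * \sum_(s : {perm 'I_N}) f s.

Lemma factR_gt0 N : 0 < N`!%:R :> R.
Proof. by rewrite ltr0n fact_gt0. Qed.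

Lemma pavg_cst N (c : R) : pavg (fun _ : {perm 'I_N} => c) = c.
Proof.
rewrite /pavg sumr_const cardT -cardE card_Sn -[c *+ _]mulr_natl mulrA mulVf ?mul1r//.
Qed.

Lemma eq_pavg N (f g : {perm 'I_N} -> R) : (forall s, f s = g s) -> pavg f = pavg g.
Proof. by move=> fg; congr (_ * _); apply: eq_bigr => s _. Qed.

Lemma pavgD N (f g : {perm 'I_N} -> R) : pavg (fun s => f s + g s) = pavg f + pavg g.
Proof. by rewrite /pavg big_split mulrDr. Qed.

Lemma pavgZ N c (f : {perm 'I_N} -> R) : pavg (fun s => c * f s) = c * pavg f.
Proof. by rewrite /pavg -mulr_sumr mulrCA. Qed.

Lemma pavgN N (f : {perm 'I_N} -> R) : pavg (fun s => - f s) = - pavg f.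
Proof. by rewrite /pavg sumrN mulrN. Qed.

Lemma pavgB N (f g : {perm 'I_N} -> R) : pavg (fun s => f s - g s) = pavg f - pavg g.
Proof. by rewrite pavgD pavgN. Qed.

Lemma pavg_sum N (I : Type) (r : seq I) (P : pred I) (f : I -> {perm 'I_N} -> R) :
  pavg (fun s => \sum_(i <- r | P i) f i s) = \sum_(i <- r | P i) pavg (f i).
Proof. by rewrite /pavg exchange_big/= mulr_sumr. Qed.

Lemma le_pavg N (f g : {perm 'I_N} -> R) : (forall s, f s <= g s) -> pavg f <= pavg g.
Proof.
move=> fg; rewrite /pavg ler_wpM2l ?invr_ge0 ?ler0n//.
by apply: ler_sum => s _.
Qed.

Lemma pavg_ge0 N (f : {perm 'I_N} -> R) : (forall s, 0 <= f s) -> 0 <= pavg f.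
Proof. by move=> f0; rewrite -[leLHS](pavg_cst N); exact: le_pavg. Qed.

Lemma pavg_norm N (f : {perm 'I_N} -> R) : `|pavg f| <= pavg (fun s => `|f s|).
Proof.
rewrite ler_norml -pavgN; apply/andP; split; apply: le_pavg => s.
  by rewrite lerNl -normrN ler_norm.
exact: ler_norm.
Qed.

Lemma pavg_mulg N (t : {perm 'I_N}) (f : {perm 'I_N} -> R) :
  pavg (fun s => f (t * s)%g) = pavg f.
Proof. by rewrite /pavg [in RHS](reindex_inj (mulgI t)). Qed.

Lemma sum_lift_perm n (a : 'I_n.+1) (f : {perm 'I_n.+1} -> R) :
  \sum_(s : {perm 'I_n.+1} | s ord0 == a) f s = \sum_(t : {perm 'I_n}) f (lift_perm ord0 a t).
Proof.
rewrite (reindex (lift_perm ord0 a)); last first.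
  (* The inverse of [lift_perm]: delete [i] from the domain and its image [s i] from the range. *)
  pose ulsf i (s : 'S_n.+1) k := odflt k (unlift (s i) (s (lift i k))).
  have ulsfK i (s : 'S_n.+1) k: lift (s i) (ulsf i s k) = s (lift i k).
    rewrite /ulsf; have:= neq_lift i k.
    by rewrite -(can_eq (permK s)) => /unlift_some[] ? ? ->.
  have inj_ulsf: injective (ulsf ord0 _).
    move=> s; apply: can_inj (ulsf (s ord0) s^-1%g) _ => k'.
    by rewrite {1}/ulsf ulsfK !permK liftK.
  exists (fun s => perm (inj_ulsf s)) => [s _ | s].
    by apply/permP=> k'; rewrite permE /ulsf lift_perm_lift lift_perm_id liftK.
  move/(s _ =P _) => si0; apply/permP=> k.
  case: (unliftP ord0 k) => [k'|] ->; rewrite ?lift_perm_id //.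
  by rewrite lift_perm_lift -si0 permE ulsfK.
by apply: eq_bigl => t; rewrite lift_perm_id eqxx.
Qed.

Lemma pavgS n (f : {perm 'I_n.+1} -> R) :
  pavg f = n.+1%:R^-1 * \sum_a pavg (fun t : {perm 'I_n} => f (lift_perm ord0 a t)).
Proof.
rewrite /pavg (partition_big (fun s : 'S_n.+1 => s ord0) predT)//= factS natrM invfM -mulrA.
congr (_ * _); rewrite mulr_sumr; apply: eq_bigr => a _.
by rewrite sum_lift_perm.
Qed.

Lemma lift_tperm n (i j : 'I_n) :
  lift_perm ord0 ord0 (tperm i j) = tperm (lift ord0 i) (lift ord0 j).
Proof.
apply/permP => k; case: (unliftP ord0 k) => [k' ->|->].
  rewrite lift_perm_lift; case: (tpermP i j k') => [->|->|/eqP a /eqP b].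
  - by rewrite tpermL.
  - by rewrite tpermR.
  - by rewrite tpermD// (inj_eq lift_inj) eq_sym.
by rewrite lift_perm_id tpermD// -val_eqE.
Qed.

(* Efron-Stein type bound: expose the permutation one value at a time. *)
Lemma pavg_sqr_le N (f : {perm 'I_N} -> R) (c : R) :
  (forall s i j, `|f (tperm i j * s)%g - f s| <= c) ->
  pavg (fun s => f s ^+ 2) <= pavg f ^+ 2 + N%:R * c ^+ 2.
Proof.
elim: N f => [|n IH] f fc.
  rewrite mul0r addr0 (eq_pavg (g := fun=> f 1%g ^+ 2)) ?pavg_cst; last first.
    by move=> s; congr (f _ ^+ 2); apply/permP => -[].
  rewrite (eq_pavg (g := fun=> f 1%g)) ?pavg_cst// => s.
  by congr (f _); apply/permP => -[].
pose m a := pavg (fun t : {perm 'I_n} => f (lift_perm ord0 a t)).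
have fS : pavg f = n.+1%:R^-1 * \sum_a m a by rewrite pavgS.
have N0 : 0 < n.+1%:R :> R by rewrite ltr0n.
have h1 : pavg (fun s => f s ^+ 2) <= n.+1%:R^-1 * \sum_a (m a ^+ 2 + n%:R * c ^+ 2).
  rewrite pavgS ler_pM2l ?invr_gt0//; apply: ler_sum => a _.
  apply: IH => s i j.
  have -> : lift_perm ord0 a (tperm i j * s)%g =
     (tperm (lift ord0 i) (lift ord0 j) * lift_perm ord0 a s)%g.
    by rewrite -lift_tperm lift_permM.
  exact: fc.
have mE a : m a = (n`!%:R)^-1 * \sum_(s : 'S_n.+1 | s ord0 == a) f s by rewrite sum_lift_perm.
(* Following [s] by [tperm a b] matches the permutations with first value [a] to those with first
   value [b]. Read on positions it is a transposition applied before [s], so it changes [f] by at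
   most [c]. *)
have mdiff a b : `|m a - m b| <= c.
  have -> : m b = (n`!%:R)^-1 * \sum_(s : 'S_n.+1 | s ord0 == a) f (s * tperm a b)%g.
    rewrite mE; congr (_ * _).
    rewrite (reindex_inj (mulIg (tperm a b)))/=; apply: eq_bigl => s.
    by rewrite permM -(inj_eq (@perm_inj _ (tperm a b))) -permM -permM -mulgA tperm2 mulg1 tpermR.
  rewrite mE -mulrBr -sumrB normrM ger0_norm ?invr_ge0 ?ler0n//.
  rewrite mulrC ler_pdivrMr ?factR_gt0//.
  apply: le_trans (ler_norm_sum _ _ _) _.
  apply: (@le_trans _ _ (\sum_(s : 'S_n.+1 | s ord0 == a) c)).
    apply: ler_sum => s _.
    have -> : (s * tperm a b = tperm (s^-1 a) (s^-1 b) * s)%g.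
      by rewrite -[X in _ = (X * _)%g]tpermJ conjgE invgK -!mulgA mulVg mulg1.
    by rewrite distrC; exact: fc.
  rewrite sum_lift_perm sumr_const card_Sn -[leLHS]mulr_natr//.
have c0 : 0 <= c by exact: le_trans (mdiff ord0 ord0).
have h2 : \sum_a (m a) ^+ 2 <= n.+1%:R * (pavg f ^+ 2 + c ^+ 2).
  have dev a : `|m a - pavg f| <= c.
    have -> : m a - pavg f = n.+1%:R^-1 * \sum_b (m a - m b).
      rewrite sumrB sumr_const card_ord mulrBr -fS -[m a *+ _]mulr_natl mulrA mulVf ?mul1r//.
    rewrite normrM ger0_norm ?invr_ge0 ?ler0n// mulrC ler_pdivrMr//.
    apply: le_trans (ler_norm_sum _ _ _) _.
    apply: (@le_trans _ _ (\sum_(b < n.+1) c)); first by apply: ler_sum => b _.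
    by rewrite sumr_const card_ord mulr_natr.
  have sumE : \sum_a (m a - pavg f) ^+ 2 = \sum_a (m a) ^+ 2 - n.+1%:R * pavg f ^+ 2.
    transitivity (\sum_a ((m a) ^+ 2 + (- (2 * pavg f) * m a + pavg f ^+ 2))).
      by apply: eq_bigr => a _; ring.
    rewrite !big_split/= sumr_const card_ord -mulr_sumr -[X in _ + (_ + X)]mulr_natl.
    have -> : \sum_a m a = n.+1%:R * pavg f.
      by rewrite fS mulrA divff ?mul1r// gt_eqF.
    ring.
  have le2 : \sum_a (m a - pavg f) ^+ 2 <= n.+1%:R * c ^+ 2.
    apply: (@le_trans _ _ (\sum_(b < n.+1) c ^+ 2)); last by rewrite sumr_const card_ord mulr_natl.
    by apply: ler_sum => a _; rewrite -[leLHS]real_normK ?num_real// ler_sqr ?nnegrE.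
  by move: le2; rewrite sumE lerBlDr mulrDr addrC.
apply: (le_trans h1); rewrite mulrC ler_pdivrMr// big_split/= sumr_const card_ord.
apply: (le_trans (lerD h2 (lexx _))).
by rewrite -natr1 le_eqVlt; apply/orP; left; apply/eqP; ring.
Qed.

Lemma pavg_perm_coord N (i : 'I_N) (F : 'I_N -> R) :
  pavg (fun s => F (s i)) = N%:R^-1 * \sum_a F a.
Proof.
have N0 : (N%:R : R) != 0 by case: N i F => [[]//|N i _]; rewrite pnatr_eq0.
have sym j : pavg (fun s => F (s j)) = pavg (fun s => F (s i)).
  rewrite -(pavg_mulg (tperm i j) (fun s => F (s i))); apply: eq_pavg => s.
  by rewrite permM tpermL.
have : \sum_j pavg (fun s : 'S_N => F (s j)) = \sum_a F a.
  rewrite -pavg_sum -[RHS](pavg_cst N); apply: eq_pavg => s.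
  by rewrite [RHS](reindex_inj (@perm_inj _ s)).
under eq_bigr do rewrite sym.
rewrite sumr_const card_ord => <-.
by rewrite -[pavg _ *+ N]mulr_natl mulrA mulVf ?mul1r.
Qed.

End permavg.

(** * The exchangeable pair and its moments *)

Section stein.
Context {R : realType} (N H : nat) (M : 'I_H -> 'M[R]_N).

(** The change of [Gamma] when the values of [s] at [i] and [j] are exchanged; it vanishes for
    [i = j], so sums may run over all pairs. *)
Definition Dx (s : {perm 'I_N}) (i j : 'I_N) (h : 'I_H) : R :=
  M h i (s j) + M h j (s i) - M h i (s i) - M h j (s j).

Lemma Gamma_tperm s i j h : Gamma M (tperm i j * s)%g 0 h = Gamma M s 0 h + Dx s i j h.
Proof.
rewrite /Dx !mxE; have [->|ij] := eqVneq i j.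
  by rewrite tperm1 mul1g; ring.
rewrite (bigD1 i)//= (bigD1 j)/=; last by rewrite eq_sym.
rewrite [in RHS](bigD1 i)//= [in RHS](bigD1 j)/=; last by rewrite eq_sym.
rewrite !permM tpermL tpermR.
rewrite (eq_bigr (fun k => M h k (s k))); first by ring.
by move=> k /andP[ki kj]; rewrite permM tpermD// eq_sym.
Qed.

Lemma Dx_tperm s i j h : Dx (tperm i j * s)%g i j h = - Dx s i j h.
Proof. by rewrite /Dx !permM tpermL tpermR; ring. Qed.

Hypothesis rs : forall h i, \sum_j M h i j = 0.
Hypothesis cs : forall h j, \sum_i M h i j = 0.

Lemma sum_perm0 h i (s : {perm 'I_N}) : \sum_j M h i (s j) = 0.
Proof.
transitivity (\sum_j M h i j); last exact: rs.
by rewrite [RHS](reindex_inj (@perm_inj _ s)).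
Qed.

(** The linear regression property of the exchangeable pair: vanishing row and column sums kill the
    mixed entries. *)
Lemma sum_Dx (s : {perm 'I_N}) h : \sum_i \sum_j Dx s i j h = - (2 * N%:R) * Gamma M s 0 h.
Proof.
have -> : \sum_i \sum_j Dx s i j h =
  \sum_i (N%:R * - M h i (s i) - \sum_j M h j (s j)).
  apply: eq_bigr => i _; rewrite /Dx !big_split/= sum_perm0 cs.
  by rewrite sumr_const card_ord sumrN; ring.
rewrite big_split/= -mulr_sumr !sumrN !sumr_const card_ord !mxE; ring.
Qed.

Lemma pavg_exch (F : {perm 'I_N} -> {perm 'I_N} -> R) i j :
  pavg (fun s => F s (tperm i j * s)%g) = pavg (fun s => F (tperm i j * s)%g s).
Proof.
rewrite -(pavg_mulg (tperm i j) (fun s => F s (tperm i j * s)%g)).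
by apply: eq_pavg => s; rewrite mulgA tperm2 mul1g.
Qed.

(** By [sum_Dx], [Gamma] is -1 / (2 N) times the sum of the increments. The swap is measure
    preserving and flips the sign of [Dx], so half of that sum may be tested against [f] at the
    swapped permutation; hence the factor 1 / (4 N). *)
Lemma pavg_Gamma_test (f : {perm 'I_N} -> 'I_H -> R) : (0 < N)%N ->
  pavg (fun s => \sum_h Gamma M s 0 h * f s h) =
  (4 * N%:R)^-1 * pavg (fun s => \sum_i \sum_j \sum_h
     Dx s i j h * (f (tperm i j * s)%g h - f s h)).
Proof.
move=> N0; have N0R : (N%:R : R) != 0 by rewrite pnatr_eq0 -lt0n.
have step1 : pavg (fun s => \sum_h Gamma M s 0 h * f s h) =
   - (2 * N%:R)^-1 * pavg (fun s => \sum_i \sum_j \sum_h Dx s i j h * f s h).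
  rewrite -pavgZ; apply: eq_pavg => s.
  under [X in _ = _ * X]eq_bigr do rewrite exchange_big/=.
  rewrite exchange_big/= mulr_sumr; apply: eq_bigr => h _.
  under [X in _ = _ * X]eq_bigr do rewrite -mulr_suml.
  by rewrite -mulr_suml sum_Dx; field.
have step2 : pavg (fun s => \sum_i \sum_j \sum_h Dx s i j h * f (tperm i j * s)%g h) =
   - pavg (fun s => \sum_i \sum_j \sum_h Dx s i j h * f s h).
  rewrite !pavg_sum -sumrN; apply: eq_bigr => i _.
  rewrite !pavg_sum -sumrN; apply: eq_bigr => j _.
  rewrite (pavg_exch (fun s t => \sum_h Dx s i j h * f t h)) -pavgN.
  apply: eq_pavg => s; rewrite -sumrN; apply: eq_bigr => h _.
  by rewrite Dx_tperm mulNr.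
have -> : (fun s => \sum_i \sum_j \sum_h Dx s i j h * (f (tperm i j * s)%g h - f s h)) =
  (fun s => \sum_i \sum_j \sum_h Dx s i j h * f (tperm i j * s)%g h -
            \sum_i \sum_j \sum_h Dx s i j h * f s h).
  apply/funext => s; rewrite -sumrB; apply: eq_bigr => i _.
  rewrite -sumrB; apply: eq_bigr => j _; rewrite -sumrB; apply: eq_bigr => h _.
  by rewrite mulrBr.
rewrite pavgB step2 step1; field; exact: N0R.
Qed.

(** Second moment of the increment over a random pair, normalised so that its mean is the covariance
    of [Gamma] ([pavg_cov]); [Y3] is the third order analogue. *)
Definition Y2 (s : {perm 'I_N}) (h k : 'I_H) : R :=
  (4 * N%:R)^-1 * \sum_i \sum_j Dx s i j h * Dx s i j k.

Definition Y3 (s : {perm 'I_N}) (h k l : 'I_H) : R :=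
  (4 * N%:R)^-1 * \sum_i \sum_j Dx s i j h * Dx s i j k * Dx s i j l.

(** An odd power of the increment changes sign under the swap, which preserves the uniform law. *)
Lemma pavg_Y3 h k l : pavg (fun s => Y3 s h k l) = 0.
Proof.
have e : pavg (fun s => Y3 s h k l) = - pavg (fun s => Y3 s h k l).
  rewrite /Y3 pavgZ pavg_sum.
  under eq_bigr do rewrite pavg_sum.
  rewrite -mulrN -sumrN; congr (_ * _); apply: eq_bigr => i _.
  rewrite -sumrN; apply: eq_bigr => j _.
  rewrite -[LHS](pavg_mulg (tperm i j)) -pavgN; apply: eq_pavg => s.
  by rewrite !Dx_tperm; ring.
lra.
Qed.

(** Of the sixteen products, the eight with exactly one of the mixed entries [M i (s j)],
    [M j (s i)] sum to 0 along a full row or column; the other eight pair off into the four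
    terms. *)
Lemma sum_Dx2 (s : {perm 'I_N}) h k : \sum_i \sum_j Dx s i j h * Dx s i j k =
  2 * \tr ((M h)^T *m M k) + 2 * (\sum_i \sum_j M h i (s j) * M k j (s i)) +
  2 * N%:R * (\sum_i M h i (s i) * M k i (s i)) + 2 * (Gamma M s 0 h * Gamma M s 0 k).
Proof.
have trE : \tr ((M h)^T *m M k) = \sum_i \sum_j M h i j * M k i j.
  rewrite /mxtrace exchange_big/=; apply: eq_bigr => i _; rewrite mxE.
  by apply: eq_bigr => j _; rewrite mxE.
have trs : \tr ((M h)^T *m M k) = \sum_i \sum_j M h i (s j) * M k i (s j).
  rewrite trE; apply: eq_bigr => i _.
  by rewrite [LHS](reindex_inj (@perm_inj _ s)).
have aa : \sum_i \sum_j M h j (s i) * M k j (s i) = \tr ((M h)^T *m M k).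
  by rewrite trs exchange_big.
have ab : \sum_i \sum_j M h j (s i) * M k i (s j) = \sum_i \sum_j M h i (s j) * M k j (s i).
  by rewrite exchange_big.
have z1 (u v : 'I_H) (c : 'I_N -> R) : \sum_i \sum_j M u i (s j) * c i = 0.
  by rewrite big1// => i _; rewrite -mulr_suml sum_perm0 mul0r.
have z2 (u : 'I_H) (c : 'I_N -> R) : \sum_i \sum_j M u j (s i) * c i = 0.
  by rewrite big1// => i _; rewrite -mulr_suml cs mul0r.
have z3 (u : 'I_H) (c : 'I_N -> R) : \sum_i \sum_j M u i (s j) * c j = 0.
  by rewrite exchange_big z2.
have z4 (u : 'I_H) (c : 'I_N -> R) : \sum_i \sum_j M u j (s i) * c j = 0.
  by rewrite exchange_big z1.
have c1 : \sum_i \sum_(j < N) M h i (s i) * M k i (s i) = N%:R * (\sum_i M h i (s i) * M k i (s i)).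
  by rewrite mulr_sumr; apply: eq_bigr => i _; rewrite sumr_const card_ord mulr_natl.
have c2 : \sum_(i < N) \sum_j M h j (s j) * M k j (s j) = N%:R * (\sum_i M h i (s i) * M k i (s i)).
  by rewrite exchange_big c1.
have c3 : \sum_i \sum_j M h i (s i) * M k j (s j) = Gamma M s 0 h * Gamma M s 0 k.
  by rewrite !mxE mulr_suml; apply: eq_bigr => i _; rewrite mulr_sumr.
have c4 : \sum_i \sum_j M h j (s j) * M k i (s i) = Gamma M s 0 h * Gamma M s 0 k.
  by rewrite exchange_big c3.
pose S (F : 'I_N -> 'I_N -> R) := \sum_i \sum_j F i j.
have SD F G : S (fun i j => F i j + G i j) = S F + S G.
  by rewrite /S -big_split; apply: eq_bigr => i _; rewrite big_split.
have SB F G : S (fun i j => F i j - G i j) = S F - S G.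
  by rewrite /S -sumrB; apply: eq_bigr => i _; rewrite sumrB.
transitivity (S (fun i j =>
   (M h i (s j) * M k i (s j) + M h j (s i) * M k j (s i)
   + (M h i (s j) * M k j (s i) + M h j (s i) * M k i (s j))
   + (M h i (s i) * M k i (s i) + M h j (s j) * M k j (s j))
   + (M h i (s i) * M k j (s j) + M h j (s j) * M k i (s i)))
   - (M h i (s j) * M k i (s i) + M h i (s j) * M k j (s j)
   + (M h j (s i) * M k i (s i) + M h j (s i) * M k j (s j))
   + (M k i (s j) * M h i (s i) + M k i (s j) * M h j (s j))
   + (M k j (s i) * M h i (s i) + M k j (s i) * M h j (s j))))).
  by rewrite /S; apply: eq_bigr => i _; apply: eq_bigr => j _; rewrite /Dx; ring.
rewrite !SB !SD /S -trs aa ab c1 c2 c3 c4.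
rewrite (z1 h h (fun i => M k i (s i))) (z3 h (fun i => M k i (s i))).
rewrite (z2 h (fun i => M k i (s i))) (z4 h (fun i => M k i (s i))).
rewrite (z1 k h (fun i => M h i (s i))) (z3 k (fun i => M h i (s i))).
rewrite (z2 k (fun i => M h i (s i))) (z4 k (fun i => M h i (s i))).
ring.
Qed.

(** Testing the Stein identity against a component of [Gamma] shows that the mean of [Y2] is the
    covariance C. Averaging [sum_Dx2] expresses the same mean through the trace T and C, and the
    resulting equation N C = T + C determines C. *)
Lemma pavg_cov h k : (1 < N)%N ->
  pavg (fun s => Gamma M s 0 h * Gamma M s 0 k) = \tr ((M h)^T *m M k) / (N%:R - 1) /\
  pavg (fun s => Y2 s h k) = \tr ((M h)^T *m M k) / (N%:R - 1).
Proof.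
move=> N1; have N0 : (0 < N)%N by exact: ltnW.
have N0R : (N%:R : R) != 0 by rewrite pnatr_eq0 -lt0n.
have N1R : (N%:R - 1 : R) != 0 by rewrite subr_eq0 (eqr_nat R N 1) neq_ltn N1 orbT.
set T := \tr _; set C := pavg (fun s => Gamma M s 0 h * Gamma M s 0 k).
have YC : pavg (fun s => Y2 s h k) = C.
  have := @pavg_Gamma_test (fun s l => if l == h then Gamma M s 0 k else 0) N0.
  have E s : \sum_l Gamma M s 0 l * (if l == h then Gamma M s 0 k else 0) = Gamma M s 0 h * Gamma M s 0 k.
    rewrite (bigD1 h)//= eqxx big1 ?addr0// => l /negbTE ->; by rewrite mulr0.
  rewrite (eq_pavg E) -/C => ->; rewrite -pavgZ; apply: eq_pavg => s.
  congr (_ * _); apply: eq_bigr => i _; apply: eq_bigr => j _.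
  rewrite (bigD1 h)//= eqxx big1 ?addr0; last by move=> l /negbTE ->; rewrite subrr mulr0.
  by rewrite Gamma_tperm addrAC subrr add0r.
have S : pavg (fun s => \sum_i M h i (s i) * M k i (s i)) = N%:R^-1 * T.
  rewrite pavg_sum (eq_bigr (fun i => N%:R^-1 * \sum_a M h i a * M k i a)); last first.
    by move=> i _; rewrite (pavg_perm_coord i (fun a => M h i a * M k i a)).
  rewrite -mulr_sumr; congr (_ * _).
  rewrite /T /mxtrace exchange_big/=; apply: eq_bigr => i _; rewrite mxE.
  by apply: eq_bigr => j _; rewrite mxE.
have X : pavg (fun s => \sum_i \sum_j M h i (s j) * M k j (s i)) = C.
  rewrite /C pavg_sum (eq_pavg (g := fun s => \sum_i \sum_j M h i (s i) * M k j (s j))); last first.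
    by move=> s; rewrite !mxE mulr_suml; apply: eq_bigr => i _; rewrite mulr_sumr.
  rewrite pavg_sum; apply: eq_bigr => i _; rewrite !pavg_sum; apply: eq_bigr => j _.
  rewrite -[LHS](pavg_mulg (tperm i j)); apply: eq_pavg => s.
  by rewrite !permM tpermL tpermR.
have : pavg (fun s => Y2 s h k) = (4 * N%:R)^-1 * (2 * T + 2 * C + 2 * N%:R * (N%:R^-1 * T) + 2 * C).
  rewrite /Y2 pavgZ; congr (_ * _).
  rewrite (eq_pavg (fun s => sum_Dx2 s h k)).
  by rewrite !pavgD !pavgZ pavg_cst S X.
rewrite YC => e.
have : C * (N%:R - 1) = T.
  have : 4 * N%:R * C = 4 * T + 4 * C by rewrite {1}e; field.
  lra.
by move=> <-; rewrite mulfK.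
Qed.

End stein.

(** * Scalar inequalities and the exponential functional *)

Section scalar.
Context {R : realType}.

Lemma series_exp_le (x : R) N : 0 <= x -> series (exp_coeff x) N <= expR x.
Proof.
move=> x0; rewrite /expR; apply: nondecreasing_cvgn_le; last exact: is_cvg_series_exp_coeff.
by apply: nondecreasing_series => k _ _; rewrite /exp_coeff/= divr_ge0 ?exprn_ge0.
Qed.

Lemma exp_rem3 (y : R) : `|expR y - 1 - y - y ^+ 2 / 2| <= `|y| ^+ 3 * expR `|y|.
Proof.
pose u N := series (exp_coeff y) (N + 3)%N - (1 + y + y ^+ 2 / 2).
have uE N : `|u N| <= `|y| ^+ 3 * expR `|y|.
  have -> : u N = \sum_(k < N) y ^+ (k + 3)%N / (k + 3)%N`!%:R.
    rewrite /u /series/= addnC big_mkord big_split_ord/= !big_ord_recl big_ord0 /exp_coeff/=.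
    rewrite expr0 expr1 /bump/= add1n !factS fact0 !muln1 !divr1 addr0.
    rewrite (_ : 1 + (y + y ^+ 2 / 2%N%:R) = 1 + y + y ^+ 2 / 2); last by rewrite addrA.
    rewrite addrAC subrr add0r.
    by apply: eq_bigr => k _; rewrite addnC.
  apply: le_trans (ler_norm_sum _ _ _) _.
  apply: (@le_trans _ _ (`|y| ^+ 3 * series (exp_coeff `|y|) N)); last first.
    by rewrite ler_wpM2l ?exprn_ge0// series_exp_le.
  rewrite /series/= big_mkord mulr_sumr; apply: ler_sum => k _.
  rewrite normrM normrX normfV normr_nat exprD mulrAC mulrC /exp_coeff/= mulrA.
  rewrite -mulrA ler_wpM2l ?exprn_ge0//; rewrite ler_wpM2l ?exprn_ge0//.
  by rewrite lef_pV2 ?posrE ?ltr0n ?fact_gt0// ler_nat addn3 !factS !mulnA leq_pmull.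
have cu : u @ \oo --> expR y - (1 + y + y ^+ 2 / 2).
  apply: cvgB; last exact: cvg_cst.
  have := @is_cvg_series_exp_coeff R y.
  by rewrite -(cvg_shiftn 3).
rewrite (_ : _ - _ - _ - _ = expR y - (1 + y + y ^+ 2 / 2)); last by ring.
by apply: (cvgr_to_le (cvg_norm cu)); exact: nearW.
Qed.

(** The expression is the derivative at t = 1 of the Hermite generating function exp(t x - t^2 q /
    2), and the subtracted terms are He1, He2 and He3 / 2 for variance q. Counting q as two powers
    of x, what is left starts at order 4; [q <= m] brings the terms of order 5 and 6 back to m^4. *)
Lemma stein_rem (x q m : R) : `|x| <= m -> 0 <= q -> q <= m ^+ 2 -> q <= m ->
  `|(x - q) * expR (x - q / 2) - x - (x ^+ 2 - q) - (x ^+ 3 - 3 * q * x) / 2|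
    <= 10 * m ^+ 4 * expR (2 * m).
Proof.
move=> xm q0 qm2 qm; set y := x - q / 2.
have m0 : 0 <= m by exact: le_trans xm.
set r := expR y - 1 - y - y ^+ 2 / 2.
have ym : `|y| <= 3 / 2 * m.
  apply: le_trans (ler_normB _ _) _; rewrite [`|q / 2|]ger0_norm ?divr_ge0//; lra.
have rm : `|r| <= (3 / 2 * m) ^+ 3 * expR (2 * m).
  apply: le_trans (exp_rem3 y) _; apply: ler_pM; rewrite ?exprn_ge0 ?expR_ge0//.
    by rewrite lerXn2r ?nnegrE// (le_trans _ ym).
  by rewrite ler_expR; lra.
rewrite (_ : _ - _ - _ - _ = (q ^+ 2 / 2 - q * x ^+ 2 + 5 / 8 * (q ^+ 2 * x) - q ^+ 3 / 8) + (x - q) * r); last first.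
  by rewrite /r /y; field.
have e1 : 1 <= expR (2 * m) by rewrite -[leLHS]expR0 ler_expR mulr_ge0.
have m4 : 0 <= m ^+ 4 by rewrite exprn_ge0.
have xx : x ^+ 2 <= m ^+ 2 by rewrite -real_normK ?num_real// lerXn2r ?nnegrE.
have b1 : q ^+ 2 <= m ^+ 4 by rewrite (_ : m ^+ 4 = (m ^+ 2) ^+ 2); [rewrite lerXn2r ?nnegrE ?sqr_ge0 | ring].
have b2 : q * x ^+ 2 <= m ^+ 4.
  by rewrite (_ : m ^+ 4 = m ^+ 2 * m ^+ 2); [rewrite ler_pM ?sqr_ge0 | ring].
have q2m : q ^+ 2 <= m ^+ 3.
  by rewrite (_ : m ^+ 3 = m ^+ 2 * m) ?expr2; [rewrite ler_pM | ring].
have b3 : `|q ^+ 2 * x| <= m ^+ 4.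
  rewrite normrM ger0_norm ?sqr_ge0// (_ : m ^+ 4 = m ^+ 3 * m); last by ring.
  by rewrite ler_pM ?sqr_ge0.
have b4 : q ^+ 3 <= m ^+ 4.
  by rewrite [q ^+ 3]exprSr [m ^+ 4]exprSr ler_pM ?sqr_ge0.
have b5 : `|(x - q) * r| <= 27 / 4 * m ^+ 4 * expR (2 * m).
  rewrite normrM (_ : 27 / 4 * m ^+ 4 * expR (2 * m) = (2 * m) * ((3 / 2 * m) ^+ 3 * expR (2 * m))); last by field.
  apply: ler_pM => //; apply: le_trans (ler_normB _ _) _; rewrite [`|q|]ger0_norm//; lra.
have b6 : `|q ^+ 2 / 2 - q * x ^+ 2 + 5 / 8 * (q ^+ 2 * x) - q ^+ 3 / 8| <= 9 / 4 * m ^+ 4.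
  have q2 : 0 <= q ^+ 2 by exact: sqr_ge0.
  have qx : 0 <= q * x ^+ 2 by rewrite mulr_ge0 ?sqr_ge0.
  have q3 : 0 <= q ^+ 3 by rewrite exprn_ge0.
  move: b3; rewrite !ler_norml => /andP[b31 b32].
  move: (q ^+ 2) (q * x ^+ 2) (q ^+ 2 * x) (q ^+ 3) (m ^+ 4) b1 b2 b31 b32 b4 q2 qx q3 => *.
  by apply/andP; split; lra.
apply: le_trans (ler_normD _ _) _; apply: le_trans (lerD b6 b5) _.
have : m ^+ 4 <= m ^+ 4 * expR (2 * m) by rewrite ler_peMr.
rewrite -!mulrA; move: (m ^+ 4) (m ^+ 4 * expR (2 * m)) m4 => u v; lra.
Qed.

Lemma exp_poly (x : R) (k : nat) : 0 <= x -> x ^+ k <= k`!%:R * expR x.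
Proof.
move=> x0; case: k => [|k]; first by rewrite expr0 fact0 mul1r -[leLHS]expR0 ler_expR.
have := expR_ge1Dxn k x0 => h.
rewrite -ler_pdivrMl ?ltr0n ?fact_gt0// mulrC; apply: le_trans h; by rewrite lerDr.
Qed.

Lemma mean_le_sum (n : nat) (x y : 'I_n -> R) : (forall i, x i <= y i) ->
  n%:R^-1 * \sum_i x i <= n%:R^-1 * \sum_i y i.
Proof. by move=> xy; rewrite ler_wpM2l ?invr_ge0 ?ler0n// ler_sum. Qed.

(** Jensen's inequality through a supporting line at the mean: averaging kills the linear part. *)
Lemma mean_tangent (n : nat) (x f : 'I_n -> R) (a b : R) : (0 < n)%N ->
  (forall i, a + b * (x i - n%:R^-1 * \sum_j x j) <= f i) -> a <= n%:R^-1 * \sum_i f i.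
Proof.
move=> n0 h; have nR : (n%:R : R) != 0 by rewrite pnatr_eq0 -lt0n.
apply: le_trans (mean_le_sum h).
have constE (c : R) : \sum_(i < n) c = n%:R * c by rewrite sumr_const card_ord mulr_natl.
rewrite big_split/= constE -mulr_sumr sumrB constE.
rewrite [leRHS](_ : _ = a)//; field; exact: nR.
Qed.

Lemma jensen_expR (n : nat) (x : 'I_n -> R) : (0 < n)%N ->
  expR (n%:R^-1 * \sum_i x i) <= n%:R^-1 * \sum_i expR (x i).
Proof.
move=> n0; set m := _^-1 * _.
apply: (@mean_tangent _ x _ _ (expR m)) => // i; rewrite -/m.
rewrite -{2}(subrK m (x i)) expRD -[X in X + _]mulr1 -mulrDr mulrC ler_wpM2r ?expR_ge0//.
exact: expR_ge1Dx.
Qed.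

Lemma jensen_cube (n : nat) (x : 'I_n -> R) : (0 < n)%N -> (forall i, 0 <= x i) ->
  (n%:R^-1 * \sum_i x i) ^+ 3 <= n%:R^-1 * \sum_i x i ^+ 3.
Proof.
move=> n0 x0; set m := _^-1 * _.
have m0 : 0 <= m by rewrite mulr_ge0 ?invr_ge0 ?ler0n// sumr_ge0.
apply: (@mean_tangent _ x _ _ (3 * m ^+ 2)) => // i; rewrite -/m.
rewrite -[leLHS]add0r -lerBrDr (_ : x i ^+ 3 - _ = (x i - m) ^+ 2 * (x i + 2 * m)); last by ring.
by apply: mulr_ge0; [exact: sqr_ge0 | apply: addr_ge0 => //; exact: mulr_ge0].
Qed.

End scalar.

Section Sn.
Context {R : realType}.

Definition L1 n (z : 'rV[R]_n) : R := \sum_i `|z 0 i|.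
(* [Sn] controls the [k]-th power of the l1 norm by [n ^ k] and each coordinate by [n ^ (1/4)], while
   its moments do not depend on [n]; the [n ^ (1/4)] is the source of the exponent 13/4. *)
Definition Sn n (z : 'rV[R]_n) : R := n%:R^-1 * \sum_i expR `|z 0 i|.

Lemma L1_ge0 n (z : 'rV[R]_n) : 0 <= L1 z.
Proof. exact: sumr_ge0. Qed.

Lemma Sn_exp n (z : 'rV[R]_n) : (0 < n)%N -> expR (n%:R^-1 * L1 z) <= Sn z.
Proof. exact: jensen_expR. Qed.

Lemma Sn_ge1 n (z : 'rV[R]_n) : (0 < n)%N -> 1 <= Sn z.
Proof.
move=> n0; apply: le_trans (Sn_exp z n0).
by rewrite -[leLHS]expR0 ler_expR mulr_ge0 ?invr_ge0 ?ler0n ?L1_ge0.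
Qed.

Lemma L1_pow n (z : 'rV[R]_n) k : (0 < n)%N -> L1 z ^+ k <= k`!%:R * n%:R ^+ k * Sn z.
Proof.
move=> n0; have nR : 0 < (n%:R : R) by rewrite ltr0n.
have := @exp_poly R (n%:R^-1 * L1 z) k; rewrite mulr_ge0 ?invr_ge0 ?ler0n ?L1_ge0// => /(_ isT) h.
rewrite mulrAC -ler_pdivrMr ?exprn_gt0// -exprVn mulrC -exprMn; apply: (le_trans h).
by rewrite ler_wpM2l// Sn_exp.
Qed.

(** One exponential is at most [n * Sn z], and expR t >= (t / 4)^4. Taking fourth roots turns n into
    [nu], and the root of [Sn z] is at most [Sn z] because [Sn z >= 1]. *)
Lemma coord_Sn n (z : 'rV[R]_n) i (nu : R) : 0 <= nu -> nu ^+ 4 = n%:R -> `|z 0 i| <= 4 * nu * Sn z.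
Proof.
move=> nu0 nuE; have n0 : (0 < n)%N by case: n i {z nuE} => [[]|].
have nR : 0 < (n%:R : R) by rewrite ltr0n.
have S1 := Sn_ge1 z n0.
have S0 : 0 <= Sn z by lra.
have h1 : expR `|z 0 i| <= n%:R * Sn z.
  rewrite /Sn mulrA divff ?mul1r ?gt_eqF// (bigD1 i)//= lerDl.
  by apply: sumr_ge0 => j _; exact: expR_ge0.
have h2 : (`|z 0 i| / 4) ^+ 4 <= expR `|z 0 i|.
  rewrite [in leRHS](_ : `|z 0 i| = 4%:R * (`|z 0 i| / 4)); last by field.
  rewrite expRM_natl lerXn2r ?nnegrE ?expR_ge0 ?divr_ge0//.
  by apply: le_trans (expR_ge1Dx _); rewrite lerDr.
have h3 : n%:R * Sn z <= (nu * Sn z) ^+ 4.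
  rewrite exprMn nuE ler_wpM2l ?ler0n// exprS ler_peMr// exprn_ege1//.
have h4 : `|z 0 i| / 4 <= nu * Sn z.
  rewrite -(@ler_pXn2r _ 4) ?nnegrE ?divr_ge0 ?(mulr_ge0 nu0 S0)//.
  by apply: le_trans h3; apply: le_trans h1.
by move: h4; rewrite ler_pdivrMr// mulrC mulrA.
Qed.

(** Convexity of the cube reduces the moment to a single coordinate. Three powers are needed later:
    two from [bracket_bound] and one from the shell estimate [pavg_Delta_le]. *)
Lemma Sn_moment n : (0 < n)%N -> gI (fun z : 'rV[R]_n => Sn z ^+ 3) /\
  gE (fun z : 'rV[R]_n => Sn z ^+ 3) <= expmom 3.
Proof.
move=> n0; have nR : (n%:R : R) != 0 by rewrite pnatr_eq0 -lt0n.
pose g (z : 'rV[R]_n) := n%:R^-1 * \sum_i expR (3 * `|z 0 i|).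
have gi : gI g by apply: gI_Z; apply: gI_sum => i _; exact: (gexp i 3).1.
have gEg : gE g = expmom 3.
  rewrite gE_Z ?gE_sum; last 2 first.
  - by move=> i _; exact: (gexp i 3).1.
  - by apply: gI_sum => i _; exact: (gexp i 3).1.
  under eq_bigr do rewrite (gexp _ 3).2.
  by rewrite sumr_const card_ord -[expmom 3 *+ n]mulr_natl mulrA mulVf ?mul1r.
have le (z : 'rV[R]_n) : Sn z ^+ 3 <= g z.
  apply: le_trans (jensen_cube n0 _) _ => [i|]; first exact: expR_ge0.
  by apply: mean_le_sum => i; rewrite -expRM_natl.
have mS : rmeas (fun z : 'rV[R]_n => Sn z ^+ 3).
  apply: measurable_funX; apply: measurable_funM => //; apply: measurable_sum => i.
  apply: measurableT_comp => //; apply: measurableT_comp => //; exact: measurable_rv_coord.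
have Si : gI (fun z : 'rV[R]_n => Sn z ^+ 3).
  apply: (gI_le mS) gi => z; rewrite ger0_norm ?le// exprn_ge0//.
  by apply: le_trans (Sn_ge1 z n0).
by split=> //; rewrite -gEg; apply: gE_le.
Qed.

End Sn.

(** * Fluctuations of the moments of the increments *)

Section variance.
Context {R : realType}.

Lemma pavg_abs_le N (f : {perm 'I_N} -> R) (K : R) : 0 <= K ->
  pavg (fun s => f s ^+ 2) <= K ^+ 2 -> pavg (fun s => `|f s|) <= K.
Proof.
move=> K0 fK; set m := pavg _.
have m0 : 0 <= m by apply: pavg_ge0.
have : 0 <= pavg (fun s => (`|f s| - m) ^+ 2) by apply: pavg_ge0 => s; exact: sqr_ge0.
rewrite (eq_pavg (g := fun s => f s ^+ 2 + (- (2 * m) * `|f s| + m ^+ 2))); last first.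
  by move=> s; rewrite -[f s ^+ 2]real_normK ?num_real//; ring.
rewrite !pavgD pavgZ pavg_cst -/m => h.
rewrite -(@ler_pXn2r _ 2) ?nnegrE//; apply: le_trans fK.
by move: h; move: (pavg _) => x; nra.
Qed.

(** At most 4 N pairs meet [k] or [l], and on each of them [F] and [G] differ by at most 2 c. *)
Lemma sum_change N (F G : 'I_N -> 'I_N -> R) (k l : 'I_N) (c : R) :
  (forall i j, i != k -> i != l -> j != k -> j != l -> F i j = G i j) ->
  (forall i j, `|F i j| <= c) -> (forall i j, `|G i j| <= c) ->
  `|\sum_i \sum_j F i j - \sum_i \sum_j G i j| <= 8 * N%:R * c.
Proof.
move=> FG Fc Gc; have c0 : 0 <= c by exact: le_trans (Fc k k).
have b i j : `|F i j - G i j| <= 2 * c * ((i == k)%:R + (i == l)%:R + (j == k)%:R + (j == l)%:R).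
  have h : `|F i j - G i j| <= 2 * c.
    apply: le_trans (ler_normB _ _) _; have := Fc i j; have := Gc i j; lra.
  have [] := boolP [|| i == k, i == l, j == k | j == l]; last first.
    rewrite !negb_or => /and4P[a1 a2 a3 a4].
    by rewrite FG// subrr normr0 !mulr_ge0 ?addr_ge0.
  move=> e; apply: (le_trans h); rewrite ler_peMr ?mulr_ge0//.
  by rewrite -!natrD (ler_nat R 1); move: e; do 4 case: (_ == _).
rewrite -sumrB; under eq_bigr do rewrite -sumrB.
apply: le_trans (ler_norm_sum _ _ _) _.
apply: (@le_trans _ _ (\sum_i \sum_j 2 * c * ((i == k)%:R + (i == l)%:R + (j == k)%:R + (j == l)%:R))).
  apply: ler_sum => i _; apply: le_trans (ler_norm_sum _ _ _) _.
  by apply: ler_sum => j _; exact: b.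
have d (a : 'I_N) : \sum_(i < N) (i == a)%:R = 1 :> R.
  by rewrite (bigD1 a)//= eqxx big1 ?addr0// => i /negbTE ->.
have cst (x : R) : \sum_(i < N) x = N%:R * x by rewrite sumr_const card_ord mulr_natl.
under eq_bigr do rewrite -mulr_sumr !big_split/= !cst !d.
rewrite -mulr_sumr !big_split/= -!mulr_sumr !d !cst.
rewrite le_eqVlt; apply/orP; left; apply/eqP; ring.
Qed.

Section Ybounds.
Variables (N H : nat) (M : 'I_H -> 'M[R]_N) (B : R).
Hypothesis N0 : (0 < N)%N.
Hypothesis MB : forall h i j, `|M h i j| <= B.

Lemma Dx_le s i j h : `|Dx M s i j h| <= 4 * B.
Proof.
have h1 := MB h i (s j); have h2 := MB h j (s i); have h3 := MB h i (s i); have h4 := MB h j (s j).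
rewrite /Dx; move: h1 h2 h3 h4; rewrite !ler_norml => /andP[? ?] /andP[? ?] /andP[? ?] /andP[? ?].
by apply/andP; split; lra.
Qed.

Lemma Dx_far s k l i j h : i != k -> i != l -> j != k -> j != l ->
  Dx M (tperm k l * s)%g i j h = Dx M s i j h.
Proof.
by move=> ik il jk jl; rewrite /Dx !permM !tpermD// eq_sym.
Qed.

Let B0 (h : 'I_H) : 0 <= B.
Proof. by apply: le_trans (MB h (Ordinal N0) (Ordinal N0)). Qed.

Let NR : (N%:R : R) != 0. Proof. by rewrite pnatr_eq0 -lt0n. Qed.
Let NR0 : 0 < (N%:R : R). Proof. by rewrite ltr0n. Qed.

Lemma Y2_change s k l h h' : `|Y2 M (tperm k l * s)%g h h' - Y2 M s h h'| <= 32 * B ^+ 2.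
Proof.
rewrite /Y2 -mulrBr normrM ger0_norm ?invr_ge0 ?mulr_ge0//.
rewrite mulrC ler_pdivrMr ?mulr_gt0//.
have := @sum_change N (fun i j => Dx M (tperm k l * s)%g i j h * Dx M (tperm k l * s)%g i j h')
  (fun i j => Dx M s i j h * Dx M s i j h') k l ((4 * B) * (4 * B)).
move=> /(_ _ _ _); rewrite (_ : 8 * N%:R * (4 * B * (4 * B)) = 32 * B ^+ 2 * (4 * N%:R)); last by ring.
apply.
- by move=> i j ik il jk jl; rewrite !Dx_far.
- by move=> i j; rewrite normrM ler_pM// Dx_le.
- by move=> i j; rewrite normrM ler_pM// Dx_le.
Qed.

Lemma Y3_change s k l h h' h'' :
  `|Y3 M (tperm k l * s)%g h h' h'' - Y3 M s h h' h''| <= 128 * B ^+ 3.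
Proof.
rewrite /Y3 -mulrBr normrM ger0_norm ?invr_ge0 ?mulr_ge0//.
rewrite mulrC ler_pdivrMr ?mulr_gt0//.
have := @sum_change N (fun i j => Dx M (tperm k l * s)%g i j h * Dx M (tperm k l * s)%g i j h'
     * Dx M (tperm k l * s)%g i j h'')
  (fun i j => Dx M s i j h * Dx M s i j h' * Dx M s i j h'') k l ((4 * B) * (4 * B) * (4 * B)).
move=> /(_ _ _ _); rewrite (_ : 8 * N%:R * (4 * B * (4 * B) * (4 * B)) = 128 * B ^+ 3 * (4 * N%:R)); last by ring.
apply.
- by move=> i j ik il jk jl; rewrite !Dx_far.
- by move=> i j; rewrite !normrM ler_pM ?mulr_ge0// ?Dx_le// ler_pM// Dx_le.
- by move=> i j; rewrite !normrM ler_pM ?mulr_ge0// ?Dx_le// ler_pM// Dx_le.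
Qed.

Hypothesis N1 : (1 < N)%N.
Hypothesis S1 : conditionS1 M.

(** Condition S1 makes the variable centred, and one transposition changes it by at most 32 B^2, so
    [pavg_sqr_le] leaves N (32 B^2)^2. *)
Lemma pavg_X2 h k : pavg (fun s => ((h == k)%:R - Y2 M s h k) ^+ 2) <= 1024 * N%:R * B ^+ 4.
Proof.
have [rs cs tr1 tr2] := S1.
have m0 : pavg (fun s => (h == k)%:R - Y2 M s h k) = 0.
  rewrite pavgB pavg_cst (pavg_cov rs cs h k N1).2.
  have N1R : (N%:R - 1 : R) != 0 by rewrite subr_eq0 (eqr_nat R N 1) neq_ltn N1 orbT.
  by have [->|hk] := eqVneq h k; [rewrite tr1 divff// subrr | rewrite tr2// mul0r subrr].
have := @pavg_sqr_le R N (fun s => (h == k)%:R - Y2 M s h k) (32 * B ^+ 2).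
rewrite m0 expr0n/= add0r (_ : N%:R * (32 * B ^+ 2) ^+ 2 = 1024 * N%:R * B ^+ 4); last by ring.
apply => s i j; rewrite opprB addrA addrAC -addrA.
rewrite (_ : _ + _ = Y2 M s h k - Y2 M (tperm i j * s)%g h k); last by ring.
by rewrite distrC Y2_change.
Qed.

Lemma pavg_Y3_abs h k l (q : R) : 0 <= q -> q ^+ 2 = N%:R ->
  pavg (fun s => `|Y3 M s h k l|) <= 128 * q * B ^+ 3.
Proof.
move=> q0 qE; have [rs cs tr1 tr2] := S1.
apply: pavg_abs_le; first by rewrite !mulr_ge0 ?exprn_ge0 ?(B0 h).
have := @pavg_sqr_le R N (fun s => Y3 M s h k l) (128 * B ^+ 3).
rewrite pavg_Y3 expr0n/= add0r -qE (_ : q ^+ 2 * (128 * B ^+ 3) ^+ 2 = (128 * q * B ^+ 3) ^+ 2); last by ring.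
by apply => s i j; exact: Y3_change.
Qed.

(** The trace is the sum of the squares of N^2 entries, hence at most N^2 B^2, while N - 1 >= N /
    2. *)
Lemma NB2_ge (h : 'I_H) : 2^-1 <= N%:R * B ^+ 2.
Proof.
have [rs cs tr1 tr2] := S1; have := tr1 h.
have -> : \tr ((M h)^T *m M h) = \sum_i \sum_j M h i j ^+ 2.
  rewrite /mxtrace exchange_big/=; apply: eq_bigr => i _; rewrite mxE.
  by apply: eq_bigr => j _; rewrite mxE expr2.
move=> e; have : \sum_i \sum_j M h i j ^+ 2 <= \sum_(i < N) \sum_(j < N) B ^+ 2.
  apply: ler_sum => i _; apply: ler_sum => j _.
  by rewrite -real_normK ?num_real// lerXn2r ?nnegrE ?(B0 h).
have cst (x : R) : \sum_(i < N) x = N%:R * x by rewrite sumr_const card_ord mulr_natl.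
rewrite !cst e => h1.
have N2 : 2 <= (N%:R : R) by rewrite (ler_nat R 2).
rewrite -(ler_pM2l NR0); apply: le_trans h1; lra.
Qed.

End Ybounds.
End variance.

(** * Rotation and Stein identity *)

Section derive_pointwise.
Context {R : realType}.
Implicit Types (f g : R -> R) (x df dg : R).

Lemma isd_eq f x df dg : is_derive x 1 f df -> df = dg -> is_derive x 1 f dg.
Proof. by move=> h <-. Qed.

Lemma isdM f g x df dg : is_derive x 1 f df -> is_derive x 1 g dg ->
  is_derive x 1 (fun y => f y * g y) (f x * dg + g x * df).
Proof. by move=> hf hg; exact: (is_deriveM hf hg). Qed.

Lemma isdD f g x df dg : is_derive x 1 f df -> is_derive x 1 g dg ->
  is_derive x 1 (fun y => f y + g y) (df + dg).
Proof. by move=> hf hg; exact: (is_deriveD hf hg). Qed.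

Lemma isdB f g x df dg : is_derive x 1 f df -> is_derive x 1 g dg ->
  is_derive x 1 (fun y => f y - g y) (df - dg).
Proof. by move=> hf hg; exact: (is_deriveB hf hg). Qed.

Lemma isd_cst (c x : R) : is_derive x 1 (fun _ : R => c) 0.
Proof. exact: is_derive_cst. Qed.

Lemma isdZ f x df (c : R) : is_derive x 1 f df -> is_derive x 1 (fun y => c * f y) (c * df).
Proof. by move=> hf; apply: isd_eq (isdM (isd_cst c x) hf) _; rewrite mulr0 addr0. Qed.

Lemma isdX f x df n : is_derive x 1 f df ->
  is_derive x 1 (fun y => f y ^+ n) (n%:R * f x ^+ n.-1 * df).
Proof.
move=> hf; elim: n => [|n IH].
  by under eq_fun do rewrite expr0; apply: isd_eq (isd_cst 1 x) _; rewrite !mul0r.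
under eq_fun do rewrite exprS.
apply: isd_eq (isdM hf IH) _; rewrite -natr1.
by case: n {IH} => [|n]/=; [rewrite mul0r mul0r mulr0 expr0 | rewrite [f x ^+ n.+1]exprS]; ring.
Qed.

Lemma isdV f x df : f x != 0 -> is_derive x 1 f df ->
  is_derive x 1 (fun y => (f y)^-1) (- (f x)^-2 * df).
Proof. by move=> f0 hf; exact: (is_deriveV f0 hf). Qed.

Lemma isd_comp f g x df dg : is_derive (g x) 1 f df -> is_derive x 1 g dg ->
  is_derive x 1 (fun y => f (g y)) (df * dg).
Proof. by move=> hf hg; exact: (is_derive1_comp hf hg). Qed.

Lemma isd_exp f x df : is_derive x 1 f df ->
  is_derive x 1 (fun y => expR (f y)) (expR (f x) * df).
Proof. by move=> hf; apply: isd_comp hf; exact: is_derive_expR. Qed.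

Lemma isd_sum (I : Type) (r : seq I) (F : I -> R -> R) (dF : I -> R) x :
  (forall i, is_derive x 1 (F i) (dF i)) ->
  is_derive x 1 (fun y => \sum_(i <- r) F i y) (\sum_(i <- r) dF i).
Proof.
move=> h; elim: r => [|i r IH].
  by under eq_fun do rewrite big_nil; rewrite big_nil; exact: isd_cst.
by under eq_fun do rewrite big_cons; rewrite big_cons; exact: isdD.
Qed.

End derive_pointwise.

(** * The rotated Gaussian kernel and its derivative *)

Section kernel.
Context {R : realType}.

(** With a = |y|^2, d = y.w and e = |w|^2 this is the density at y of cos th w + sin th Z relative
    to Z. Written in these scalars, its dependence on th is one-variable calculus; [kb] is its
    logarithmic derivative. *)
Definition kf (n : nat) (a d e th : R) : R :=
  (sin th)^-1 ^+ n * expR (a / 2 - (a - 2 * (cos th * d) + cos th ^+ 2 * e) * (sin th)^-1 ^+ 2 / 2).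

Definition kb (n : nat) (a d e th : R) : R :=
  cos th / sin th * ((a - 2 * (cos th * d) + cos th ^+ 2 * e) / sin th ^+ 2 - n%:R)
  - (d - cos th * e) / sin th.

Lemma is_derive_kf n a d e th : sin th != 0 ->
  is_derive th 1 (kf n a d e) (kf n a d e th * kb n a d e th).
Proof.
move=> s0; rewrite /kf.
have dc := is_derive_cos th; have ds := is_derive_sin th.
have dsV := isdV s0 ds.
have h1 := isdX n dsV.
have h2 := isdD (isdB (isd_cst a th) (isdZ 2 (isdM dc (isd_cst d th))))
   (isdM (isdX 2 dc) (isd_cst e th)).
have h3 := isdM h2 (isdX 2 dsV).
have h4 := isd_exp (isdB (isd_cst (a / 2) th) (isdM h3 (isd_cst 2^-1 th))).
apply: isd_eq (isdM h1 h4) _.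
have cs : cos th ^+ 2 = 1 - sin th ^+ 2 by rewrite -[in RHS](cos2Dsin2 th) addrK.
rewrite /kb /=; set E := expR _.
have -> : n%:R * (sin th)^-1 ^+ n.-1 * (- (sin th)^-2 * cos th) = (sin th)^-1 ^+ n * (- n%:R * cos th / sin th).
  by case: n {h1} => [|m]; [rewrite !mul0r mulNr !mul0r oppr0 !mul0r mulr0 | rewrite /= [(sin th)^-1 ^+ m.+1]exprSr -exprVn; field].
move: ((sin th)^-1 ^+ n) E => u E.
move: cs s0; move: (sin th) (cos th) => s c cs s0.
have -> : c ^+ 2 * e = (1 - s ^+ 2) * e by rewrite cs.
rewrite !expr1.
have c3 : c ^+ 3 = c * (1 - s ^+ 2) by rewrite exprS cs.
transitivity (u * E * (- (n%:R * c) / s + (- (2 * d * s) + 2 * c * s * e) * s^-1 ^+ 2 / 2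
   + (a - 2 * (c * d) + (1 - s ^+ 2) * e) * s^-1 ^+ 3 * c)).
  by rewrite -!exprVn; field.
by field: c3.
Qed.

Definition dotp n (u v : 'rV[R]_n) : R := \sum_i u 0 i * v 0 i.

Definition gker n (w : 'rV[R]_n) (th : R) (y : 'rV[R]_n) : R :=
  kf n (dotp y y) (dotp y w) (dotp w w) th.

Definition kerb n (w : 'rV[R]_n) (th : R) (y : 'rV[R]_n) : R :=
  kb n (dotp y y) (dotp y w) (dotp w w) th.

Lemma dotp_sub n (y w : 'rV[R]_n) (c : R) :
  dotp (y - c *: w) (y - c *: w) = dotp y y - 2 * (c * dotp y w) + c ^+ 2 * dotp w w.
Proof.
rewrite /dotp !mulr_sumr -sumrB -big_split/=; apply: eq_bigr => i _; rewrite !mxE; ring.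
Qed.

Lemma dotp_ge0 n (y : 'rV[R]_n) : 0 <= dotp y y.
Proof. by apply: sumr_ge0 => i _; rewrite -expr2 sqr_ge0. Qed.

Lemma gker_nw n (w : 'rV[R]_n) (th : R) (y : 'rV[R]_n) : 0 < sin th ->
  nw (cos th *: w) (sin th) y = gker w th y.
Proof.
move=> s0; rewrite /nw /affw big_split/= prodr_const card_ord /gker /kf; congr (_ * _).
rewrite -expR_sum; congr expR; rewrite -dotp_sub sumrB; congr (_ - _).
  by rewrite /dotp mulr_suml; apply: eq_bigr => i _; rewrite expr2.
by rewrite /dotp !mulr_suml; apply: eq_bigr => i _; rewrite !mxE; field; rewrite gt_eqF.
Qed.

Lemma gker_ge0 n (w : 'rV[R]_n) (th : R) (y : 'rV[R]_n) : 0 < sin th -> 0 <= gker w th y.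
Proof. by move=> s0; rewrite -gker_nw// nw_ge0. Qed.

(** After clearing sin^2, the inequality between the exponents says that |w - cos th y|^2 >= 0. The
    bound is uniform in [y], as domination under the integral requires. *)
Lemma gker_ub n (w : 'rV[R]_n) (th c : R) (y : 'rV[R]_n) : 0 < c -> c <= sin th ->
  gker w th y <= c^-1 ^+ n * expR (dotp w w / 2).
Proof.
move=> c0 cs; have s0 : 0 < sin th by exact: lt_le_trans cs.
rewrite /gker /kf ler_pM ?exprn_ge0 ?invr_ge0 ?expR_ge0 ?(ltW s0)//.
  by rewrite lerXn2r ?nnegrE ?invr_ge0 ?(ltW s0) ?(ltW c0)// lef_pV2.
rewrite ler_expR exprVn -!mulrBl ler_pM2r ?invr_gt0// lerBlDr -lerBlDl.
rewrite ler_pdivlMr ?exprn_gt0//.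
have := dotp_ge0 (w - cos th *: y); rewrite dotp_sub (_ : dotp w y = dotp y w); last first.
  by apply: eq_bigr => i _; rewrite mulrC.
have := cos2Dsin2 th; move: (dotp _ _) (dotp y w) (dotp y y) (cos th) (sin th) => e d a co si h1 h2.
have -> : si ^+ 2 = 1 - co ^+ 2 by lra.
nra.
Qed.

Lemma kerbE n (w : 'rV[R]_n) (th : R) (z : 'rV[R]_n) : sin th != 0 ->
  kerb w th (cos th *: w + sin th *: z) = cos th / sin th * (dotp z z - n%:R) - dotp z w.
Proof.
move=> s0; rewrite /kerb /kb.
have -> : dotp (cos th *: w + sin th *: z) (cos th *: w + sin th *: z) -
   2 * (cos th * dotp (cos th *: w + sin th *: z) w) + cos th ^+ 2 * dotp w w = sin th ^+ 2 * dotp z z.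
  rewrite -dotp_sub addrAC subrr add0r /dotp mulr_sumr; apply: eq_bigr => i _; rewrite !mxE; ring.
have -> : dotp (cos th *: w + sin th *: z) w = cos th * dotp w w + sin th * dotp z w.
  rewrite /dotp !mulr_sumr -big_split/=; apply: eq_bigr => i _; rewrite !mxE; ring.
by field.
Qed.

Lemma rmeas_coord n i : rmeas (fun y : 'rV[R]_n => y 0 i).
Proof. exact: measurable_rv_coord. Qed.

Lemma rmeas_dotp n (w : 'rV[R]_n) : rmeas (fun y => dotp y w).
Proof.
apply: measurable_sum => i; apply: measurable_funM => //; exact: rmeas_coord.
Qed.

Lemma rmeas_dotpp n : rmeas (fun y : 'rV[R]_n => dotp y y).
Proof.
apply: measurable_sum => i; apply: measurable_funM; exact: rmeas_coord.
Qed.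

Lemma rmeas_num n (w : 'rV[R]_n) (c e : R) :
  rmeas (fun y => dotp y y - 2 * (c * dotp y w) + e).
Proof.
apply: measurable_funD => //; apply: measurable_funB; first exact: rmeas_dotpp.
by apply: measurable_funM => //; apply: measurable_funM => //; exact: rmeas_dotp.
Qed.

Lemma rmeas_ker n (w : 'rV[R]_n) th : rmeas (gker w th).
Proof.
apply: measurable_funM => //; apply: measurableT_comp => //; apply: measurable_funB.
  by apply: measurable_funM => //; exact: rmeas_dotpp.
apply: measurable_funM => //; apply: measurable_funM => //; exact: rmeas_num.
Qed.

Lemma rmeas_kerb n (w : 'rV[R]_n) th : rmeas (kerb w th).
Proof.
apply: measurable_funB.
  apply: measurable_funM => //; apply: measurable_funB => //.
  by apply: measurable_funM => //; exact: rmeas_num.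
by apply: measurable_funM => //; apply: measurable_funB => //; exact: rmeas_dotp.
Qed.

(** An integrable envelope, uniform over [sin th >= c]: squares of coordinates are absorbed into
    exponentials, whose integrability is known from [gexp]. *)
Lemma kerb_ub n (w : 'rV[R]_n) (th c : R) (y : 'rV[R]_n) : 0 < c -> c <= sin th ->
  `|kerb w th y| <= (c^-1 + 1) * c^-1 ^+ 2 * (4 * (\sum_i expR (1 * `|y 0 i|)) + 2 * dotp w w)
     + c^-1 * n%:R + dotp w w.
Proof.
move=> c0 cs; have s0 : 0 < sin th by exact: lt_le_trans cs.
pose z := (sin th)^-1 *: (y - cos th *: w).
have yE : y = cos th *: w + sin th *: z.
  by rewrite /z scalerA divff ?gt_eqF// scale1r addrC subrK.
rewrite {1}yE kerbE ?gt_eqF//.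
have w0 := dotp_ge0 w; have z0 := dotp_ge0 z.
have zw : `|dotp z w| <= dotp z z + dotp w w.
  apply: le_trans (ler_norm_sum _ _ _) _; rewrite -big_split/=; apply: ler_sum => i _.
  rewrite ler_norml; apply/andP; split; nra.
have cV : (sin th)^-1 <= c^-1 by rewrite lef_pV2.
have cV0 : 0 < c^-1 by rewrite invr_gt0.
have zz : dotp z z <= c^-1 ^+ 2 * (4 * (\sum_i expR (1 * `|y 0 i|)) + 2 * dotp w w).
  have -> : dotp z z = (sin th)^-1 ^+ 2 * dotp (y - cos th *: w) (y - cos th *: w).
    rewrite /z /dotp mulr_sumr; apply: eq_bigr => i _; rewrite !mxE; ring.
  apply: ler_pM; rewrite ?exprn_ge0 ?invr_ge0 ?(ltW s0) ?dotp_ge0//.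
    by rewrite lerXn2r ?nnegrE ?invr_ge0 ?(ltW s0) ?(ltW c0).
  rewrite /dotp !mulr_sumr -big_split/=; apply: ler_sum => i _.
  rewrite !mxE mul1r.
  have h := @exp_poly R `|y 0 i| 2 (normr_ge0 _).
  rewrite real_normK ?num_real//= in h; have {}h : y 0 i ^+ 2 <= 2 * expR `|y 0 i| by [].
  have c2 : cos th ^+ 2 <= 1 by have := cos2Dsin2 th; have := sqr_ge0 (sin th); lra.
  have c2w : cos th ^+ 2 * w 0 i ^+ 2 <= w 0 i ^+ 2 by rewrite ler_piMl ?sqr_ge0.
  have := sqr_ge0 (y 0 i + cos th * w 0 i).
  move: c2w h; move: (expR `|y 0 i|) (y 0 i) (w 0 i) (cos th) => E a b co; nra.
apply: le_trans (ler_normB _ _) _; rewrite normrM.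
have cs1 : `|cos th / sin th| <= c^-1.
  rewrite normrM normfV [`|sin th|]gtr0_norm// -[leRHS]mul1r ler_pM ?invr_ge0 ?(ltW s0)//.
  by rewrite ler_norml cos_geN1 cos_le1.
have h2 : `|dotp z z - n%:R| <= dotp z z + n%:R.
  by apply: le_trans (ler_normB _ _) _; rewrite ger0_norm// normr_nat.
have h3 : `|cos th / sin th| * `|dotp z z - n%:R| <= c^-1 * (dotp z z + n%:R) by apply: ler_pM.
set X := _ * (4 * _ + _) in zz; rewrite -[_ * _ * (4 * _ + _)]mulrA -/X.
have this : (c^-1 + 1) * dotp z z <= (c^-1 + 1) * X by rewrite ler_pM2l// addr_gt0.
apply: le_trans (lerD h3 zw) _.
by clear -this; lra.
Qed.

(** The probability that cos th w + sin th Z lies in [A], with th carried by the kernel and not by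
    the indicator, so that it is differentiable in th. *)
Definition Uf n (A : set 'rV[R]_n) (w : 'rV[R]_n) (th : R) : R :=
  gE (fun y => \1_A y * gker w th y).

Lemma indic_le1 n (A : set 'rV[R]_n) y : `|\1_A y : R| <= 1.
Proof. by rewrite indicE normr_nat; case: (_ \in _); rewrite ?lerr ?ler01. Qed.

Lemma gI_indM n (A : set 'rV[R]_n) (f : 'rV[R]_n -> R) : open A -> gI f ->
  gI (fun y => \1_A y * f y).
Proof.
move=> oA fi; apply: (@gI_le _ _ _ (fun v => `|f v|)).
- by apply: measurable_funM; [exact: rmeas_indic | exact: (gI_meas fi)].
- by move=> v; rewrite normrM ler_piMl// indic_le1.
- exact: (integrable_norm fi).
Qed.

(** Differentiation under the integral on a neighbourhood where the sine stays above c = sin th / 2;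
    the product [G] of the two envelopes dominates there. *)
Lemma is_derive_Uf n (A : set 'rV[R]_n) (w : 'rV[R]_n) (th : R) : open A -> 0 < sin th ->
  gI (fun y => \1_A y * (gker w th y * kerb w th y)) /\
  is_derive th 1 (Uf A w) (gE (fun y => \1_A y * (gker w th y * kerb w th y))).
Proof.
move=> oA s0.
have [dl dl0 dlP] : exists2 dl : R, 0 < dl & forall x, `|th - x| < dl -> sin th / 2 < sin x.
  have : \forall x \near th, sin th / 2 < sin x.
    by have /cvgr_gt := @continuous_sin R th; apply; rewrite ltr_pdivrMr// ltr_pMr// ltr1n.
  move=> /nbhs_ballP[e /= e0 eP]; exists e => // x xe; exact: eP.
pose c := sin th / 2; have c0 : 0 < c by rewrite divr_gt0.
pose f x (t : n.-tuple R) := \1_A (rv t) * gker w x (rv t).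
pose G (y : 'rV[R]_n) := c^-1 ^+ n * expR (dotp w w / 2) *
   ((c^-1 + 1) * c^-1 ^+ 2 * (4 * (\sum_i expR (1 * `|y 0 i|)) + 2 * dotp w w)
     + c^-1 * n%:R + dotp w w).
have cV : 0 <= c^-1 by rewrite invr_ge0 ltW.
have G0 y : 0 <= G y.
  rewrite /G !mulr_ge0 ?exprn_ge0 ?expR_ge0// !addr_ge0 ?dotp_ge0// !mulr_ge0 ?exprn_ge0 ?addr_ge0//.
  - by rewrite mulr_ge0// sumr_ge0// => i _; exact: expR_ge0.
  - by rewrite mulr_ge0// dotp_ge0.
have iG : gI G.
  apply: gI_Z; apply: gI_D; last exact: gI_cst.
  apply: gI_D; last exact: gI_cst.
  apply: gI_Z; apply: gI_D; last exact: gI_cst.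
  by apply: gI_Z; apply: gI_sum => i _; exact: (gexp i 1).1.
have Ith : `]th - dl, th + dl[%classic th.
  by rewrite /= in_itv/= ltrBlDr !ltrDl dl0.
have II x : `]th - dl, th + dl[%classic x -> c <= sin x.
  rewrite /= in_itv/= => /andP[x1 x2]; apply: ltW; apply: dlP.
  by rewrite ltr_norml; apply/andP; split; lra.
have fi x : `]th - dl, th + dl[%classic x -> (gaussn n).-integrable setT (EFin \o f x).
  move=> /II cx; apply: (@gI_indM n A (gker w x) oA).
  apply: (@gI_le _ n _ (fun=> c^-1 ^+ n * expR (dotp w w / 2))); last exact: gI_cst.
    exact: rmeas_ker.
  by move=> v; rewrite ger0_norm ?gker_ub ?gker_ge0// (lt_le_trans c0).
have df x t : `]th - dl, th + dl[%classic x ->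
    is_derive x 1 (f ^~ t) (\1_A (rv t) * (gker w x (rv t) * kerb w x (rv t))).
  move=> /II cx; apply: isdZ; apply: is_derive_kf.
  by rewrite gt_eqF// (lt_le_trans c0).
have d1E x t : `]th - dl, th + dl[%classic x ->
    partial1of2 f x t = \1_A (rv t) * (gker w x (rv t) * kerb w x (rv t)).
  by move=> /(df x t) h; rewrite partial1of2E; exact: derive_val.
have Gb x t : `]th - dl, th + dl[%classic x -> setT t -> `|partial1of2 f x t| <= G (rv t).
  move=> xI _; rewrite d1E//; have cx := II _ xI.
  rewrite normrM -[leRHS]mul1r ler_pM ?indic_le1// normrM ler_pM//.
  - by rewrite ger0_norm ?gker_ub ?gker_ge0// (lt_le_trans c0).
  - exact: kerb_ub.
have fd x t : `]th - dl, th + dl[%classic x -> setT t -> derivable (f ^~ t) x 1.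
  by move=> xI _; have [] := df x t xI.
split.
  apply: (@gI_le _ n _ G) => //.
    apply: measurable_funM; first exact: rmeas_indic.
    by apply: measurable_funM; [exact: rmeas_ker | exact: rmeas_kerb].
  move=> v; rewrite normrM -[leRHS]mul1r ler_pM ?indic_le1// normrM ler_pM//.
  - by rewrite ger0_norm ?gker_ub ?gker_ge0//; exact: II.
  - by apply: kerb_ub => //; exact: II.
have D := @derivable_under_integral R _ _ (gaussn n) f setT measurableT th _ _ Ith fi fd (G \o @rv R n) (fun t => G0 _) iG Gb.
apply: DeriveDef => //.
rewrite -derive1E (@differentiation_under_integral R _ _ (gaussn n) f setT measurableT th _ _ Ith fi fd (G \o @rv R n) (fun t => G0 _) iG Gb).
by apply: eq_Rintegral => t _; exact: d1E.
Qed.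

End kernel.

(** * Gaussian moments from the kernel *)

Section moments.
Context {R : realType}.

(** The Cameron-Martin density: the standard normal translated by [a], relative to the untranslated
    one. *)
Definition Ga n (a z : 'rV[R]_n) : R := expR (dotp a z - dotp a a / 2).

Lemma dotpC n (u v : 'rV[R]_n) : dotp u v = dotp v u.
Proof. by apply: eq_bigr => i _; rewrite mulrC. Qed.

Lemma dotpDl n (u v w : 'rV[R]_n) : dotp (u + v) w = dotp u w + dotp v w.
Proof. by rewrite /dotp -big_split/=; apply: eq_bigr => i _; rewrite !mxE mulrDl. Qed.

Lemma dotpZl n c (u v : 'rV[R]_n) : dotp (c *: u) v = c * dotp u v.
Proof. by rewrite /dotp mulr_sumr; apply: eq_bigr => i _; rewrite !mxE mulrA. Qed.

Lemma nw_Ga n (a z : 'rV[R]_n) : nw a 1 z = Ga a z.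
Proof.
rewrite /nw /affw /Ga.
transitivity (\prod_(i < n) expR (a 0 i * z 0 i - a 0 i * a 0 i / 2)).
  by apply: eq_bigr => i _; rewrite invr1 mul1r; congr expR; field.
by rewrite -expR_sum /dotp mulr_suml sumrB.
Qed.

Lemma gI_coord n (i : 'I_n) : gI (fun z : 'rV[R]_n => z 0 i).
Proof.
apply: (gI_le _ _ (gexp i 1).1); first exact: rmeas_coord.
move=> v; rewrite mul1r; apply: le_trans (expR_ge1Dx _); by rewrite lerDr.
Qed.

Lemma gI_coord2 n (i j : 'I_n) : gI (fun z : 'rV[R]_n => z 0 i * z 0 j).
Proof.
apply: (@gI_le _ n _ (fun z => expR (1 * `|z 0 i|) + expR (1 * `|z 0 j|))).
- by apply: measurable_funM; exact: rmeas_coord.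
- move=> z; rewrite !mul1r normrM.
  have h1 := exp_poly 2 (normr_ge0 (z 0 i)); have h2 := exp_poly 2 (normr_ge0 (z 0 j)).
  have e : (2`!%:R : R) = 2 by [].
  rewrite e in h1 h2; have := sqr_ge0 (`|z 0 i| - `|z 0 j|).
  move: h1 h2; move: (expR `|z 0 i|) (expR `|z 0 j|) (`|z 0 i|) (`|z 0 j|) => a b c d; nra.
- by apply: gI_D; [exact: (gexp i 1).1 | exact: (gexp j 1).1].
Qed.

Lemma gI_dotpp n : gI (fun z : 'rV[R]_n => dotp z z).
Proof. by apply: gI_sum => i _; exact: gI_coord2. Qed.

Lemma gI_dotp n (w : 'rV[R]_n) : gI (fun z => dotp z w).
Proof.
apply: gI_sum => i _; under [X in gI X]eq_fun do rewrite mulrC.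
by apply: gI_Z; exact: gI_coord.
Qed.

Lemma gE_ker n (f : 'rV[R]_n -> R) (w : 'rV[R]_n) (th : R) : 0 < sin th -> rmeas f ->
  gE (fun y => f y * gker w th y) = gE (fun z => f (cos th *: w + sin th *: z)).
Proof.
move=> s0 mf; rewrite gE_affine//; congr gE; apply/funext => y.
by rewrite gker_nw.
Qed.

Lemma gker_mass n (w : 'rV[R]_n) (th : R) : 0 < sin th -> Uf setT w th = 1.
Proof.
move=> s0; rewrite /Uf gE_ker//; last by apply: rmeas_indic; exact: openT.
rewrite (_ : (fun _ => _) = (fun=> 1)) ?gE_cst//.
by apply/funext => y; rewrite indicT.
Qed.

(** The kernel has total mass 1 for every angle, so the derivative of [Uf setT] is 0; [is_derive_Uf]
    and [kerbE] write this derivative as the expectation here. *)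
Lemma gE_centered n (w : 'rV[R]_n) (th : R) : 0 < sin th ->
  gE (fun z => cos th / sin th * (dotp z z - n%:R) - dotp z w) = 0.
Proof.
move=> s0; have oT : open [set: 'rV[R]_n] by exact: openT.
have [_ D] := is_derive_Uf w oT s0.
have D0 : is_derive th 1 (Uf setT w) 0.
  have h : \forall x \near th, (fun=> 1) x = Uf setT w x.
    have : \forall x \near th, 0 < sin x by have /cvgr_gt := @continuous_sin R th; apply.
    by apply: filterS => x x0; rewrite gker_mass.
  exact: (near_eq_is_derive h (isd_cst 1 th)).
have : gE (fun y => \1_setT y * (gker w th y * kerb w th y)) = 0.
  by rewrite -(@derive_val _ _ _ _ _ _ _ D) (@derive_val _ _ _ _ _ _ _ D0).
rewrite (_ : (fun y => _) = (fun y => kerb w th y * gker w th y)); last first.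
  by apply/funext => y; rewrite indicT mul1r mulrC.
rewrite gE_ker//; last exact: rmeas_kerb.
move=> <-; congr gE; apply/funext => z; rewrite kerbE// gt_eqF//.
Qed.

(** Any angle with nonzero sine and cosine serves: at w = 0 [gE_centered] gives the mean of |z|^2,
    and general w then gives that of z.w. *)
Let th0 : R := pi / 4.
Let sth0 : 0 < sin th0 :> R.
Proof. by apply: sin_gt0_pihalf; rewrite /th0; have := pi_gt0 R; lra. Qed.
Let cth0 : 0 < cos th0 :> R.
Proof. by apply: cos_gt0_pihalf; rewrite /th0; have := pi_gt0 R; lra. Qed.

Lemma gE_dotpp n : gE (fun z : 'rV[R]_n => dotp z z) = n%:R.
Proof.
have := @gE_centered n 0 th0 sth0.
rewrite (_ : (fun z => _) = (fun z => cos th0 / sin th0 * (dotp z z - n%:R))); last first.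
  apply/funext => z; rewrite (_ : dotp z 0 = 0) ?subr0//.
  by rewrite /dotp big1// => i _; rewrite mxE mulr0.
have i1 : gI (fun z : 'rV[R]_n => dotp z z - n%:R) by apply: gI_B; [exact: gI_dotpp | exact: gI_cst].
rewrite gE_Z// gE_B ?gE_cst; [|exact: gI_dotpp|exact: gI_cst].
move=> /eqP; rewrite mulf_eq0 mulf_eq0 invr_eq0 (gt_eqF sth0) (gt_eqF cth0)/= subr_eq0.
by move=> /eqP.
Qed.

Lemma gE_dotp n (w : 'rV[R]_n) : gE (fun z => dotp z w) = 0.
Proof.
have := @gE_centered n w th0 sth0.
have i1 : gI (fun z : 'rV[R]_n => dotp z z - n%:R) by apply: gI_B; [exact: gI_dotpp | exact: gI_cst].
rewrite gE_B; [|exact: gI_Z|exact: gI_dotp].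
rewrite gE_Z// gE_B ?gE_cst; [|exact: gI_dotpp|exact: gI_cst].
by rewrite gE_dotpp subrr mulr0 sub0r => /eqP; rewrite oppr_eq0 => /eqP.
Qed.

(** [Ga a] translates the normal by [a], which turns the first factor into the linear form in [d],
    of mean 0. *)
Lemma gE_dotp_Ga n (d a : 'rV[R]_n) :
  gI (fun z => (dotp d z - dotp d a) * Ga a z) /\
  gE (fun z => (dotp d z - dotp d a) * Ga a z) = 0.
Proof.
have mf : rmeas (fun z => dotp d z - dotp d a).
  by apply: measurable_funB => //; under eq_fun do rewrite dotpC; exact: rmeas_dotp.
have Gw : (fun z => (dotp d z - dotp d a) * Ga a z) = (fun z => (dotp d z - dotp d a) * nw a 1 z).
  by apply/funext => z; rewrite nw_Ga.
have sh : (fun z => dotp d (a + 1 *: z) - dotp d a) = (fun z => dotp z d).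
  apply/funext => z; rewrite scale1r dotpC dotpDl dotpC addrAC subrr add0r//.
rewrite Gw; split; last first.
  by rewrite -(@gE_affine _ n (fun z => dotp d z - dotp d a))// sh gE_dotp.
by apply: gI_affine_inv => //; rewrite sh; exact: gI_dotp.
Qed.

End moments.

(** * The Stein identity under the kernel *)

Section exchange.
Context {R : realType}.

Lemma gI_pavg N n (f : {perm 'I_N} -> 'rV[R]_n -> R) : (forall s, gI (f s)) ->
  gI (fun v => pavg (fun s => f s v)).
Proof. by move=> h; apply: gI_Z; apply: gI_sum. Qed.

Lemma gE_pavg N n (f : {perm 'I_N} -> 'rV[R]_n -> R) : (forall s, gI (f s)) ->
  gE (fun v => pavg (fun s => f s v)) = pavg (fun s => gE (f s)).
Proof. by move=> h; rewrite /pavg gE_Z ?gE_sum//; apply: gI_sum. Qed.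

Lemma gker_shift n (w d y : 'rV[R]_n) (th : R) : 0 < sin th ->
  let x := cos th / sin th in let z := (sin th)^-1 *: (y - cos th *: w) in
  gker (w + d) th y = gker w th y * expR (x * dotp d z - x ^+ 2 * dotp d d / 2).
Proof.
move=> s0 x z; rewrite -!gker_nw// /nw /affw !big_split/= -[RHS]mulrA; congr (_ * _).
rewrite -!expR_sum -expRD; congr expR.
rewrite /z /x /dotp !mulr_sumr !mulr_suml -sumrB -big_split/=; apply: eq_bigr => i _.
by rewrite !mxE; field; rewrite gt_eqF.
Qed.

(** Here [al] = D.z and [de] = |D|^2 for an increment D. A swap multiplies the kernel by the
    exponential and moves z to z - x D; [qf] is the resulting change of kernel times D.z, divided by
    the kernel before the swap. *)
Definition qf (x al de : R) : R :=
  (al - x * de) * expR (x * al - x ^+ 2 * de / 2) - al.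

Variables (N H : nat) (M : 'I_H -> 'M[R]_N).
Hypothesis N0 : (0 < N)%N.
Hypothesis rs : forall h i, \sum_j M h i j = 0.
Hypothesis cs : forall h j, \sum_i M h i j = 0.

Definition Dv (s : {perm 'I_N}) (i j : 'I_N) : 'rV[R]_H := \row_h Dx M s i j h.

Lemma Gamma_tpermv s i j : Gamma M (tperm i j * s)%g = Gamma M s + Dv s i j.
Proof.
apply: rvP => h; rewrite Gamma_tperm [RHS]mxE; congr (_ + _).
by rewrite [RHS]mxE.
Qed.

(* [x] stands for [cos th / sin th]. *)
Definition Qf (x : R) (s : {perm 'I_N}) (z : 'rV[R]_H) : R :=
  x * (dotp z z - H%:R) -
  (4 * N%:R)^-1 * \sum_i \sum_j qf x (dotp (Dv s i j) z) (dotp (Dv s i j) (Dv s i j)).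

Definition zof (w : 'rV[R]_H) (th : R) (y : 'rV[R]_H) := (sin th)^-1 *: (y - cos th *: w).

(* Exchanging pi with pi o (i j) moves the kernel from W to W + D; this turns the drift z.W into
   the second difference [qf]. *)
Lemma stein_kernel (th : R) (y : 'rV[R]_H) : 0 < sin th ->
  pavg (fun s => gker (Gamma M s) th y * kerb (Gamma M s) th y) =
  pavg (fun s => gker (Gamma M s) th y * Qf (cos th / sin th) s (zof (Gamma M s) th y)).
Proof.
move=> s0; set x := cos th / sin th.
pose z s := zof (Gamma M s) th y.
have yE s : y = cos th *: Gamma M s + sin th *: z s.
  by rewrite /z /zof scalerA divff ?gt_eqF// scale1r addrC subrK.
pose f s h := gker (Gamma M s) th y * z s 0 h.
have E1 s : gker (Gamma M s) th y * kerb (Gamma M s) th y =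
   gker (Gamma M s) th y * (x * (dotp (z s) (z s) - H%:R)) - \sum_h Gamma M s 0 h * f s h.
  rewrite {2}(yE s) kerbE ?gt_eqF// mulrBr; congr (_ - _).
  by rewrite /dotp mulr_sumr; apply: eq_bigr => h _; rewrite /f; ring.
have E2 s : gker (Gamma M s) th y * Qf x s (z s) =
   gker (Gamma M s) th y * (x * (dotp (z s) (z s) - H%:R)) -
   (4 * N%:R)^-1 * \sum_i \sum_j \sum_h Dx M s i j h * (f (tperm i j * s)%g h - f s h).
  rewrite mulrBr; congr (_ - _); rewrite mulrCA; congr (_ * _).
  rewrite mulr_sumr; apply: eq_bigr => i _; rewrite mulr_sumr; apply: eq_bigr => j _.
  rewrite /f Gamma_tpermv gker_shift// -/x -/(zof _ _ _) -/(z s).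
  set K := gker _ _ _; set E := expR _.
  have zt h : z (tperm i j * s)%g 0 h = z s 0 h - x * Dx M s i j h.
    by rewrite /z /zof Gamma_tpermv !mxE /x; field; rewrite gt_eqF.
  transitivity (\sum_h K * (Dx M s i j h * z s 0 h * (E - 1) - x * (Dx M s i j h * Dx M s i j h) * E)).
    rewrite -mulr_sumr; congr (_ * _); rewrite sumrB -!mulr_suml -mulr_sumr.
    have -> : \sum_h Dx M s i j h * z s 0 h = dotp (Dv s i j) (z s).
      by rewrite /dotp; apply: eq_bigr => h _; congr (_ * _); rewrite mxE.
    have -> : \sum_h Dx M s i j h * Dx M s i j h = dotp (Dv s i j) (Dv s i j).
      by rewrite /dotp; apply: eq_bigr => h _; congr (_ * _); rewrite mxE.
    by rewrite /qf -/E; ring.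
  by apply: eq_bigr => h _; rewrite zt; ring.
rewrite (eq_pavg E1) (eq_pavg E2) !pavgB; congr (_ - _).
by rewrite pavgZ -pavg_Gamma_test.
Qed.

(** |z|^2 - H is centred, and each [qf] is a linear form centred under a translated Gaussian minus a
    linear form centred under the original one. *)
Lemma Qf_moment (x : R) s : gI (Qf x s) /\ gE (Qf x s) = 0.
Proof.
have e i j : (fun z => qf x (dotp (Dv s i j) z) (dotp (Dv s i j) (Dv s i j))) =
   (fun z => (dotp (Dv s i j) z - dotp (Dv s i j) (x *: Dv s i j)) * Ga (x *: Dv s i j) z - dotp z (Dv s i j)).
  apply/funext => z; rewrite /qf /Ga !dotpZl [dotp _ (x *: _)]dotpC !dotpZl [dotp z _]dotpC.
  congr (_ * expR _ - _); ring.
have i1 : gI (fun z : 'rV[R]_H => x * (dotp z z - H%:R)).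
  by apply: gI_Z; apply: gI_B; [exact: gI_dotpp | exact: gI_cst].
have i2 i j : gI (fun z => qf x (dotp (Dv s i j) z) (dotp (Dv s i j) (Dv s i j))).
  rewrite e; apply: gI_B; [exact: (gE_dotp_Ga _ _).1 | exact: gI_dotp].
have i2s i : gI (fun z => \sum_j qf x (dotp (Dv s i j) z) (dotp (Dv s i j) (Dv s i j))).
  by apply: gI_sum => j _; exact: i2.
have i3 : gI (fun z => (4 * N%:R)^-1 * \sum_i \sum_j qf x (dotp (Dv s i j) z) (dotp (Dv s i j) (Dv s i j))).
  by apply: gI_Z; apply: gI_sum => i _; exact: i2s.
split; first exact: gI_B.
have i0 : gI (fun z : 'rV[R]_H => dotp z z - H%:R).
  by apply: gI_B; [exact: gI_dotpp | exact: gI_cst].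
have m1 : gE (fun z : 'rV[R]_H => x * (dotp z z - H%:R)) = 0.
  rewrite gE_Z// gE_B; [|exact: gI_dotpp|exact: gI_cst].
  by rewrite gE_cst gE_dotpp subrr mulr0.
rewrite gE_B// m1 sub0r.
rewrite gE_Z ?gE_sum; last 2 first.
- by move=> i _; exact: i2s.
- by apply: gI_sum => i _; exact: i2s.
rewrite big1 ?mulr0 ?oppr0// => i _; rewrite gE_sum; last by move=> j _; exact: i2.
rewrite big1// => j _; rewrite e gE_B; [|exact: (gE_dotp_Ga _ _).1|exact: gI_dotp].
by rewrite (gE_dotp_Ga _ _).2 gE_dotp subrr.
Qed.

Definition Delta (A : set 'rV[R]_H) (th : R) (s : {perm 'I_N}) (z : 'rV[R]_H) : R :=
  \1_A (cos th *: Gamma M s + sin th *: z) - \1_A (cos th *: Gamma M s).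

Lemma is_derive_avg (A : set 'rV[R]_H) (th : R) : open A -> 0 < sin th ->
  gI (fun z => pavg (fun s => Delta A th s z * Qf (cos th / sin th) s z)) /\
  is_derive th 1 (fun th => pavg (fun s => Uf A (Gamma M s) th))
    (gE (fun z => pavg (fun s => Delta A th s z * Qf (cos th / sin th) s z))).
Proof.
move=> oA s0; set x := cos th / sin th.
have rA s : rmeas (fun z => \1_A (cos th *: Gamma M s + sin th *: z) : R).
  exact: rmeas_affine (rmeas_indic oA).
have iAQ s : gI (fun z => \1_A (cos th *: Gamma M s + sin th *: z) * Qf x s z).
  apply: (@gI_le _ _ _ (fun v => `|Qf x s v|)).
  - by apply: measurable_funM; [exact: rA | exact: (gI_meas (Qf_moment x s).1)].
  - by move=> v /=; rewrite normrM ler_piMl// indic_le1.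
  - exact: (integrable_norm (Qf_moment x s).1).
have iD s : gI (fun z => Delta A th s z * Qf x s z).
  under [X in gI X]eq_fun do rewrite mulrBl.
  by apply: gI_B => //; apply: gI_Z; exact: (Qf_moment x s).1.
split; first exact: gI_pavg.
apply: isd_eq.
  apply: isdZ; apply: (@isd_sum R _ _ (fun s th => Uf A (Gamma M s) th)) => s.
  exact: (is_derive_Uf (Gamma M s) oA s0).2.
rewrite -/(pavg _) -gE_pavg; last by move=> s; exact: (is_derive_Uf (Gamma M s) oA s0).1.
(* [stein_kernel] holds at a fixed [y] after averaging over permutations, so the average is taken
   inside the integral first; afterwards each permutation returns to its own variable z. *)
transitivity (gE (fun y => pavg (fun s => \1_A y * Qf x s (zof (Gamma M s) th y) * gker (Gamma M s) th y))).
  congr gE; apply/funext => y; rewrite pavgZ stein_kernel// -pavgZ; apply: eq_pavg => s.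
  by rewrite mulrCA mulrC.
have zofK w (z : 'rV[R]_H) : zof w th (cos th *: w + sin th *: z) = z.
  by rewrite /zof addrAC subrr add0r scalerA mulVf ?gt_eqF// scale1r.
have rz s : rmeas (fun y => \1_A y * Qf x s (zof (Gamma M s) th y)).
  apply: measurable_funM; first exact: rmeas_indic.
  rewrite (_ : (fun _ => _) = (fun t => Qf x s (- ((sin th)^-1 * cos th) *: Gamma M s + (sin th)^-1 *: rv t))).
    exact: (rmeas_affine _ _ (gI_meas (Qf_moment x s).1)).
  apply/funext => t; congr Qf; rewrite /zof scalerBr scalerA scaleNr addrC//.
rewrite gE_pavg; last first.
  move=> s; under [X in gI X]eq_fun => y do rewrite -gker_nw//.
  apply: (gI_affine_inv s0 (rz s)).
  by under [X in gI X]eq_fun do rewrite zofK; exact: iAQ.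
rewrite gE_pavg//; apply: eq_pavg => s.
rewrite (gE_ker _ s0 (rz s)).
under [X in gE X = _]eq_fun do rewrite zofK.
under [X in _ = gE X]eq_fun do rewrite mulrBl.
rewrite gE_B//; last by apply: gI_Z; exact: (Qf_moment x s).1.
by rewrite gE_Z ?(Qf_moment x s).2 ?mulr0 ?subr0//; exact: (Qf_moment x s).1.
Qed.

End exchange.

(** * Hermite expansion and size of the Stein bracket *)

Section bracket.
Context {R : realType}.
Variables (N H : nat) (M : 'I_H -> 'M[R]_N) (B : R).
Hypothesis N0 : (0 < N)%N.
Hypothesis H0 : (0 < H)%N.
Hypothesis MB : forall h i j, `|M h i j| <= B.

Let B0 : 0 <= B.
Proof. exact: le_trans (normr_ge0 _) (MB (Ordinal H0) (Ordinal N0) (Ordinal N0)). Qed.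

Lemma le_of_eq (x y : R) : x = y -> x <= y. Proof. by move->. Qed.

(** The second Hermite tensor of z, contracted with the deviation of [Y2] from the identity. *)
Definition quadE (s : {perm 'I_N}) (z : 'rV[R]_H) : R :=
  \sum_h \sum_k ((h == k)%:R - Y2 M s h k) * (z 0 h * z 0 k - (h == k)%:R).

(** The third Hermite tensor of z, contracted with [Y3]. As [Y3] is symmetric, one pairing with
    factor 3 stands for the three pairings. *)
Definition cubE (s : {perm 'I_N}) (z : 'rV[R]_H) : R :=
  \sum_h \sum_k \sum_l Y3 M s h k l * (z 0 h * z 0 k * z 0 l - 3 * (h == k)%:R * z 0 l).

Lemma dotp_sqr s i j (z : 'rV[R]_H) : dotp (Dv M s i j) z ^+ 2 =
  \sum_h \sum_k Dx M s i j h * Dx M s i j k * (z 0 h * z 0 k).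
Proof.
rewrite expr2 /dotp mulr_suml; apply: eq_bigr => h _; rewrite mulr_sumr.
apply: eq_bigr => k _; rewrite !mxE; ring.
Qed.

Lemma dotp_cube s i j (z : 'rV[R]_H) : dotp (Dv M s i j) z ^+ 3 =
  \sum_h \sum_k \sum_l Dx M s i j h * Dx M s i j k * Dx M s i j l * (z 0 h * z 0 k * z 0 l).
Proof.
rewrite exprS dotp_sqr {1}/dotp mulr_suml; apply: eq_bigr => h _; rewrite mulr_sumr.
apply: eq_bigr => k _; rewrite mulr_sumr; apply: eq_bigr => l _; rewrite !mxE; ring.
Qed.

Lemma sum_delta2 (F : 'I_H -> 'I_H -> R) :
  \sum_h \sum_k F h k * (h == k)%:R = \sum_h F h h.
Proof.
apply: eq_bigr => h _; rewrite (bigD1 h)//= eqxx mulr1 big1 ?addr0// => k.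
by rewrite eq_sym => /negbTE ->; rewrite mulr0.
Qed.

Lemma quadEE s z : quadE s z = dotp z z - H%:R - (4 * N%:R)^-1 *
  \sum_i \sum_j (dotp (Dv M s i j) z ^+ 2 - dotp (Dv M s i j) (Dv M s i j)).
Proof.
have e : quadE s z = \sum_h \sum_k (h == k)%:R * (z 0 h * z 0 k - (h == k)%:R) -
    \sum_h \sum_k Y2 M s h k * (z 0 h * z 0 k - (h == k)%:R).
  rewrite -sumrB; apply: eq_bigr => h _; rewrite -sumrB; apply: eq_bigr => k _; ring.
rewrite e; congr (_ - _).
  transitivity (\sum_h \sum_k (z 0 h * z 0 k - 1) * (h == k)%:R).
    apply: eq_bigr => h _; apply: eq_bigr => k _.
    by case: (h == k); rewrite ?mul1r ?mulr1 ?mul0r ?mulr0.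
  rewrite (sum_delta2 (fun h k => z 0 h * z 0 k - 1)) sumrB /dotp; congr (_ - _).
  by rewrite sumr_const card_ord.
rewrite mulr_sumr.
transitivity (\sum_h \sum_k \sum_i \sum_j (4 * N%:R)^-1 * (Dx M s i j h * Dx M s i j k * (z 0 h * z 0 k - (h == k)%:R))).
  apply: eq_bigr => h _; apply: eq_bigr => k _; rewrite /Y2 -[LHS]mulrA mulr_suml mulr_sumr.
  by apply: eq_bigr => i _; rewrite mulr_suml mulr_sumr; apply: eq_bigr => j _.
under eq_bigr => h _ do rewrite exchange_big/=.
rewrite exchange_big/=; apply: eq_bigr => i _.
under eq_bigr => h _ do rewrite exchange_big/=.
rewrite exchange_big/= mulr_sumr; apply: eq_bigr => j _.
rewrite dotp_sqr /dotp.
have -> : \sum_k Dv M s i j 0 k * Dv M s i j 0 k =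
   \sum_h \sum_k (Dx M s i j h * Dx M s i j k) * (h == k)%:R.
  by rewrite (sum_delta2 (fun h k => Dx M s i j h * Dx M s i j k)); apply: eq_bigr => k _; rewrite !mxE.
rewrite -sumrB mulr_sumr; apply: eq_bigr => h _; rewrite -sumrB mulr_sumr.
by apply: eq_bigr => k _; ring.
Qed.

Lemma cubEE s z : cubE s z = (4 * N%:R)^-1 *
  \sum_i \sum_j (dotp (Dv M s i j) z ^+ 3 -
     3 * dotp (Dv M s i j) (Dv M s i j) * dotp (Dv M s i j) z).
Proof.
rewrite mulr_sumr.
transitivity (\sum_h \sum_k \sum_l \sum_i \sum_j (4 * N%:R)^-1 * (Dx M s i j h * Dx M s i j k *
    Dx M s i j l * (z 0 h * z 0 k * z 0 l - 3 * (h == k)%:R * z 0 l))).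
  apply: eq_bigr => h _; apply: eq_bigr => k _; apply: eq_bigr => l _.
  rewrite /Y3 -[LHS]mulrA mulr_suml mulr_sumr.
  by apply: eq_bigr => i _; rewrite mulr_suml mulr_sumr; apply: eq_bigr => j _.
under eq_bigr => h _ do under eq_bigr => k _ do rewrite exchange_big/=.
under eq_bigr => h _ do rewrite exchange_big/=.
rewrite exchange_big/=; apply: eq_bigr => i _.
under eq_bigr => h _ do under eq_bigr => k _ do rewrite exchange_big/=.
under eq_bigr => h _ do rewrite exchange_big/=.
rewrite exchange_big/= mulr_sumr; apply: eq_bigr => j _.
rewrite dotp_cube.
have -> : 3 * dotp (Dv M s i j) (Dv M s i j) * dotp (Dv M s i j) z =
   \sum_h \sum_k (3 * (Dx M s i j h * Dx M s i j k) * dotp (Dv M s i j) z) * (h == k)%:R.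
  rewrite (sum_delta2 (fun h k => 3 * (Dx M s i j h * Dx M s i j k) * dotp (Dv M s i j) z)).
  rewrite -mulr_suml -mulr_sumr; congr (_ * _ * _).
  by rewrite /dotp; apply: eq_bigr => k _; rewrite !mxE.
rewrite -sumrB mulr_sumr; apply: eq_bigr => h _; rewrite -sumrB mulr_sumr.
apply: eq_bigr => k _; rewrite /dotp mulr_sumr mulr_suml -sumrB mulr_sumr.
by apply: eq_bigr => l _; rewrite mxE; ring.
Qed.

(** [stein_rem] applies to each pair (i, j) after multiplication by [x]. The summand [H] in [m]
    makes room for x^2 |D|^2, both below m^2 and, because 4 x B <= 1, below m. *)
Lemma Qf_expand (x : R) s z : 0 < x -> 4 * x * B <= 1 ->
  let m := 4 * x * B * (L1 z + H%:R) in
  `|Qf M x s z - (x * quadE s z - x ^+ 2 / 2 * cubE s z)| <=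
    (5 / 2) * N%:R / x * (m ^+ 4 * expR (2 * m)).
Proof.
move=> x0 xB; cbv zeta; set m := 4 * x * B * (L1 z + H%:R).
pose a i j := dotp (Dv M s i j) z; pose d i j := dotp (Dv M s i j) (Dv M s i j).
pose rem i j := (x * a i j - x ^+ 2 * d i j) * expR (x * a i j - x ^+ 2 * d i j / 2) - x * a i j
   - ((x * a i j) ^+ 2 - x ^+ 2 * d i j) - ((x * a i j) ^+ 3 - 3 * (x ^+ 2 * d i j) * (x * a i j)) / 2.
have N0R : 0 < (N%:R : R) by rewrite ltr0n.
have H1 : 1 <= (H%:R : R) by rewrite ler1n.
have L0 := L1_ge0 z.
have e : Qf M x s z - (x * quadE s z - x ^+ 2 / 2 * cubE s z) =
    - ((4 * N%:R)^-1 * x^-1 * \sum_i \sum_j rem i j).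
  rewrite quadEE cubEE /Qf.
  set S1 := \sum_i \sum_j qf _ _ _.
  set S2 := \sum_i \sum_j (_ ^+ 2 - _); set S3 := \sum_i \sum_j (_ ^+ 3 - _).
  have -> : \sum_i \sum_j rem i j = x * S1 - x ^+ 2 * S2 - x ^+ 3 / 2 * S3.
    rewrite /S1 /S2 /S3 !mulr_sumr -!sumrB; apply: eq_bigr => i _.
    rewrite !mulr_sumr -!sumrB; apply: eq_bigr => j _.
    rewrite /rem /qf -/(a i j) -/(d i j); set E := expR _; ring.
  by field; rewrite !gt_eqF.
rewrite e normrN normrM ger0_norm; last by rewrite mulr_ge0// invr_ge0 ?ltW// mulr_gt0.
have dle i j : d i j <= 16 * B ^+ 2 * H%:R.
    apply: le_trans (_ : \sum_(h < H) (4 * B) ^+ 2 <= _).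
      apply: ler_sum => h _; rewrite mxE -expr2 -real_normK ?num_real//.
      by rewrite lerXn2r ?nnegrE// ?mulr_ge0//; exact: Dx_le.
    by rewrite sumr_const card_ord -[(_ ^+ 2) *+ _]mulr_natr; apply: le_of_eq; ring.
have remb i j : `|rem i j| <= 10 * (m ^+ 4 * expR (2 * m)).
  rewrite mulrA; apply: stein_rem.
  - rewrite normrM gtr0_norm// /m -2!mulrA mulrCA ler_pM2l//.
    apply: le_trans (_ : \sum_h `|Dx M s i j h| * `|z 0 h| <= _).
      apply: le_trans (ler_norm_sum _ _ _) _; apply: ler_sum => h _.
      by rewrite normrM !mxE.
    apply: le_trans (_ : \sum_h (4 * B) * `|z 0 h| <= _).
      by apply: ler_sum => h _; apply: ler_wpM2r => //; exact: Dx_le.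
    by rewrite -mulr_sumr -/(L1 z) -mulrA ler_wpM2l// ler_wpM2l// lerDl.
  - by rewrite mulr_ge0// ?sqr_ge0// dotp_ge0.
  - apply: le_trans (_ : x ^+ 2 * (16 * B ^+ 2 * H%:R) <= _).
      by rewrite ler_wpM2l// sqr_ge0.
    have -> : m ^+ 2 = x ^+ 2 * (16 * B ^+ 2 * (L1 z + H%:R) ^+ 2) by rewrite /m; ring.
    rewrite ler_wpM2l ?sqr_ge0// ler_wpM2l ?mulr_ge0 ?sqr_ge0//.
    apply: le_trans (_ : H%:R ^+ 2 <= _); first by rewrite expr2 ler_peMl.
    by rewrite lerXn2r ?nnegrE ?addr_ge0// lerDr.
  - apply: le_trans (_ : x ^+ 2 * (16 * B ^+ 2 * H%:R) <= _).
      by rewrite ler_wpM2l// sqr_ge0.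
    have -> : x ^+ 2 * (16 * B ^+ 2 * H%:R) = 4 * x * B * (4 * x * B * H%:R) by ring.
    have xB0 : 0 <= 4 * x * B by rewrite !mulr_ge0// ltW.
    by rewrite /m ler_wpM2l// (le_trans (_ : _ <= H%:R))// ?lerDr// ler_piMl.
have sb : `|\sum_i \sum_j rem i j| <= N%:R * (N%:R * (10 * (m ^+ 4 * expR (2 * m)))).
  have cst (y : R) : \sum_(i < N) y = N%:R * y by rewrite sumr_const card_ord mulr_natl.
  rewrite -[leRHS]cst; apply: le_trans (ler_norm_sum _ _ _) _; apply: ler_sum => i _.
  rewrite -[leRHS]cst; apply: le_trans (ler_norm_sum _ _ _) _; apply: ler_sum => j _.
  exact: remb.
apply: le_trans (ler_wpM2l _ sb) _; first by rewrite mulr_ge0// invr_ge0 ?ltW// mulr_gt0.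
by apply: le_of_eq; field; rewrite !gt_eqF.
Qed.

End bracket.

Section bracket_bound.
Context {R : realType}.

(** [2 * b * n <= 1] makes the exponent at most 1 + L1 z / n, so the exponential costs one factor
    [Sn z]; the fourth power costs another, with 200 = 8 (4! + 1). *)
Lemma rem_pow n (z : 'rV[R]_n) (b : R) : (0 < n)%N -> 0 <= b -> 2 * b * n%:R <= 1 ->
  (b * (L1 z + n%:R)) ^+ 4 * expR (2 * (b * (L1 z + n%:R))) <=
  200 * expR 1 * b ^+ 4 * n%:R ^+ 4 * Sn z ^+ 2.
Proof.
move=> n0 b0 bn; have S1 := Sn_ge1 z n0; have L0 := L1_ge0 z.
have n0R : 0 < (n%:R : R) by rewrite ltr0n.
have e1 : expR (2 * (b * (L1 z + n%:R))) <= expR 1 * Sn z.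
  apply: le_trans (_ : expR (1 + n%:R^-1 * L1 z) <= _); last first.
    by rewrite expRD ler_pM2l ?expR_gt0// Sn_exp.
  rewrite ler_expR mulrDr mulrDr addrC lerD//; first by rewrite mulrA.
  by rewrite mulrA ler_wpM2r// -div1r ler_pdivlMr.
have e2 : (L1 z + n%:R) ^+ 4 <= 200 * n%:R ^+ 4 * Sn z.
  have h := L1_pow z 4 n0; rewrite (_ : 4`!%:R = 24 :> R) in h; last by congr (_%:R).
  have n4 : n%:R ^+ 4 <= n%:R ^+ 4 * Sn z by rewrite ler_peMr// exprn_ge0// ltW.
  apply: le_trans (_ : 8 * (L1 z ^+ 4 + n%:R ^+ 4) <= _).
    have h1 (a c : R) : (a + c) ^+ 2 <= 2 * (a ^+ 2 + c ^+ 2) by have := sqr_ge0 (a - c); nra.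
    have h2 := h1 (L1 z) n%:R; have h3 := h1 (L1 z ^+ 2) (n%:R ^+ 2).
    rewrite -[(_ + _) ^+ 4]/((L1 z + n%:R) ^+ (2 * 2)) exprM.
    apply: le_trans (_ : (2 * (L1 z ^+ 2 + n%:R ^+ 2)) ^+ 2 <= _).
      by rewrite lerXn2r ?nnegrE ?sqr_ge0// mulr_ge0// addr_ge0// sqr_ge0.
    move: h3; rewrite -!exprM exprMn => h3; lra.
  by move: h n4; lra.
rewrite exprMn.
apply: le_trans (_ : (b ^+ 4 * (200 * n%:R ^+ 4 * Sn z)) * (expR 1 * Sn z) <= _).
  apply: ler_pM => //; rewrite ?expR_ge0 ?mulr_ge0 ?exprn_ge0 ?addr_ge0 ?ler0n//.
  by apply: ler_wpM2l => //; rewrite exprn_ge0.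
by apply: le_of_eq; ring.
Qed.

Lemma sum_quad n (z : 'rV[R]_n) : (0 < n)%N ->
  \sum_(h < n) \sum_(k < n) `|z 0 h * z 0 k - (h == k)%:R| <= 3 * n%:R ^+ 2 * Sn z.
Proof.
move=> n0; have S1 := Sn_ge1 z n0; have n1 : 1 <= (n%:R : R) by rewrite ler1n.
apply: le_trans (_ : L1 z ^+ 2 + n%:R <= _).
  apply: le_trans (_ : \sum_(h < n) \sum_(k < n) (`|z 0 h| * `|z 0 k| + 1 * (h == k)%:R) <= _).
    apply: ler_sum => h _; apply: ler_sum => k _; rewrite -normrM mul1r.
    by apply: le_trans (ler_normB _ _) _; rewrite normr_nat.
  under eq_bigr => h _ do rewrite big_split/=.
  rewrite big_split/= (sum_delta2 (fun _ _ => 1)) sumr_const card_ord; apply: lerD => //.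
  by rewrite expr2 /L1 mulr_suml; apply: ler_sum => h _; rewrite mulr_sumr.
have h := L1_pow z 2 n0; rewrite (_ : 2`!%:R = 2 :> R) in h; last by congr (_%:R).
have : n%:R <= n%:R ^+ 2 * Sn z.
  by rewrite -[leLHS]mulr1; apply: ler_pM => //; rewrite expr2 ler_peMl//; lra.
by move: h; lra.
Qed.

Lemma sum_cub n (z : 'rV[R]_n) : (0 < n)%N ->
  \sum_(h < n) \sum_(k < n) \sum_(l < n) `|z 0 h * z 0 k * z 0 l - 3 * (h == k)%:R * z 0 l|
   <= 9 * n%:R ^+ 3 * Sn z.
Proof.
move=> n0; have S1 := Sn_ge1 z n0; have n1 : 1 <= (n%:R : R) by rewrite ler1n.
have L0 := L1_ge0 z.
apply: le_trans (_ : L1 z ^+ 3 + 3 * n%:R * L1 z <= _).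
  apply: le_trans (_ : \sum_(h < n) \sum_(k < n) (`|z 0 h| * `|z 0 k| * L1 z + 3 * L1 z * (h == k)%:R) <= _).
    apply: ler_sum => h _; apply: ler_sum => k _.
    rewrite [leRHS](_ : _ = \sum_(l < n) (`|z 0 h| * `|z 0 k| * `|z 0 l| + 3 * (h == k)%:R * `|z 0 l|)).
      apply: ler_sum => l _; apply: le_trans (ler_normB _ _) _.
      by rewrite !normrM !normr_nat.
    by rewrite big_split/= -!mulr_sumr -/(L1 z); congr (_ + _); ring.
  under eq_bigr => h _ do rewrite big_split/=.
  rewrite big_split/= (sum_delta2 (fun _ _ => 3 * L1 z)) sumr_const card_ord; apply: lerD => //.
    rewrite exprS expr2 /L1 mulr_suml; apply: ler_sum => h _; rewrite mulr_suml mulr_sumr.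
    by apply: ler_sum => k _; rewrite mulrA.
  by apply: le_of_eq; rewrite -[_ *+ _]mulr_natr; ring.
have h := L1_pow z 3 n0; rewrite (_ : 3`!%:R = 6 :> R) in h; last by congr (_%:R).
have h1 := L1_pow z 1 n0; rewrite expr1 expr1 mul1r in h1.
have : n%:R * L1 z <= n%:R ^+ 3 * Sn z.
  apply: le_trans (_ : n%:R * (n%:R * Sn z) <= _); first by rewrite ler_wpM2l//; lra.
  rewrite exprS -mulrA ler_wpM2l//.
  by rewrite ler_wpM2r//; [lra | rewrite expr2 ler_peMl].
by move: h; lra.
Qed.

(** AM-GM with a free weight [e]. Since |D| <= 1, the square of [D] is at most |D|, so the first
    moment of [D] enters. *)
Lemma pavg_amgm N (D X : {perm 'I_N} -> R) (e P V : R) : 0 < e -> (forall s, `|D s| <= 1) ->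
  pavg (fun s => `|D s|) <= P -> pavg (fun s => X s ^+ 2) <= V ->
  `|pavg (fun s => D s * X s)| <= 2^-1 * (e * P + V / e).
Proof.
move=> e0 D1 DP XV; apply: le_trans (pavg_norm _) _.
apply: le_trans (_ : pavg (fun s => 2^-1 * (e * `|D s| + e^-1 * X s ^+ 2)) <= _).
  apply: le_pavg => s; rewrite normrM -[X s ^+ 2]real_normK ?num_real//.
  have := D1 s; have := normr_ge0 (D s); have := normr_ge0 (X s).
  move: `|D s| `|X s| => d x x0 d0 d1.
  have h : 0 <= e^-1 * (e * d - x) ^+ 2 by rewrite mulr_ge0 ?sqr_ge0// invr_ge0 ltW.
  rewrite (_ : e^-1 * _ = e * d ^+ 2 - 2 * (d * x) + e^-1 * x ^+ 2) in h; last first.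
    by field; rewrite gt_eqF.
  have : e * d ^+ 2 <= e * d by rewrite ler_pM2l// expr2 ler_piMl.
  lra.
rewrite pavgZ pavgD !pavgZ ler_pM2l//.
by apply: lerD; [rewrite ler_pM2l | rewrite mulrC ler_wpM2r// invr_ge0 ltW].
Qed.

Variables (N H : nat) (M : 'I_H -> 'M[R]_N) (B : R).
Hypothesis N1 : (1 < N)%N.
Hypothesis H0 : (0 < H)%N.
Hypothesis MB : forall h i j, `|M h i j| <= B.
Hypothesis S1 : conditionS1 M.

Let N0 : (0 < N)%N. Proof. exact: ltnW. Qed.
Let B0 : 0 <= B.
Proof. exact: le_trans (normr_ge0 _) (MB (Ordinal H0) (Ordinal N0) (Ordinal N0)). Qed.

(** The quadratic part is paired with [D] by AM-GM, [e] staying free. In the cubic part |D| <= 1 is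
    enough, as [Y3] has first moment of order N^(1/2) B^3. The remainder is bounded uniformly in the
    permutation, and |D| then brings the factor [P]. *)
Lemma bracket_bound (x e P q : R) (D : {perm 'I_N} -> R) (z : 'rV[R]_H) :
  0 < x -> 8 * x * B * H%:R <= 1 -> 0 < e -> (forall s, `|D s| <= 1) ->
  pavg (fun s => `|D s|) <= P -> 0 <= q -> q ^+ 2 = N%:R ->
  `|pavg (fun s => D s * Qf M x s z)| <=
  (3 / 2 * x * H%:R ^+ 2 * (e * P + 1024 * N%:R * B ^+ 4 / e)
   + 576 * x ^+ 2 * H%:R ^+ 3 * q * B ^+ 3
   + (128 * 1000) * expR 1 * N%:R * x ^+ 3 * B ^+ 4 * H%:R ^+ 4 * P) * Sn z ^+ 2.
Proof.
move=> x0 xB e0 D1 DP q0 qN.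
have n1 : 1 <= (H%:R : R) by rewrite ler1n.
have Sz := Sn_ge1 z H0; have N0R : 0 < (N%:R : R) by rewrite ltr0n.
have P0 : 0 <= P by apply: le_trans DP; apply: pavg_ge0.
have SS : Sn z <= Sn z ^+ 2 by rewrite expr2 ler_peMr//; lra.
have -> : pavg (fun s => D s * Qf M x s z) =
   x * pavg (fun s => D s * quadE M s z) - x ^+ 2 / 2 * pavg (fun s => D s * cubE M s z)
   + pavg (fun s => D s * (Qf M x s z - (x * quadE M s z - x ^+ 2 / 2 * cubE M s z))).
  by rewrite -!pavgZ -pavgB -pavgD; apply: eq_pavg => s; ring.
set V := e * P + _.
have V0 : 0 <= V.
  rewrite /V; apply: addr_ge0; first exact: mulr_ge0 (ltW e0) P0.
  by apply: divr_ge0 (ltW e0); apply: mulr_ge0 (exprn_ge0 _ B0); apply: mulr_ge0; exact: ler0n.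
have hq : `|pavg (fun s => D s * quadE M s z)| <= 3 / 2 * H%:R ^+ 2 * V * Sn z ^+ 2.
  have -> : pavg (fun s => D s * quadE M s z) = \sum_h \sum_k
     (z 0 h * z 0 k - (h == k)%:R) * pavg (fun s => D s * ((h == k)%:R - Y2 M s h k)).
    transitivity (pavg (fun s => \sum_h \sum_k (z 0 h * z 0 k - (h == k)%:R) * (D s * ((h == k)%:R - Y2 M s h k)))).
      apply: eq_pavg => s; rewrite mulr_sumr; apply: eq_bigr => h _; rewrite mulr_sumr.
      by apply: eq_bigr => k _; ring.
    rewrite pavg_sum; apply: eq_bigr => h _; rewrite pavg_sum; apply: eq_bigr => k _.
    by rewrite pavgZ.
  apply: le_trans (_ : \sum_(h < H) \sum_(k < H) `|z 0 h * z 0 k - (h == k)%:R| * (2^-1 * V) <= _).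
    apply: le_trans (ler_norm_sum _ _ _) _; apply: ler_sum => h _.
    apply: le_trans (ler_norm_sum _ _ _) _; apply: ler_sum => k _.
    rewrite normrM ler_wpM2l//; apply: pavg_amgm => //.
    exact: (pavg_X2 N0 MB N1 S1 h k).
  under eq_bigr => h _ do rewrite -mulr_suml.
  rewrite -mulr_suml; apply: le_trans (_ : 3 * H%:R ^+ 2 * Sn z * (2^-1 * V) <= _).
    by apply: ler_wpM2r; [rewrite mulr_ge0 | exact: sum_quad].
  apply: le_trans (_ : 3 / 2 * H%:R ^+ 2 * V * Sn z <= _); first by move: V V0 => V V0; apply: le_of_eq; field.
  by rewrite ler_wpM2l// !mulr_ge0// ?exprn_ge0; lra.
have hc : `|pavg (fun s => D s * cubE M s z)| <= 1152 * H%:R ^+ 3 * q * B ^+ 3 * Sn z ^+ 2.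
  have -> : pavg (fun s => D s * cubE M s z) = \sum_h \sum_k \sum_l
     (z 0 h * z 0 k * z 0 l - 3 * (h == k)%:R * z 0 l) * pavg (fun s => D s * Y3 M s h k l).
    transitivity (pavg (fun s => \sum_h \sum_k \sum_l
      (z 0 h * z 0 k * z 0 l - 3 * (h == k)%:R * z 0 l) * (D s * Y3 M s h k l))).
      apply: eq_pavg => s; rewrite mulr_sumr; apply: eq_bigr => h _; rewrite mulr_sumr.
      by apply: eq_bigr => k _; rewrite mulr_sumr; apply: eq_bigr => l _; ring.
    rewrite pavg_sum; apply: eq_bigr => h _; rewrite pavg_sum; apply: eq_bigr => k _.
    by rewrite pavg_sum; apply: eq_bigr => l _; rewrite pavgZ.
  apply: le_trans (_ : \sum_(h < H) \sum_(k < H) \sum_(l < H)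
      `|z 0 h * z 0 k * z 0 l - 3 * (h == k)%:R * z 0 l| * (128 * q * B ^+ 3) <= _).
    apply: le_trans (ler_norm_sum _ _ _) _; apply: ler_sum => h _.
    apply: le_trans (ler_norm_sum _ _ _) _; apply: ler_sum => k _.
    apply: le_trans (ler_norm_sum _ _ _) _; apply: ler_sum => l _.
    rewrite normrM ler_wpM2l//; apply: le_trans (pavg_norm _) _.
    apply: le_trans (_ : pavg (fun s => `|Y3 M s h k l|) <= _).
      by apply: le_pavg => s; rewrite normrM ler_piMl.
    exact: (pavg_Y3_abs N0 MB S1 h k l q0 qN).
  under eq_bigr => h _ do under eq_bigr => k _ do rewrite -mulr_suml.
  under eq_bigr => h _ do rewrite -mulr_suml.
  rewrite -mulr_suml; apply: le_trans (_ : 9 * H%:R ^+ 3 * Sn z * (128 * q * B ^+ 3) <= _).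
    apply: ler_wpM2r; last exact: sum_cub.
    by apply: mulr_ge0 (exprn_ge0 _ B0); apply: mulr_ge0 q0; exact: ler0n.
  apply: le_trans (_ : 1152 * H%:R ^+ 3 * q * B ^+ 3 * Sn z <= _); first by apply: le_of_eq; ring.
  apply: ler_wpM2l SS; apply: mulr_ge0 (exprn_ge0 _ B0); apply: mulr_ge0 q0.
  by apply: mulr_ge0 (exprn_ge0 _ (ler0n _ _)); exact: ler0n.
have hr : `|pavg (fun s => D s * (Qf M x s z - (x * quadE M s z - x ^+ 2 / 2 * cubE M s z)))| <=
    (128 * 1000) * expR 1 * N%:R * x ^+ 3 * B ^+ 4 * H%:R ^+ 4 * P * Sn z ^+ 2.
  set W := (128 * 1000) * expR 1 * N%:R * x ^+ 3 * B ^+ 4 * H%:R ^+ 4 * Sn z ^+ 2.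
  have W0 : 0 <= W.
    apply: mulr_ge0 (sqr_ge0 _); apply: mulr_ge0 (exprn_ge0 _ (ler0n _ _)).
    apply: mulr_ge0 (exprn_ge0 _ B0); apply: mulr_ge0 (exprn_ge0 _ (ltW x0)).
    apply: mulr_ge0 (ler0n _ _); apply: mulr_ge0 (expR_ge0 _).
    by apply: mulr_ge0; exact: ler0n.
  rewrite (_ : _ * P * _ = W * P); last by rewrite /W; ring.
  apply: le_trans (pavg_norm _) _.
  apply: le_trans (_ : pavg (fun s => W * `|D s|) <= _); last by rewrite pavgZ ler_wpM2l.
  apply: le_pavg => s; rewrite normrM mulrC ler_wpM2r//.
  have xB4 : 4 * x * B <= 1.
    apply: le_trans xB; rewrite (_ : 8 * x * B * _ = 4 * x * B * (2 * H%:R)); last by ring.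
    by rewrite ler_peMr ?mulr_ge0//; lra.
  apply: le_trans (Qf_expand N0 H0 MB s z x0 xB4) _.
  have := @rem_pow _ z (4 * x * B) H0; set r := _ * expR _ => h.
  (* The constant 128000 is 5/2 * 200 * 4^4. *)
  apply: le_trans (_ : 5 / 2 * N%:R / x * (200 * expR 1 * (4 * x * B) ^+ 4 * H%:R ^+ 4 * Sn z ^+ 2) <= _).
    rewrite ler_wpM2l//; first by rewrite !mulr_ge0 ?invr_ge0// ltW.
    by apply: h; [rewrite !mulr_ge0// ltW | lra].
  by apply: le_of_eq; rewrite /W; field; rewrite gt_eqF.
apply: le_trans (ler_normD _ _) _; rewrite [leRHS]mulrDl; apply: lerD => //.
apply: le_trans (ler_normB _ _) _; rewrite [leRHS]mulrDl; apply: lerD => //.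
  rewrite normrM gtr0_norm//.
  by apply: le_trans (ler_wpM2l (ltW x0) hq) _; apply: le_of_eq; ring.
have x2 : 0 <= x ^+ 2 / 2 by rewrite divr_ge0// sqr_ge0.
rewrite normrM ger0_norm//.
by apply: le_trans (ler_wpM2l x2 hc) _; apply: le_of_eq; field.
Qed.

End bracket_bound.

(** * Convex shells and the increment of the indicator *)

Section shells.
Context {R : realType}.

Definition gam n (A : set 'rV[R]_n) : R := gE (\1_A).

Lemma gI_indic n (A : set 'rV[R]_n) : open A -> gI (\1_A).
Proof.
move=> oA; apply: (@gI_le _ _ _ (fun=> 1)) => //; first exact: rmeas_indic.
  exact: indic_le1.
exact: gI_cst.
Qed.

Lemma indic_ge0 n (A : set 'rV[R]_n) v : 0 <= \1_A v :> R.
Proof. by rewrite indicE. Qed.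

Lemma indic_le n (A : set 'rV[R]_n) v : \1_A v <= 1 :> R.
Proof. by rewrite indicE; case: (_ \in _). Qed.

Lemma indic_mono T (A B : set T) v w : (A v -> B w) -> \1_A v <= \1_B w :> R.
Proof.
move=> h; rewrite !indicE; case: (boolP (v \in A)) => [vA|]; last by rewrite ler0n.
by rewrite (_ : w \in B) //; apply/mem_set/h/set_mem.
Qed.

Lemma gam_ge0 n (A : set 'rV[R]_n) : 0 <= gam A.
Proof. by apply: gE_ge0; exact: indic_ge0. Qed.

Lemma gam_le1 n (A : set 'rV[R]_n) : open A -> gam A <= 1.
Proof.
move=> oA; rewrite -[1](@gE_cst R n); apply: gE_le; [exact: gI_indic | exact: gI_cst|].
exact: indic_le.
Qed.

Lemma gam_mono n (A B : set 'rV[R]_n) : open A -> open B -> A `<=` B -> gam A <= gam B.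
Proof.
move=> oA oB AB; apply: gE_le; [exact: gI_indic | exact: gI_indic |] => v.
by apply: indic_mono; exact: AB.
Qed.

Lemma ero_open n r (A : set 'rV[R]_n) : open A -> open (ero r A).
Proof. exact: eroL_open. Qed.

Lemma ero_cvx n r (A : set 'rV[R]_n) : cvx A -> cvx (ero r A).
Proof. exact: eroL_cvx. Qed.

Lemma gam_ero n (r : R) (A : set 'rV[R]_n) : 0 <= r -> open A -> cvx A ->
  gam A <= gam (ero r A) + n%:R * r.
Proof.
move=> r0 oA cA; have := ero_shell r0 oA cA.
rewrite (gEK (gI_indic oA)) (gEK (gI_indic (@ero_open _ r _ oA))).
by rewrite -EFinD lee_fin.
Qed.

Lemma gam_cub n (r : R) (A : set 'rV[R]_n) : 0 <= r -> open A -> cvx A ->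
  gam (cub r A) <= gam A + n%:R * r.
Proof.
move=> r0 oA cA; apply: le_trans (gam_ero r0 (@cub_open _ _ r A) (cub_cvx cA)) _.
rewrite lerD2r; apply: gam_mono => //; first by apply: ero_open; exact: cub_open.
exact: ero_cub.
Qed.

(** Both indicators on the left lie between that of the erosion and that of the dilate at [v]. *)
Lemma indic_shift n (r : R) (A : set 'rV[R]_n) (v u : 'rV[R]_n) : cvx A ->
  (forall i, `|u 0 i| < r) ->
  `|\1_A (v + u) - \1_A v| <= \1_(cub r A) v - \1_(ero r A) v :> R.
Proof.
move=> cA ur.
have ur' i : `|u 0 i| <= r by exact: ltW.
have h1 : \1_(ero r A) v <= \1_A (v + u) :> R by apply: indic_mono; exact: eroP.
have h2 : \1_(ero r A) v <= \1_A v :> R.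
  apply: indic_mono => /(@eroP _ _ _ _ _ (0 : 'rV[R]_n)); rewrite addr0; apply => // i.
  by rewrite mxE normr0 (le_trans _ (ur' i)).
have h3 : \1_A (v + u) <= \1_(cub r A) v :> R.
  apply: indic_mono => Avu; exists (v + u) => // i.
  by rewrite mxE opprD addrA subrr sub0r normrN.
have h4 : \1_A v <= \1_(cub r A) v :> R.
  apply: indic_mono => Av; exists v => // i; rewrite subrr normr0.
  exact: le_lt_trans (normr_ge0 _) (ur i).
by rewrite ler_norml; apply/andP; split; lra.
Qed.

Lemma scale_open n (A : set 'rV[R]_n) (c : R) (x : 'rV[R]_n) : c != 0 -> open A ->
  open [set v | A (x + c *: v)].
Proof.
move=> c0 oA; apply: rvP_open => v /= Av.
have [e e0 he] := open_rvP oA Av; exists (e / `|c|); first by rewrite divr_gt0 ?normr_gt0.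
move=> y hy; apply: he => i; rewrite !mxE opprD addrACA subrr add0r -mulrBr normrM mulrC.
by rewrite -ltr_pdivlMr ?normr_gt0.
Qed.

Lemma scale_cvx n (A : set 'rV[R]_n) (c : R) (x : 'rV[R]_n) : cvx A ->
  cvx [set v | A (x + c *: v)].
Proof.
move=> cA u v t t01 /= Au Av.
rewrite (_ : x + _ = t *: (x + c *: u) + (1 - t) *: (x + c *: v)); first exact: cA.
by apply: rvP => i; rewrite !mxE; ring.
Qed.

Variables (N H : nat) (M : 'I_H -> 'M[R]_N).

Definition PW (A : set 'rV[R]_H) : R := pavg (fun s => \1_A (Gamma M s)).

Lemma PW_ge0 A : 0 <= PW A.
Proof. by apply: pavg_ge0 => s; exact: indic_ge0. Qed.

Lemma PW_le1 A : PW A <= 1.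
Proof. by rewrite -[1](@pavg_cst R N); apply: le_pavg => s; exact: indic_le. Qed.

Hypothesis H0 : (0 < H)%N.
Variables (kap nu : R).
Hypothesis kapP : forall A, open A -> cvx A -> `|PW A - gam A| <= kap.
Hypothesis nu0 : 0 <= nu.
Hypothesis nu4 : nu ^+ 4 = H%:R.

Lemma kap_ge0 : 0 <= kap.
Proof.
apply: le_trans (normr_ge0 _) (kapP openT _).
by move=> x y t _ _ _.
Qed.

Lemma nu_ge1 : 1 <= nu.
Proof.
rewrite leNgt; apply/negP => h; have : nu ^+ 4 < 1 by rewrite exprn_ilt1.
by rewrite nu4 ltNge ler1n H0.
Qed.

Lemma shell_PW (r : R) (A : set 'rV[R]_H) : 0 <= r -> open A -> cvx A ->
  PW (cub r A) - PW (ero r A) <= 2 * kap + 2 * H%:R * r.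
Proof.
move=> r0 oA cA.
have h1 := kapP (@cub_open _ _ r A) (cub_cvx cA).
have h2 := kapP (@ero_open _ r _ oA) (@ero_cvx _ r _ cA).
have h3 := gam_ero r0 oA cA; have h4 := gam_cub r0 oA cA.
by move: h1 h2; rewrite !ler_norml => /andP[_ ?] /andP[? _]; lra.
Qed.

Lemma Delta_le1 (A : set 'rV[R]_H) (th : R) s z : `|Delta M A th s z| <= 1.
Proof.
rewrite /Delta ler_norml; move: (cos th *: Gamma M s) => w; move: (w + _) => v.
have := indic_ge0 A v; have := indic_le A v; have := indic_ge0 A w; have := indic_le A w.
by move: (\1_A v) (\1_A w) => a b ? ? ? ?; apply/andP; split; lra.
Qed.

(** Dividing by cos th turns the increment into the effect of shifting [Gamma] by (sin th / cos th)
    z across the dilate [A']. If cos th < 1/2 the quotient is not controlled, but then sin th >= 1/2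
    and the right-hand side exceeds 1. *)
Lemma pavg_Delta_le (A : set 'rV[R]_H) (th : R) (z : 'rV[R]_H) : open A -> cvx A ->
  0 < sin th -> 0 < cos th ->
  pavg (fun s => `|Delta M A th s z|) <= 2 * kap + 18 * H%:R * nu * sin th * Sn z.
Proof.
move=> oA cA s0 c0; have k0 := kap_ge0; have n1 := nu_ge1.
have H1 : 1 <= (H%:R : R) by rewrite ler1n.
have S1 := Sn_ge1 z H0.
have Hn : 1 <= H%:R * nu by rewrite -[leLHS]mulr1 ler_pM//.
have HnS : 1 <= H%:R * nu * Sn z by rewrite -[leLHS]mulr1 ler_pM//; lra.
have [c2|c2] := lerP (2^-1) (cos th); last first.
  have hs : 2^-1 <= sin th by have := cos2Dsin2 th; nra.
  apply: le_trans (_ : 1 <= _).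
    rewrite -[leRHS](@pavg_cst R N); apply: le_pavg => s.
    exact: Delta_le1.
  have : 2^-1 <= sin th * (H%:R * nu * Sn z) by rewrite -[leLHS]mulr1 ler_pM//; lra.
  by move: k0; lra.
(* The shift has coordinates at most 2 sin th * 4 nu Sn z; 9 in place of 8 gives the strict
   inequality that [indic_shift] asks for. *)
pose r := 9 * nu * sin th * Sn z.
have r0 : 0 <= r.
  by apply: mulr_ge0; [apply: mulr_ge0 (ltW s0); exact: mulr_ge0 | lra].
pose A' := [set v : 'rV[R]_H | A (0 + cos th *: v)].
have oA' : open A' by apply: scale_open => //; rewrite gt_eqF.
have cA' : cvx A' by exact: scale_cvx.
apply: le_trans (_ : PW (cub r A') - PW (ero r A') <= _); last first.
  by apply: le_trans (shell_PW r0 oA' cA') _; apply: le_of_eq; rewrite /r; ring.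
rewrite /PW -pavgB; apply: le_pavg => s.
have -> : Delta M A th s z = \1_A' (Gamma M s + (sin th / cos th) *: z) - \1_A' (Gamma M s).
  rewrite /Delta; congr (_ - _); apply: eq_indic; rewrite /A'/= add0r//.
  by rewrite scalerDr scalerA mulrCA divff ?gt_eqF// mulr1.
apply: indic_shift => // i; rewrite mxE normrM gtr0_norm ?divr_gt0//.
apply: le_lt_trans (_ : 2 * sin th * (4 * nu * Sn z) < _).
  apply: ler_pM => //; first by rewrite divr_ge0// ltW.
    rewrite ler_pdivrMr// -mulrA [_ * cos th]mulrC mulrA ler_peMl//; lra.
  exact: coord_Sn.
have : 0 < nu * sin th * Sn z by apply: mulr_gt0; [apply: mulr_gt0 => //|]; lra.
by rewrite /r; lra.
Qed.

End shells.

(** * Derivative along the rotation and its integration *)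

Section derivative_bound.
Context {R : realType}.
Variables (N H : nat) (M : 'I_H -> 'M[R]_N) (B kap nu q : R).
Hypothesis N1 : (1 < N)%N.
Hypothesis H0 : (0 < H)%N.
Hypothesis MB : forall h i j, `|M h i j| <= B.
Hypothesis S1 : conditionS1 M.
Hypothesis kapP : forall A, open A -> cvx A -> `|PW M A - gam A| <= kap.
Hypothesis nu0 : 0 <= nu.
Hypothesis nu4 : nu ^+ 4 = H%:R.
Hypothesis q0 : 0 < q.
Hypothesis qN : q ^+ 2 = N%:R.
Hypothesis B0 : 0 < B.

(** [y] stands for (sin th)^(-1/2). The first two terms come from the quadratic part of [Qf], the
    third from the cubic part and the remainder, the last from the remainder. *)
Definition dbnd (c4 y : R) : R :=
  24 * H%:R * q * B ^+ 2 * kap * y ^+ 3 +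
  (216 * H%:R ^+ 2 * nu + 192 * H%:R ^+ 3) * q * B ^+ 2 * y +
  (576 * H%:R ^+ 3 * q * B ^+ 3 + 18 * c4 * N%:R * B ^+ 4 * H%:R ^+ 5 * nu) * y ^+ 4 +
  2 * c4 * N%:R * B ^+ 4 * H%:R ^+ 4 * kap * y ^+ 6.

Lemma derivative_bound (A : set 'rV[R]_H) (th y : R) : open A -> cvx A ->
  0 < sin th -> 0 < cos th -> 0 < y -> y ^+ 2 * sin th = 1 ->
  8 * (cos th / sin th) * B * H%:R <= 1 ->
  `|gE (fun z => pavg (fun s => Delta M A th s z * Qf M (cos th / sin th) s z))| <=
  cos th * dbnd (128 * 1000 * expR 1) y * expmom 3.
Proof.
move=> oA cA s0 c0 y0 ys xB.
have k0 : 0 <= kap := kap_ge0 kapP.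
have n1 : 1 <= (H%:R : R) by rewrite ler1n.
have n0 : 0 < (H%:R : R) by lra.
have [rs cs _ _] := S1.
have sE : sin th = (y ^+ 2)^-1 by rewrite -[LHS](mulKf (x := y ^+ 2)) ?ys ?mulr1// gt_eqF// exprn_gt0.
set c4 := 128 * 1000 * expR 1.
have c40 : 0 <= c4 by apply: mulr_ge0 (expR_ge0 _); apply: mulr_ge0; exact: ler0n.
set x := cos th / sin th.
have x0 : 0 < x by exact: divr_gt0.
have xE : x = cos th * y ^+ 2 by rewrite /x sE invrK.
(* The power of [y] balances AM-GM: as x has order y^2 and sin th = y^(-2), the shell part of x e P
   and the term x v both have order y. The factor 1 / H shifts powers of H from the [kap] term to
   the one free of [kap], where H^3 is affordable. *)
pose e := 8 * q * B ^+ 2 * y / H%:R.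
have e0 : 0 < e.
  apply: divr_gt0 => //; apply: mulr_gt0 y0; apply: mulr_gt0; last exact: exprn_gt0.
  by apply: mulr_gt0.
pose P := 2 * kap + 18 * H%:R * nu * sin th.
have P0 : 0 <= P.
  apply: addr_ge0; first exact: mulr_ge0.
  by apply: mulr_ge0 (ltW s0); apply: mulr_ge0 nu0; apply: mulr_ge0.
pose v := 1024 * N%:R * B ^+ 4 / e.
have v0 : 0 <= v.
  apply: divr_ge0 (ltW e0); apply: mulr_ge0 (exprn_ge0 _ (ltW B0)).
  by apply: mulr_ge0; exact: ler0n.
pose D := 3 / 2 * x * H%:R ^+ 2 * (e * P + v) + 576 * x ^+ 2 * H%:R ^+ 3 * q * B ^+ 3
   + c4 * N%:R * x ^+ 3 * B ^+ 4 * H%:R ^+ 4 * P.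
have D1 s z : `|Delta M A th s z| <= 1 by exact: Delta_le1.
have pw z : `|pavg (fun s => Delta M A th s z * Qf M x s z)| <= D * Sn z ^+ 3.
  have Sz := Sn_ge1 z H0.
  have DP : pavg (fun s => `|Delta M A th s z|) <= P * Sn z.
    apply: le_trans (pavg_Delta_le H0 kapP nu0 nu4 z oA cA s0 c0) _.
    by rewrite /P [leRHS]mulrDl lerD// ler_peMr// mulr_ge0.
  have := bracket_bound N1 H0 MB S1 z x0 xB e0 (fun s => D1 s z) DP (ltW q0) qN.
  rewrite -/v -/c4 => h; apply: le_trans h _.
  rewrite [Sn z ^+ 3]exprS [leRHS]mulrA; apply: ler_wpM2r; first exact: sqr_ge0.
  rewrite /D [leRHS]mulrDl; apply: lerD; first rewrite [leRHS]mulrDl; first apply: lerD.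
  - rewrite -[leRHS]mulrA; apply: ler_wpM2l.
      by apply: mulr_ge0 (sqr_ge0 _); apply: mulr_ge0 (ltW x0).
    by rewrite [leRHS]mulrDl mulrA lerD// ler_peMr.
  - rewrite -[leLHS]mulr1; apply: ler_wpM2l; last exact: Sz.
    apply: mulr_ge0 (exprn_ge0 _ (ltW B0)); apply: mulr_ge0 (ltW q0).
    by apply: mulr_ge0; [apply: mulr_ge0 (sqr_ge0 _); exact: ler0n | exact: exprn_ge0].
  - by rewrite mulrA.
have [iS mS] := @Sn_moment R H H0.
have D0 : 0 <= D.
  have h := le_trans (normr_ge0 _) (pw 0); have := Sn_ge1 (0 : 'rV[R]_H) H0 => h1.
  have h2 : 0 < Sn (0 : 'rV[R]_H) ^+ 3 by apply: exprn_gt0; exact: lt_le_trans ltr01 h1.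
  by move: h; rewrite (pmulr_lge0 _ h2).
have [iD _] := is_derive_avg (ltnW N1) rs cs oA s0 (M := M).
apply: le_trans (_ : gE (fun z : 'rV[R]_H => D * Sn z ^+ 3) <= _).
  by apply: gE_norm; [exact: gI_meas iD | exact: gI_Z | exact: pw].
rewrite gE_Z//; apply: le_trans (_ : D * expmom 3 <= _); first exact: ler_wpM2l.
apply: ler_wpM2r; first by apply: le_trans mS; apply: gE_ge0 => z; rewrite exprn_ge0// (le_trans ler01)// Sn_ge1.
have c1 : cos th <= 1 by exact: cos_le1.
have vE : v = 128 * H%:R * q * B ^+ 2 / y.
  rewrite /v /e -qN; field; rewrite !gt_eqF//.
have t1 : 3 / 2 * x * H%:R ^+ 2 * (e * P + v) = cos th * (24 * H%:R * q * B ^+ 2 * kap * y ^+ 3 +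
  (216 * H%:R ^+ 2 * nu + 192 * H%:R ^+ 3) * q * B ^+ 2 * y).
  rewrite vE xE /e /P sE; field; rewrite !gt_eqF//.
have t2 : 576 * x ^+ 2 * H%:R ^+ 3 * q * B ^+ 3 <= cos th * (576 * H%:R ^+ 3 * q * B ^+ 3 * y ^+ 4).
  rewrite xE; set w := 576 * H%:R ^+ 3 * q * B ^+ 3 * y ^+ 4.
  have w0 : 0 <= w.
    apply: mulr_ge0 (exprn_ge0 _ (ltW y0)); apply: mulr_ge0 (exprn_ge0 _ (ltW B0)).
    by apply: mulr_ge0 (ltW q0); apply: mulr_ge0 (exprn_ge0 _ (ltW n0)); exact: ler0n.
  rewrite [leLHS](_ : _ = cos th * (cos th * w)); last by rewrite /w; ring.
  by rewrite ler_pM2l// ler_piMl.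
have t3 : c4 * N%:R * x ^+ 3 * B ^+ 4 * H%:R ^+ 4 * P <=
   cos th * (18 * c4 * N%:R * B ^+ 4 * H%:R ^+ 5 * nu * y ^+ 4 + 2 * c4 * N%:R * B ^+ 4 * H%:R ^+ 4 * kap * y ^+ 6).
  set w := (X in _ <= cos th * X).
  have -> : c4 * N%:R * x ^+ 3 * B ^+ 4 * H%:R ^+ 4 * P = cos th * (cos th ^+ 2 * w).
    by rewrite /w xE /P sE; field; rewrite gt_eqF.
  have w0 : 0 <= w.
    apply: addr_ge0; apply: mulr_ge0 (exprn_ge0 _ (ltW y0)).
      apply: mulr_ge0 nu0; apply: mulr_ge0 (exprn_ge0 _ (ltW n0)).
      apply: mulr_ge0 (exprn_ge0 _ (ltW B0)); apply: mulr_ge0 (ler0n _ _).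
      by apply: mulr_ge0 c40; exact: ler0n.
    apply: mulr_ge0 k0; apply: mulr_ge0 (exprn_ge0 _ (ltW n0)).
    apply: mulr_ge0 (exprn_ge0 _ (ltW B0)); apply: mulr_ge0 (ler0n _ _).
    by apply: mulr_ge0 c40; exact: ler0n.
  have cc : cos th ^+ 2 <= 1 by apply: exprn_ile1; [exact: ltW | exact: c1].
  rewrite (ler_pM2l c0); have := ler_wpM2r w0 cc; by rewrite mul1r.
rewrite /D t1 /dbnd; move: t2 t3; lra.
Qed.

End derivative_bound.

Section integration.
Context {R : realType}.

(** Integrates a derivative bound by comparison with an explicit primitive [g]. The inequality is
    asked on the open interval because [derivative_bound] needs a positive cosine, which fails at pi
    / 2. *)
Lemma mvt_le (f g df dg : R -> R) (a b : R) : a < b ->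
  (forall x, a <= x <= b -> is_derive x 1 f (df x)) ->
  (forall x, a <= x <= b -> is_derive x 1 g (dg x)) ->
  (forall x, a < x < b -> `|df x| <= dg x) -> `|f b - f a| <= g b - g a.
Proof.
move=> ab hf hg hle.
have key (h dh : R -> R) : (forall x, a <= x <= b -> is_derive x 1 h (dh x)) ->
    (forall x, a < x < b -> 0 <= dh x) -> h a <= h b.
  move=> hd h0; have [c cab e] : exists2 c, c \in `]a, b[%R & h b - h a = dh c * (b - a).
    apply: MVT; first exact: ab.
      move=> x; rewrite in_itv/= => /andP[ax xb]; apply: hd; by rewrite !ltW.
    apply: derivable_within_continuous => x; rewrite in_itv/= => xab.
    by have [] := hd x xab.
  rewrite -subr_ge0 e; move: cab; rewrite in_itv/= => /h0 h1.
  by rewrite mulr_ge0// subr_ge0 ltW.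
have k1 := key (fun x => g x - f x) (fun x => dg x - df x).
have k2 := key (fun x => g x + f x) (fun x => dg x + df x).
have {k1} h1 : g a - f a <= g b - f b.
  apply: k1 => x xab; first by apply: isdB; [exact: hg | exact: hf].
  by have := hle x xab; rewrite subr_ge0 => /(le_trans (ler_norm _)).
have {k2} h2 : g a + f a <= g b + f b.
  apply: k2 => x xab; first by apply: isdD; [exact: hg | exact: hf].
  have := hle x xab; rewrite ler_norml => /andP[]; lra.
by rewrite ler_norml; apply/andP; split; lra.
Qed.

Definition isq (th : R) : R := (Num.sqrt (sin th))^-1.

Lemma is_derive_isq (th : R) : 0 < sin th ->
  is_derive th 1 isq (- (cos th * isq th ^+ 3 / 2)).
Proof.
move=> s0; have q0 : Num.sqrt (sin th) != 0 by rewrite gt_eqF// sqrtr_gt0.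
apply: isd_eq.
  apply: isdV => //; apply: (@isd_comp _ Num.sqrt sin).
    exact: is_derive1_sqrt.
by rewrite /isq; field.
Qed.

Lemma is_derive_prim (b1 b2 b3 b4 th : R) : 0 < sin th ->
  is_derive th 1 (fun t => - (2 * b1) * isq t + (2 * b2) * (isq t)^-1 + - b3 * isq t ^+ 2
     + - (b4 / 2) * isq t ^+ 4)
   (cos th * (b1 * isq th ^+ 3 + b2 * isq th + b3 * isq th ^+ 4 + b4 * isq th ^+ 6)).
Proof.
move=> s0; have q0 : isq th != 0 by rewrite invr_eq0 gt_eqF// sqrtr_gt0.
have h := is_derive_isq s0.
apply: isd_eq (isdD (isdD (isdD (isdZ _ h) (isdZ (2 * b2) (isdV q0 h))) (isdZ _ (isdX 2 h)))
  (isdZ _ (isdX 4 h))) _.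
by rewrite /=; field.
Qed.

Variables (N H : nat) (M : 'I_H -> 'M[R]_N) (B kap nu q : R).
Hypothesis N1 : (1 < N)%N.
Hypothesis H0 : (0 < H)%N.
Hypothesis MB : forall h i j, `|M h i j| <= B.
Hypothesis S1 : conditionS1 M.
Hypothesis kapP : forall A, open A -> cvx A -> `|PW M A - gam A| <= kap.
Hypothesis nu0 : 0 <= nu.
Hypothesis nu4 : nu ^+ 4 = H%:R.
Hypothesis q0 : 0 < q.
Hypothesis qN : q ^+ 2 = N%:R.
Hypothesis B0 : 0 < B.

(** [8 * B * H <= eps] gives 8 cot th B H <= 1 on the whole range of angles from asin eps to pi / 2.
    The right-hand side is the increment of the primitive of the derivative bound, with its negative
    terms dropped; [y0] is eps^(-1/2). *)
Lemma smooth_error (A : set 'rV[R]_H) (eps y0 : R) : open A -> cvx A ->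
  0 < eps -> eps < 1 -> 0 < y0 -> y0 ^+ 2 * eps = 1 -> 8 * B * H%:R <= eps ->
  `|pavg (fun s => gE (fun z => \1_A (Num.sqrt (1 - eps ^+ 2) *: Gamma M s + eps *: z))) - gam A| <=
  expmom 3 * (2 * (24 * H%:R * q * B ^+ 2 * kap) * y0 +
     2 * ((216 * H%:R ^+ 2 * nu + 192 * H%:R ^+ 3) * q * B ^+ 2) +
     (576 * H%:R ^+ 3 * q * B ^+ 3 + 18 * (128 * 1000 * expR 1) * N%:R * B ^+ 4 * H%:R ^+ 5 * nu) * y0 ^+ 2 +
     2 * (128 * 1000 * expR 1) * N%:R * B ^+ 4 * H%:R ^+ 4 * kap / 2 * y0 ^+ 4).
Proof.
move=> oA cA e0 e1 y00 ye eB.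
set c4 := 128 * 1000 * expR 1.
have c40 : 0 <= c4 by apply: mulr_ge0 (expR_ge0 _); apply: mulr_ge0; exact: ler0n.
have [rs cs _ _] := S1.
have eI : -1 <= eps <= 1 by apply/andP; split; lra.
pose a := asin eps; pose b : R := pi / 2.
have sa : sin a = eps by rewrite asinK// in_itv.
have ca : cos a = Num.sqrt (1 - eps ^+ 2) by rewrite cos_asin.
have ab : a < b by apply: asin_ltpi2; apply/andP; split; lra.
have aN : - b < a by apply: asin_gtNpi2; apply/andP; split; lra.
have sx x : a <= x <= b -> eps <= sin x.
  move=> /andP[ax xb]; move: ax; rewrite le_eqVlt => /orP[/eqP <-|ax]; first by rewrite sa.
  rewrite -sa ltW// ltr_sin// in_itv/=; apply/andP; split; rewrite -/b; lra.
have sx0 x : a <= x <= b -> 0 < sin x by move=> /sx; lra.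
pose b1 := 24 * H%:R * q * B ^+ 2 * kap.
pose b2 := (216 * H%:R ^+ 2 * nu + 192 * H%:R ^+ 3) * q * B ^+ 2.
pose b3 := 576 * H%:R ^+ 3 * q * B ^+ 3 + 18 * c4 * N%:R * B ^+ 4 * H%:R ^+ 5 * nu.
pose b4 := 2 * c4 * N%:R * B ^+ 4 * H%:R ^+ 4 * kap.
pose C0 := @expmom R 3.
pose u x := pavg (fun s => Uf A (Gamma M s) x).
pose du x := gE (fun z => pavg (fun s => Delta M A x s z * Qf M (cos x / sin x) s z)).
pose g x := C0 * (- (2 * b1) * isq x + (2 * b2) * (isq x)^-1 + - b3 * isq x ^+ 2
     + - (b4 / 2) * isq x ^+ 4).
pose dg x := C0 * (cos x * (b1 * isq x ^+ 3 + b2 * isq x + b3 * isq x ^+ 4 + b4 * isq x ^+ 6)).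
have C00 : 0 <= C0.
  have [_ mS] := @Sn_moment R H H0; apply: le_trans mS; apply: gE_ge0 => z.
  by rewrite exprn_ge0// (le_trans ler01)// Sn_ge1.
have k0 : 0 <= kap := kap_ge0 kapP.
have main : `|u b - u a| <= g b - g a.
  apply: (@mvt_le u g du dg _ _ ab) => x xab.
  - exact: (is_derive_avg (ltnW N1) rs cs oA (sx0 x xab)).2.
  - by apply: isdZ; apply: is_derive_prim; exact: sx0.
  - have xab' : a <= x <= b by case/andP: xab => *; apply/andP; split; exact: ltW.
    have s0 := sx0 x xab'; have c0 : 0 < cos x.
      by apply: cos_gt0_pihalf; case/andP: xab => ax xb; rewrite -/b xb (lt_trans aN ax).
    have i0 : 0 < isq x by rewrite invr_gt0 sqrtr_gt0.
    have is1 : isq x ^+ 2 * sin x = 1 by rewrite /isq exprVn sqr_sqrtr ?ltW// mulVf// gt_eqF.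
    have xB : 8 * (cos x / sin x) * B * H%:R <= 1.
      rewrite (_ : 8 * _ * B * _ = (cos x * (8 * B * H%:R)) / sin x); last by ring.
      rewrite ler_pdivrMr// mul1r; apply: le_trans (sx x xab'); apply: le_trans eB.
      by rewrite ler_piMl ?cos_le1// mulr_ge0// mulr_ge0// ltW.
    apply: le_trans (derivative_bound N1 H0 MB S1 kapP nu0 nu4 q0 qN B0 oA cA s0 c0 i0 is1 xB) _.
    by rewrite /dbnd /dg mulrC.
have sb : sin b = 1 := sin_pihalf R.
have cb : cos b = 0 := cos_pihalf R.
have ib : isq b = 1 by rewrite /isq sb sqrtr1 invr1.
have ia : isq a = y0.
  have eE : eps = y0^-1 ^+ 2.
    by rewrite exprVn -[LHS](mulKf (x := y0 ^+ 2)) ?ye ?mulr1// gt_eqF// exprn_gt0.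
  by rewrite /isq sa eE sqrtr_sqr gtr0_norm ?invr_gt0// invrK.
have ub : u b = gam A.
  rewrite /u -[RHS](@pavg_cst R N); apply: eq_pavg => s.
  rewrite /Uf gE_ker ?sb//; last exact: rmeas_indic.
  by congr gE; apply/funext => z; rewrite cb scale0r scale1r add0r.
have ua : u a = pavg (fun s => gE (fun z => \1_A (Num.sqrt (1 - eps ^+ 2) *: Gamma M s + eps *: z))).
  apply: eq_pavg => s; rewrite /Uf gE_ker ?sa//; last exact: rmeas_indic.
  by rewrite ca.
rewrite -ua -ub distrC; apply: le_trans main _.
rewrite /g ib ia -mulrBr; apply: ler_wpM2l => //.
rewrite -/b1 -/b2 -/b3 -/b4 !expr1n invr1.
have nn : 0 <= (H%:R : R) := ler0n _ _.
have b10 : 0 <= b1.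
  apply: mulr_ge0 k0; apply: mulr_ge0 (exprn_ge0 _ (ltW B0)); apply: mulr_ge0 (ltW q0).
  by apply: mulr_ge0 nn; exact: ler0n.
have b20 : 0 <= b2.
  apply: mulr_ge0 (exprn_ge0 _ (ltW B0)); apply: mulr_ge0 (ltW q0); apply: addr_ge0.
    by apply: mulr_ge0 nu0; apply: mulr_ge0 (exprn_ge0 _ nn); exact: ler0n.
  by apply: mulr_ge0 (exprn_ge0 _ nn); exact: ler0n.
have b30 : 0 <= b3.
  apply: addr_ge0.
    apply: mulr_ge0 (exprn_ge0 _ (ltW B0)); apply: mulr_ge0 (ltW q0).
    by apply: mulr_ge0 (exprn_ge0 _ nn); exact: ler0n.
  apply: mulr_ge0 nu0; apply: mulr_ge0 (exprn_ge0 _ nn); apply: mulr_ge0 (exprn_ge0 _ (ltW B0)).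
  by apply: mulr_ge0 (ler0n _ _); apply: mulr_ge0 c40; exact: ler0n.
have b40 : 0 <= b4.
  apply: mulr_ge0 k0; apply: mulr_ge0 (exprn_ge0 _ nn); apply: mulr_ge0 (exprn_ge0 _ (ltW B0)).
  by apply: mulr_ge0 (ler0n _ _); apply: mulr_ge0 c40; exact: ler0n.
have b2y : 0 <= b2 / y0 by rewrite divr_ge0// ltW.
move: b10 b20 b30 b40 b2y; clear; move: b1 b2 b3 b4 => b1 b2 b3 b4 *; lra.
Qed.

End integration.

(** * Removing the smoothing *)

Section scaling.
Context {R : realType}.

Lemma nw0_le n (rho : R) (v : 'rV[R]_n) : 0 < rho -> rho <= 1 -> nw 0 rho v <= rho^-1 ^+ n.
Proof.
move=> r0 r1; rewrite /nw -[n in leRHS]card_ord -prodr_const; apply: ler_prod => i _.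
rewrite affw_ge0//= /affw mxE subr0 -[leRHS]mulr1 ler_pM2l ?invr_gt0// -expR0 ler_expR.
rewrite subr_le0 ler_wpM2l ?sqr_ge0// lef_pV2 ?posrE ?mulr_gt0 ?exprn_gt0// ler_piMr//.
by rewrite exprn_ile1// ltW.
Qed.

Lemma gE_scale_le n (f : 'rV[R]_n -> R) (rho : R) : 0 < rho -> rho <= 1 -> rmeas f ->
  (forall v, 0 <= f v <= 1) -> gE (fun v => f (0 + rho *: v)) <= rho^-1 ^+ n * gE f.
Proof.
move=> r0 r1 mf f01; rewrite gE_affine//.
have bd c v : 0 <= c -> `|c * f v| <= c.
  by move=> c0; have /andP[a b] := f01 v; rewrite ger0_norm ?mulr_ge0// ler_piMr.
have fi : gI f.
  apply: (@gI_le _ _ _ (fun=> 1)) => //; last exact: gI_cst.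
  by move=> v; rewrite -[f v]mul1r; exact: bd.
rewrite -gE_Z//; apply: gE_le.
- apply: gI_affine_inv => //; apply: (@gI_le _ _ _ (fun=> 1)); last exact: gI_cst.
    exact: rmeas_affine.
  by move=> v; rewrite -[f _]mul1r; exact: bd.
- exact: gI_Z.
- by move=> v; rewrite mulrC ler_wpM2r ?nw0_le//; case/andP: (f01 v).
Qed.

(** The density of rho Z relative to Z is at most rho^(-n) because rho <= 1; applying this to [A]
    and to its complement bounds the difference from both sides. *)
Lemma gam_scale n (A : set 'rV[R]_n) (rho : R) : open A -> 0 < rho -> rho <= 1 ->
  `|gam [set v | A (0 + rho *: v)] - gam A| <= rho^-1 ^+ n - 1.
Proof.
move=> oA r0 r1; have rA := rmeas_indic oA.
have oA' : open [set v | A (0 + rho *: v)] by apply: scale_open => //; rewrite gt_eqF.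
have e : \1_[set v | A (0 + rho *: v)] = (fun v => \1_A (0 + rho *: v)) :> ('rV[R]_n -> R).
  by apply/funext => v; apply: eq_indic.
have h1 := @gE_scale_le n (\1_A) rho r0 r1 rA.
have {}h1 : gam [set v | A (0 + rho *: v)] <= rho^-1 ^+ n * gam A.
  by rewrite /gam e; apply: h1 => v; rewrite indic_ge0 indic_le.
have h2 := @gE_scale_le n (fun v => 1 - \1_A v) rho r0 r1.
have {}h2 : 1 - gam [set v | A (0 + rho *: v)] <= rho^-1 ^+ n * (1 - gam A).
  rewrite /gam e -{1}(@gE_cst R n 1) -gE_B; [|exact: gI_cst|by rewrite -e; exact: gI_indic].
  rewrite -{2}(@gE_cst R n 1) -gE_B; [|exact: gI_cst|exact: gI_indic].
  apply: h2; first by apply: measurable_funB => //; exact: rA.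
  by move=> v; rewrite subr_ge0 indic_le lerBlDr lerDl indic_ge0.
have g0 := gam_ge0 A; have g1 := gam_le1 oA.
have k1 : 1 <= rho^-1 ^+ n by rewrite exprn_ege1// invf_ge1.
move: h1 h2; move: (gam _) (gam A) (rho^-1 ^+ n) g0 g1 k1 => a b c g0 g1 k1 h1 h2.
by rewrite ler_norml; apply/andP; split; nra.
Qed.

Lemma gam_lip n (A : set 'rV[R]_n) (rho r : R) (x : 'rV[R]_n) : open A -> cvx A ->
  0 < rho -> rho <= 1 -> 0 <= r -> (forall i, `|x 0 i| < r) ->
  `|gam [set v | A (x + rho *: v)] - gam A| <= n%:R * r + (rho^-1 ^+ n - 1).
Proof.
move=> oA cA r0 r1 rr xr; pose A' := [set w | A (w + x)].
have oA' : open A' by exact: open_transl.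
have e : [set v | A (x + rho *: v)] = [set v | A' (0 + rho *: v)].
  by apply/funext => v; rewrite /A'/= add0r addrC.
have h := gam_scale oA' r0 r1.
have h1 : gam A' <= gam (cub r A).
  apply: gam_mono => //; first exact: cub_open.
  by move=> w Aw; exists (w + x) => // i; rewrite mxE opprD addrA subrr sub0r normrN.
have h2 : gam (ero r A) <= gam A'.
  apply: gam_mono => //; first exact: ero_open.
  by move=> w; apply: eroP => // i; rewrite ltW.
have h3 := gam_ero rr oA cA; have h4 := gam_cub rr oA cA.
by move: h; rewrite e !ler_norml => /andP[? ?]; apply/andP; split; lra.
Qed.

Lemma bernoulli (e : R) n : 0 <= e <= 1 -> 1 - n%:R * e <= (1 - e) ^+ n.
Proof.
move=> /andP[e0 e1]; elim: n => [|n IH]; first by rewrite mul0r subr0 expr0.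
rewrite exprS; apply: le_trans (_ : (1 - e) * (1 - n%:R * e) <= _); last first.
  by rewrite ler_wpM2l// subr_ge0.
rewrite -natr1; have : 0 <= n%:R * e * e by rewrite !mulr_ge0.
lra.
Qed.

(** sqrt(1 - e^2) >= 1 - e, whose n-th power is at least 1 - n e >= 1/2 by Bernoulli, and 1 / (1 -
    t) - 1 <= 2 t for t <= 1/2. *)
Lemma scale_err_le n (e : R) : 0 < e -> n%:R * e <= 2^-1 -> e < 1 ->
  (Num.sqrt (1 - e ^+ 2))^-1 ^+ n - 1 <= 2 * n%:R * e.
Proof.
move=> e0 ne e1; set rho := Num.sqrt _.
have e01 : 0 <= 1 - e ^+ 2 by rewrite subr_ge0 exprn_ile1// ltW.
have h : 1 - e <= rho.
  have e1' : 0 <= 1 - e by lra.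
  by rewrite -[leLHS](ger0_norm e1') -sqrtr_sqr /rho ler_sqrt//; nra.
have p : 1 - n%:R * e <= rho ^+ n.
  have e1' : 0 <= 1 - e by lra.
  apply: le_trans (bernoulli n _) _; first by rewrite !ltW.
  by apply: lerXn2r => //; rewrite nnegrE// sqrtr_ge0.
have p0 : 0 < rho ^+ n by lra.
rewrite exprVn lerBlDr -div1r ler_pdivrMr//.
have ne0 : 0 <= n%:R * e by rewrite mulr_ge0// ltW.
move: ne ne0 p p0; rewrite -mulrA; move: (n%:R * e) (rho ^+ n) => x y *; nra.
Qed.

End scaling.

Section smoothing.
Context {R : realType}.
Let C0 := @expmom R 3.

Lemma gI_Sn n : (0 < n)%N -> gI (@Sn R n).
Proof.
move=> n0; apply: gI_Z; apply: gI_sum => i _.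
by under [X in gI X]eq_fun do rewrite -[`|_|]mul1r; exact: (gexp i 1).1.
Qed.

Lemma gE_Sn n : (0 < n)%N -> gE (@Sn R n) <= C0.
Proof.
move=> n0; have [i3 m3] := @Sn_moment R n n0; apply: le_trans m3.
apply: gE_le => //; first exact: gI_Sn.
by move=> z; rewrite -[leLHS]expr1 ler_weXn2l// Sn_ge1.
Qed.

Lemma C0_ge1 : 1 <= C0.
Proof.
apply: le_trans (@gE_Sn 1 isT); rewrite -[leLHS](@gE_cst R 1).
by apply: gE_le => [||z]; [exact: gI_cst | exact: gI_Sn | exact: Sn_ge1].
Qed.

(* Where [Sn z >= 4 C0], the bound [a - (a + k) Sn z / (4 C0)] drops below [-k]; so it holds
   everywhere, and Markov's inequality is replaced by integrating it. *)
Lemma good_event n (F : 'rV[R]_n -> R) (a k d : R) : (0 < n)%N -> gI F ->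
  (forall z, Sn z < 4 * C0 -> a <= F z) -> (forall z, - k - d * Sn z <= F z) ->
  0 <= k -> 0 <= d -> 3 / 4 * a <= gE F + k / 4 + d * C0.
Proof.
move=> n0 iF hg hb k0 d0; have C1 := C0_ge1.
have mS := gE_Sn n0; have iS := gI_Sn n0.
have S0 : 0 <= gE (@Sn R n) by apply: gE_ge0 => z; exact: le_trans ler01 (Sn_ge1 z n0).
have iL (c e : R) : gI (fun z : 'rV[R]_n => c - e * Sn z) by exact: gI_B (gI_cst _ _) (gI_Z _ iS).
have mL (c e : R) : gE (fun z : 'rV[R]_n => c - e * Sn z) = c - e * gE (@Sn R n).
  by rewrite (gE_B (gI_cst _ _) (gI_Z _ iS)) gE_cst (gE_Z _ iS).
have [ak|ak] := lerP 0 (a + k); last first.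
  have h : - k - d * C0 <= gE F.
    apply: le_trans (_ : gE (fun z : 'rV[R]_n => - k - d * Sn z) <= _); last first.
      exact: (gE_le (iL _ _) iF).
    by rewrite mL lerD2l lerN2 ler_wpM2l.
  by lra.
pose c := (a + k) / (4 * C0) + d.
have c0 : 0 <= c by rewrite /c addr_ge0// divr_ge0//; lra.
have h : a - c * C0 <= gE F.
  apply: le_trans (_ : gE (fun z : 'rV[R]_n => a - c * Sn z) <= _).
    by rewrite mL lerD2l lerN2 ler_wpM2l.
  apply: (gE_le (iL _ _) iF) => z; have Sz := Sn_ge1 z n0.
  have [gz|gz] := ltP (Sn z) (4 * C0).
    by apply: le_trans (hg z gz); rewrite lerBlDr lerDl mulr_ge0//; lra.
  apply: le_trans (hb z).
  have : a + k <= (a + k) / (4 * C0) * Sn z.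
    by rewrite mulrAC ler_pdivlMr; [rewrite ler_wpM2l | lra].
  by rewrite /c; lra.
have : (a + k) / (4 * C0) * C0 = (a + k) / 4 by field; rewrite gt_eqF//; lra.
by move: h; rewrite /c; lra.
Qed.

Variables (N H : nat) (M : 'I_H -> 'M[R]_N) (kap nu : R).
Hypothesis H0 : (0 < H)%N.
Hypothesis kapP : forall A, open A -> cvx A -> `|PW M A - gam A| <= kap.
Hypothesis nu0 : 0 <= nu.
Hypothesis nu4 : nu ^+ 4 = H%:R.
Variables (eps rho T : R).
Hypothesis e0 : 0 < eps.
Hypothesis r0 : 0 < rho.
Hypothesis r1 : rho <= 1.
Hypothesis TP : forall A : set 'rV[R]_H, open A -> cvx A ->
  `|pavg (fun s => gE (fun z => \1_A (rho *: Gamma M s + eps *: z))) - gam A| <= T.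

Let sc := rho^-1 ^+ H - 1.
Let F (B : set 'rV[R]_H) (z : 'rV[R]_H) : R := pavg (fun s => \1_B (rho *: Gamma M s + eps *: z)).

Lemma smooth_mean B : open B -> cvx B -> gI (F B) /\ `|gE (F B) - gam B| <= T.
Proof.
move=> oB cB.
have i s : gI (fun z => \1_B (rho *: Gamma M s + eps *: z)).
  apply: (@gI_le _ _ _ (fun=> 1)); last exact: gI_cst.
    exact: rmeas_affine (rmeas_indic oB).
  by move=> v; exact: indic_le1.
by split; [exact: gI_pavg | rewrite /F gE_pavg//; exact: TP].
Qed.

(** For fixed [z], [F B z] is [PW] of an affine preimage of [B], so [kapP] and [gam_lip] apply. This
    coarse bound serves where [Sn z] is large. *)
Lemma smooth_dev B z : open B -> cvx B ->
  `|F B z - gam B| <= kap + sc + 5 * H%:R * nu * eps * Sn z.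
Proof.
move=> oB cB; have n1 := nu_ge1 H0 nu0 nu4; have Sz := Sn_ge1 z H0.
pose B' := [set v : 'rV[R]_H | B (eps *: z + rho *: v)].
have oB' : open B' by apply: scale_open => //; rewrite gt_eqF.
have cB' : cvx B' by exact: scale_cvx.
have -> : F B z = PW M B' by apply: eq_pavg => s; apply: eq_indic; rewrite /B'/= addrC.
have h1 := kapP oB' cB'.
have p : 0 < nu * eps * Sn z by apply: mulr_gt0; [apply: mulr_gt0 => //|]; lra.
have h2 : `|gam B' - gam B| <= H%:R * (5 * nu * eps * Sn z) + sc.
  apply: gam_lip => //; first by lra.
  move=> i; rewrite mxE normrM gtr0_norm//.
  apply: le_lt_trans (_ : eps * (4 * nu * Sn z) < _); last by lra.
  by apply: (ler_wpM2l (ltW e0)); exact: coord_Sn.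
rewrite -(subrK (gam B') (PW M B')) -addrA; apply: le_trans (ler_normD _ _) _.
by move: h1 h2; lra.
Qed.

Lemma sc_ge0 : 0 <= sc.
Proof. by rewrite subr_ge0 exprn_ege1// invf_ge1. Qed.

(** [A'] contains rho W exactly when [A] contains W. Where Sn z < 4 C0, adding eps z moves rho W by
    less than [r] in each coordinate, so the indicator of [A] is compared with that of the erosion
    or dilate of [A']; elsewhere [smooth_dev] costs (kap + sc) / 4. Dividing by the 3/4 of
    [good_event] leaves kap / 3. *)
Lemma smoothing (A : set 'rV[R]_H) : open A -> cvx A ->
  `|PW M A - gam A| <= 4 / 3 * T + kap / 3 + 4 / 3 * sc + 23 * H%:R * nu * eps * C0.
Proof.
move=> oA cA; have k0 : 0 <= kap := kap_ge0 kapP.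
have s0 := sc_ge0; have n1 := nu_ge1 H0 nu0 nu4; have C1 := C0_ge1.
pose A' := [set w : 'rV[R]_H | A (0 + rho^-1 *: w)].
have oA' : open A' by apply: scale_open => //; rewrite invr_eq0 gt_eqF.
have cA' : cvx A' by exact: scale_cvx.
have A'E v : A' (rho *: v) = A v.
  by rewrite /A'/= add0r scalerA mulVf ?scale1r// gt_eqF.
have hA : `|gam A - gam A'| <= sc.
  have := gam_scale oA' r0 r1; congr (`|gam _ - _| <= _).
  by apply/funext => v /=; rewrite add0r A'E.
(* This is eps * 4 nu * 4 C0, the coordinate bound of [coord_Sn] at Sn z = 4 C0. *)
pose r := 16 * nu * eps * C0.
have hn : 0 <= H%:R * nu * eps by rewrite !mulr_ge0// ltW.
have hX : 0 <= H%:R * nu * eps * C0 by apply: mulr_ge0; lra.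
have rp : 0 <= r by apply: mulr_ge0; [apply: mulr_ge0 (ltW e0); exact: mulr_ge0 | lra].
have zr (z : 'rV[R]_H) (i : 'I_H) : Sn z < 4 * C0 -> `|(eps *: z) 0 i| < r.
  move=> Sz; rewrite mxE normrM gtr0_norm// /r.
  apply: le_lt_trans (_ : eps * (4 * nu * Sn z) < _).
    by apply: (ler_wpM2l (ltW e0)); exact: coord_Sn.
  have p : 0 < nu * eps by rewrite mulr_gt0//; lra.
  have : nu * eps * Sn z < nu * eps * (4 * C0) by rewrite ltr_pM2l.
  by lra.
have d0 : 0 <= 5 * H%:R * nu * eps by rewrite -!mulrA mulr_ge0// mulrA.
have ks : 0 <= kap + sc by exact: addr_ge0.
have HrE : H%:R * r = 16 * (H%:R * nu * eps * C0) by rewrite /r; ring.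
move: hA; rewrite !ler_norml => /andP[hA1 hA2]; apply/andP; split.
- pose B := ero r A'.
  have oB : open B by exact: ero_open.
  have cB : cvx B by exact: ero_cvx.
  have [iF] := smooth_mean oB cB; rewrite ler_norml => /andP[hm _].
  have gB := gam_ero rp oA' cA'.
  have := @good_event H (fun z => gam B - F B z) (gam B - PW M A) (kap + sc) (5 * H%:R * nu * eps) H0.
  rewrite gE_B ?gE_cst; [|exact: gI_cst|exact: iF].
  move=> h; have {}h := h (gI_B (gI_cst _ _) iF).
  have {}h : 3 / 4 * (gam B - PW M A) <= gam B - gE (F B) + (kap + sc) / 4 + 5 * H%:R * nu * eps * C0.
    apply: h => // z; last first.
      by have := smooth_dev z oB cB; rewrite ler_norml => /andP[_]; lra.
    move=> Sz; rewrite lerD2l lerN2; apply: le_pavg => s; apply: indic_mono.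
    move=> /(@eroP _ _ _ _ _ (- (eps *: z))) => /(_ cA'); rewrite addrK A'E; apply=> i.
    by rewrite mxE normrN ltW// zr.
  by rewrite HrE in gB; move: h gB hm hA1 hA2 hX; rewrite -/B; lra.
- pose B := cub r A'.
  have oB : open B by exact: cub_open.
  have cB : cvx B by exact: cub_cvx.
  have [iF] := smooth_mean oB cB; rewrite ler_norml => /andP[_ hm].
  have gB := gam_cub rp oA' cA'.
  have := @good_event H (fun z => F B z - gam B) (PW M A - gam B) (kap + sc) (5 * H%:R * nu * eps) H0.
  rewrite gE_B ?gE_cst; [|exact: iF|exact: gI_cst].
  move=> h; have {}h := h (gI_B iF (gI_cst _ _)).
  have {}h : 3 / 4 * (PW M A - gam B) <= gE (F B) - gam B + (kap + sc) / 4 + 5 * H%:R * nu * eps * C0.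
    apply: h => // z; last first.
      by have := smooth_dev z oB cB; rewrite ler_norml => /andP[]; lra.
    move=> Sz; rewrite lerD2r; apply: le_pavg => s; apply: indic_mono => As.
    exists (rho *: Gamma M s); first by rewrite A'E.
    move=> i; rewrite (_ : (rho *: Gamma M s + eps *: z) 0 i - (rho *: Gamma M s) 0 i = (eps *: z) 0 i).
      exact: zr.
    by rewrite !mxE; ring.
  by rewrite HrE in gB; move: h gB hm hA1 hA2 hX; rewrite -/B; lra.
Qed.

End smoothing.

(** * The recursive inequality for the error *)

Section fixed_point.
Context {R : realType}.
Variables (N H : nat) (M : 'I_H -> 'M[R]_N) (B : R).
Hypothesis N1 : (1 < N)%N.
Hypothesis H0 : (0 < H)%N.
Hypothesis MB : forall h i j, `|M h i j| <= B.
Hypothesis S1 : conditionS1 M.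

Lemma bound_gt0 : 0 < B.
Proof.
have N0 := ltnW N1; have NB := NB2_ge N0 MB N1 S1 (Ordinal H0).
rewrite lt_neqAle (le_trans (normr_ge0 _) (MB (Ordinal H0) (Ordinal N0) (Ordinal N0))) andbT.
by apply/negP => /eqP e; move: NB; rewrite -e expr0n mulr0; lra.
Qed.

End fixed_point.

(** The constants enter as variables with defining equations, paired by the product of types, so
    that they stay opaque to arithmetic. [K] is large enough that the terms with [kap] in the smooth
    error amount to at most kap / 8; [smoothing] then returns 4/3 * kap / 8 + kap / 3 = kap / 2. *)
Lemma fixed_point_step (R : realType) (N H : nat) (M : 'I_H -> 'M[R]_N) (B kap nu C0 c4 K cT cE n beta eps : R) (A : set 'rV[R]_H) :
  (1 < N)%N -> (0 < H)%N -> (forall h i j, `|M h i j| <= B) -> conditionS1 M ->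
  0 <= nu -> nu ^+ 4 = H%:R ->
  (forall A, open A -> cvx A -> `|PW M A - gam A| <= kap) ->
  (K = 16 + 8 * C0 * (68 + 2 * c4)) * (cT = C0 * (1632 + 1728 + 36 * c4)) ->
  (cE = 4 / 3 * cT + 3 * K + 23 * K * C0) * (c4 = 128 * 1000 * expR 1) ->
  (n = H%:R) * (C0 = @expmom R 3) ->
  (eps = K * n ^+ 2 * beta) * (beta = N%:R * B ^+ 3) ->
  1 <= C0 -> 0 <= c4 -> 16 <= K -> 0 <= cT -> n * eps <= 2^-1 ->
  open A -> cvx A ->
  `|PW M A - gam A| <= kap / 2 + cE * (n ^+ 3 * nu * beta).
Proof.
move=> N1 H0 MB S1 nu0 nu4 kapP EQ1 EQ2 EQ3 EQ4 Cge cge Kge cTge neps oA cA.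
have Bgt := bound_gt0 N1 H0 MB S1.
have k0 : 0 <= kap := kap_ge0 kapP.
have N0R : 0 < (N%:R : R) by rewrite ltr0n ltnW.
have NB : 2^-1 <= N%:R * B ^+ 2 := NB2_ge (ltnW N1) MB N1 S1 (Ordinal H0).
have n1 : 1 <= n by rewrite EQ3.1 ler1n.
have n0 : 0 < n := lt_le_trans ltr01 n1.
have v1 := nu_ge1 H0 nu0 nu4.
have K0 : 0 < K by lra.
have bB : beta = B * (N%:R * B ^+ 2) by rewrite EQ4.2; ring.
have b0 : 0 < beta by rewrite EQ4.2 mulr_gt0// exprn_gt0.
have B2b : B <= 2 * beta by rewrite bB; nra.
have n21 : 1 <= n ^+ 2 by rewrite exprn_ege1.
have eps0 : 0 < eps by rewrite EQ4.1; apply: mulr_gt0 b0; apply: (mulr_gt0 K0); exact: exprn_gt0.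
have eps12 : eps <= 2^-1 by apply: le_trans neps; rewrite ler_peMl// ltW.
have KB : K * n ^+ 2 * B <= 2 * eps.
  rewrite EQ4.1 bB -[leLHS]mulr1; apply: le_trans (_ : K * n ^+ 2 * B * (2 * (N%:R * B ^+ 2)) <= _); last by apply: le_of_eq; ring.
  by rewrite ler_wpM2l//; [apply: mulr_ge0 (ltW Bgt); apply: (mulr_ge0 (ltW K0)); exact: sqr_ge0 | lra].
have KB1 : K * B <= 1.
  apply: le_trans (_ : K * n ^+ 2 * B <= _); last by apply: le_trans KB _; lra.
  by rewrite ler_wpM2r ?(ltW Bgt)// ler_peMr// ltW.
pose q : R := Num.sqrt N%:R.
have q0 : 0 < q by rewrite sqrtr_gt0.
have qN : q ^+ 2 = N%:R by rewrite sqr_sqrtr// ltW.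
pose y : R := Num.sqrt eps^-1.
have y0 : 0 < y by rewrite sqrtr_gt0 invr_gt0.
have y2 : y ^+ 2 = eps^-1 by rewrite sqr_sqrtr// invr_ge0 ltW.
have ye : y ^+ 2 * eps = 1 by rewrite y2 mulVf// gt_eqF.
have eB : 8 * B * H%:R <= eps.
  rewrite -EQ3.1; apply: le_trans (_ : K * n ^+ 2 * B / 2 <= _); last by lra.
  have : 16 * (n * B) <= K * (n ^+ 2 * B).
    apply: ler_pM => //; first by rewrite mulr_ge0// ltW.
    by rewrite ler_wpM2r ?(ltW Bgt)// expr2 ler_peMl// ltW.
  by lra.
have qB : q * B ^+ 2 <= 2 * beta.
  rewrite -(@ler_pXn2r _ 2) ?nnegrE//; last 2 first.
  - by rewrite mulr_ge0// ?sqr_ge0// ltW.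
  - by rewrite mulr_ge0// ltW.
  rewrite exprMn qN (_ : (2 * beta) ^+ 2 = 4 * (N%:R * B ^+ 2) * (N%:R * (B ^+ 2) ^+ 2)); last first.
    by rewrite EQ4.2; ring.
  by rewrite ler_peMl; [ | rewrite mulr_ge0 ?sqr_ge0// ltW | clear -NB; lra].
(* 1 <= 8 (N B^2)^3 = 8 N beta^2, so q^(-1) is at most sqrt 8 times [beta]. *)
have qV : q^-1 <= 3 * beta.
  rewrite -(@ler_pXn2r _ 2) ?nnegrE//; last 2 first.
  - by rewrite invr_ge0 ltW.
  - by rewrite mulr_ge0// ltW.
  rewrite exprVn qN -div1r ler_pdivrMr//.
  apply: le_trans (_ : 8 * beta ^+ 2 * N%:R <= _); last first.
    by rewrite ler_wpM2r// ?(ltW N0R)//; have := sqr_ge0 beta; clear; lra.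
  rewrite bB exprMn [leRHS](_ : _ = 8 * (N%:R * B ^+ 2) ^+ 3); last by ring.
  have : (2^-1) ^+ 3 <= (N%:R * B ^+ 2) ^+ 3 by apply: lerXn2r => //; rewrite nnegrE; clear -NB; lra.
  by rewrite (_ : 2^-1 ^+ 3 = 8^-1 :> R); [clear; lra | field].
pose z := n ^+ 3 * nu * beta.
have z0 : 0 <= z by rewrite /z !mulr_ge0// ?exprn_ge0// ltW.
have n31 : 1 <= n ^+ 3 by rewrite exprn_ege1.
have T1 : 2 * (24 * n * q * B ^+ 2 * kap) * y <= 68 / K * kap.
  rewrite [leLHS](_ : _ = (48 * n * q * B ^+ 2 * y) * kap); last by ring.
  apply: ler_wpM2r => //; rewrite -(@ler_pXn2r _ 2) ?nnegrE//; last 2 first.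
  - apply: mulr_ge0 (ltW y0); apply: mulr_ge0 (sqr_ge0 _); apply: mulr_ge0 (ltW q0).
    by apply: mulr_ge0 (ltW n0); exact: ler0n.
  - by apply: divr_ge0 (ltW K0); exact: ler0n.
  rewrite (_ : (48 * n * q * B ^+ 2 * y) ^+ 2 = 48 ^+ 2 * (n ^+ 2 * q ^+ 2 * B ^+ 4 * y ^+ 2)); last by ring.
  rewrite (_ : n ^+ 2 * q ^+ 2 * B ^+ 4 * y ^+ 2 = B / K); last first.
    rewrite qN y2 EQ4.1 EQ4.2.
    by field; rewrite !gt_eqF.
  rewrite expr_div_n ler_pdivlMr ?exprn_gt0//.
  rewrite (_ : 48 ^+ 2 * (B / K) * K ^+ 2 = 48 ^+ 2 * (K * B)); last by field; rewrite gt_eqF.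
  by apply: le_trans (_ : 48 ^+ 2 * 1 <= _); [rewrite ler_wpM2l// sqr_ge0 | clear; lra].
have n3p : 0 <= n ^+ 3 := le_trans ler01 n31.
have qBp : 0 <= q * B ^+ 2 := mulr_ge0 (ltW q0) (sqr_ge0 _).
have n2p : 0 <= n ^+ 2 * nu := mulr_ge0 (sqr_ge0 _) nu0.
have T2 : 2 * ((216 * n ^+ 2 * nu + 192 * n ^+ 3) * q * B ^+ 2) <= 1632 * z.
  have h : n ^+ 2 * nu * (q * B ^+ 2) <= 2 * z.
    apply: le_trans (_ : n ^+ 3 * nu * (2 * beta) <= _); last by rewrite /z; apply: le_of_eq; ring.
    apply: ler_pM => //.
    by rewrite ler_wpM2r// [n ^+ 3]exprSr ler_peMr// sqr_ge0.
  have h2 : n ^+ 3 * (q * B ^+ 2) <= 2 * z.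
    apply: le_trans (_ : n ^+ 3 * nu * (2 * beta) <= _); last by rewrite /z; apply: le_of_eq; ring.
    by apply: ler_pM => //; rewrite ler_peMr.
  by clear -h h2; lra.
have KV : K^-1 <= 1 by rewrite invf_le1//; clear -Kge; lra.
have KV0 : 0 <= K^-1 by rewrite invr_ge0 ltW.
have T3 : (576 * n ^+ 3 * q * B ^+ 3 + 18 * c4 * N%:R * B ^+ 4 * n ^+ 5 * nu) * y ^+ 2 <= (1728 + 36 * c4) * z.
  rewrite [leLHS](_ : _ = 576 * (K^-1 * (n * q^-1)) + 18 * c4 * (K^-1 * (B * n ^+ 3 * nu))); last first.
    by rewrite y2 EQ4.1 EQ4.2 -qN; field; rewrite !gt_eqF.
  have h1 : K^-1 * (n * q^-1) <= 3 * z.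
    apply: le_trans (_ : n * q^-1 <= _).
      by rewrite ler_piMl// mulr_ge0// ?invr_ge0 ltW.
    apply: le_trans (_ : n * (3 * beta) <= _); first by rewrite ler_wpM2l// ltW.
    rewrite /z mulrCA ler_wpM2l// ler_wpM2r ?(ltW b0)//.
    have n2v : 1 <= n ^+ 2 * nu by rewrite -[leLHS]mulr1; apply: ler_pM.
    by rewrite [n ^+ 3]exprS -mulrA -[leLHS]mulr1; apply: (ler_wpM2l (ltW n0)).
  have h2 : K^-1 * (B * n ^+ 3 * nu) <= 2 * z.
    apply: le_trans (_ : B * n ^+ 3 * nu <= _).
      by rewrite ler_piMl// !mulr_ge0 ?exprn_ge0// ltW.
    rewrite (_ : 2 * z = 2 * beta * n ^+ 3 * nu); last by rewrite /z; ring.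
    by rewrite ler_wpM2r// ler_wpM2r// exprn_ge0// ltW.
  have h3 : 18 * c4 * (K^-1 * (B * n ^+ 3 * nu)) <= 18 * c4 * (2 * z).
    by apply: ler_wpM2l h2; apply: mulr_ge0 cge; exact: ler0n.
  by move: h1 h3; clear; lra.
have T4 : 2 * c4 * N%:R * B ^+ 4 * n ^+ 4 * kap / 2 * y ^+ 4 <= 2 * c4 / K * kap.
  rewrite (_ : y ^+ 4 = (y ^+ 2) ^+ 2); last by rewrite -exprM.
  rewrite [leLHS](_ : _ = c4 * kap * (K^-1 * K^-1 * (N%:R * B ^+ 2)^-1)); last first.
    by rewrite y2 EQ4.1 EQ4.2; field; rewrite !gt_eqF.
  rewrite [leRHS](_ : _ = c4 * kap * (K^-1 * 2)); last by ring.
  apply: ler_wpM2l; first exact: mulr_ge0.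
  have KK : K^-1 * K^-1 <= K^-1 by rewrite -[leRHS]mulr1; apply: (ler_wpM2l KV0).
  have NBV : (N%:R * B ^+ 2)^-1 <= 2.
    by rewrite -[leRHS]invrK lef_pV2// posrE ?invr_gt0// mulr_gt0// exprn_gt0.
  apply: ler_pM => //; first exact: mulr_ge0.
  by rewrite invr_ge0 mulr_ge0 ?sqr_ge0// ltW.
pose T := C0 * (68 / K * kap + 1632 * z + (1728 + 36 * c4) * z + 2 * c4 / K * kap).
have TP (A' : set 'rV[R]_H) : open A' -> cvx A' ->
   `|pavg (fun s => gE (fun z => \1_A' (Num.sqrt (1 - eps ^+ 2) *: Gamma M s + eps *: z))) - gam A'| <= T.
  move=> oA' cA'.
  have eps1 : eps < 1 by clear -eps12; lra.
  apply: le_trans (smooth_error N1 H0 MB S1 kapP nu0 nu4 q0 qN Bgt oA' cA' eps0 eps1 y0 ye eB) _.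
  rewrite -EQ2.2 -EQ3.1 -EQ3.2; apply: ler_wpM2l; first exact: le_trans ler01 Cge.
  by apply: lerD => //; apply: lerD => //; apply: lerD.
have e21 : 0 < 1 - eps ^+ 2 by clear -eps12 eps0; nra.
have r0 : 0 < Num.sqrt (1 - eps ^+ 2) by rewrite sqrtr_gt0.
have r1 : Num.sqrt (1 - eps ^+ 2) <= 1.
  by rewrite -[leRHS]sqrtr1 ler_sqrt// gerBl sqr_ge0.
apply: le_trans (smoothing H0 kapP nu0 nu4 eps0 r0 r1 TP oA cA) _.
have sc : (Num.sqrt (1 - eps ^+ 2))^-1 ^+ H - 1 <= 2 * H%:R * eps.
  apply: scale_err_le => //; last by clear -eps12; lra.
  by rewrite -EQ3.1.
have nz : n * eps * nu = K * z by rewrite EQ4.1 /z; ring.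
have nz0 : n * eps <= K * z by rewrite -nz ler_peMr// mulr_ge0// ltW.
have Tk : T <= kap / 8 + cT * z.
  have -> : T = C0 * (68 + 2 * c4) / K * kap + cT * z by rewrite /T EQ1.2; field; rewrite gt_eqF.
  rewrite lerD2r [kap / 8]mulrC; apply: ler_wpM2r => //.
  by rewrite ler_pdivrMr// EQ1.1; clear; lra.
rewrite -EQ3.2 -EQ3.1 -/z in sc *.
have e1 : 23 * n * nu * eps * C0 = 23 * K * C0 * z.
  by rewrite (_ : 23 * n * nu * eps * C0 = 23 * (n * eps * nu) * C0); [rewrite nz; ring | ring].
have Kz : 0 <= K * z := mulr_ge0 (ltW K0) z0.
by rewrite e1 EQ2.1; move: Tk sc nz0 Kz; move: (_ - 1) => s; clear; lra.
Qed.

(** * Rates for open convex and for convex sets *)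

Section convex_sets.
Context {R : realType}.

(** If H eps > 1/2, the trivial bound 1 is already below 2 [cE] z. Otherwise [fixed_point_step] is
    applied with the supremum of the errors as [kap]; it is finite, being at most 1, so half of it
    can be subtracted. *)
Lemma open_convex_rate : exists2 C : R, 0 < C & forall (N H : nat) (M : 'I_H -> 'M[R]_N) (B nu : R),
  (1 < N)%N -> (0 < H)%N -> (forall h i j, `|M h i j| <= B) -> conditionS1 M ->
  0 <= nu -> nu ^+ 4 = H%:R -> forall A, open A -> cvx A ->
  `|PW M A - gam A| <= C * (H%:R ^+ 3 * nu * (N%:R * B ^+ 3)).
Proof.
pose C0 := @expmom R 3; pose c4 : R := 128 * 1000 * expR 1.
pose K : R := 16 + 8 * C0 * (68 + 2 * c4).
pose cT : R := C0 * (1632 + 1728 + 36 * c4).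
pose cE : R := 4 / 3 * cT + 3 * K + 23 * K * C0.
have EQ1 : (K = 16 + 8 * C0 * (68 + 2 * c4)) * (cT = C0 * (1632 + 1728 + 36 * c4)) by [].
have EQ2 : (cE = 4 / 3 * cT + 3 * K + 23 * K * C0) * (c4 = 128 * 1000 * expR 1) by [].
have EQ0 : C0 = @expmom R 3 by [].
have c40 : 0 <= c4 by apply: mulr_ge0 (expR_ge0 _); apply: mulr_ge0; exact: ler0n.
have C01 : 1 <= C0 by exact: C0_ge1.
have C00 := le_trans ler01 C01.
have K16 : 16 <= K.
  rewrite EQ1.1 lerDl; apply: mulr_ge0; first by apply: mulr_ge0 C00; exact: ler0n.
  by apply: addr_ge0; [|apply: mulr_ge0 c40]; exact: ler0n.
have cT0 : 0 <= cT.
  rewrite EQ1.2; apply: mulr_ge0 C00 _.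
  by apply: addr_ge0; [apply: addr_ge0|apply: mulr_ge0 c40]; exact: ler0n.
clearbody C0 c4 K cT cE.
have K0 : 0 < K by apply: lt_le_trans K16; rewrite ltr0n.
have KC : 0 <= K * C0 := mulr_ge0 (ltW K0) C00.
have cEK : K <= cE by rewrite EQ2.1; clear -cT0 K0 KC; lra.
exists (2 * cE); first by rewrite mulr_gt0// (lt_le_trans K0).
move=> N H M B nu N1 H0 MB S1 nu0 nu4.
have B0 := bound_gt0 N1 H0 MB S1.
have n1 : 1 <= (H%:R : R) by rewrite ler1n.
have v1 := nu_ge1 H0 nu0 nu4.
pose z := H%:R ^+ 3 * nu * (N%:R * B ^+ 3).
have z0 : 0 <= z by rewrite /z !mulr_ge0 ?exprn_ge0// ltW.
pose eps := K * H%:R ^+ 2 * (N%:R * B ^+ 3).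
have nz : H%:R * eps <= K * z.
  rewrite (_ : K * z = H%:R * eps * nu); last by rewrite /eps /z; ring.
  by rewrite ler_peMr// /eps !mulr_ge0 ?exprn_ge0// ltW.
have triv A : open A -> `|PW M A - gam A| <= 1.
  move=> oA; have := PW_ge0 M A; have := PW_le1 M A; have := gam_ge0 A; have := gam_le1 oA.
  by move: (PW M A) (gam A) => a b; rewrite ler_norml; clear => *; apply/andP; split; lra.
have [ne|ne] := lerP (H%:R * eps) 2^-1; last first.
  move=> A oA _; apply: le_trans (triv A oA) _; rewrite -/z.
  have : K * z <= cE * z by rewrite ler_wpM2r.
  by move: ne nz; move: (_ * eps) => a; clear; lra.
pose E := [set d : R | exists A : set 'rV[R]_H, [/\ open A, cvx A & d = `|PW M A - gam A|]].
have Eub : has_ubound E by exists 1 => d [A [oA _ ->]]; exact: triv.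
have kapP A : open A -> cvx A -> `|PW M A - gam A| <= sup E.
  by move=> oA cA; apply: ub_le_sup => //; exists A.
have step A : open A -> cvx A -> `|PW M A - gam A| <= sup E / 2 + cE * z.
  exact: (@fixed_point_step R N H M B (sup E) nu C0 c4 K cT cE H%:R (N%:R * B ^+ 3) eps A
    N1 H0 MB S1 nu0 nu4 kapP EQ1 EQ2 (erefl, EQ0) (erefl, erefl)).
have : sup E <= sup E / 2 + cE * z.
  apply: ge_sup; last by move=> d [A [oA cA ->]]; exact: step.
  exists `|PW M set0 - gam (set0 : set 'rV[R]_H)|; exists set0; split => //.
move=> h A oA cA; apply: le_trans (kapP A oA cA) _; rewrite -/z.
by move: h; clear; move: (sup E) z => s z; lra.
Qed.

Lemma gauss_prob_open H (A : set 'rV[R]_H) : open A -> gauss_prob A = (gam A)%:E.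
Proof.
move=> oA; rewrite /gauss_prob (gauss_intE (f := fun v => (\1_A v)%:E)).
- by rewrite gEK//; exact: gI_indic.
- exact: rmeas_indicE.
- by move=> v; rewrite lee_fin indic_ge0.
Qed.

Lemma le_gauss_prob H (A B : set 'rV[R]_H) : A `<=` B -> (gauss_prob A <= gauss_prob B)%E.
Proof.
move=> AB; apply: le_gauss_int => v; rewrite lee_fin ?indic_ge0//.
by apply: indic_mono; exact: AB.
Qed.

Lemma convex_set_cvx H (A : set 'rV[R]_H) : convex_set A -> cvx A.
Proof.
move=> cA x y t /andP[t0 t1] Ax Ay.
pose k : {i01 R} := Itv01 t0 t1.
by have := cA x y k (mem_set Ax) (mem_set Ay); rewrite inE.
Qed.

(* No measurability of [A] is needed: [A] is squeezed between the open convex sets [ero r (cub r A)]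
   and [cub r A], whose Gaussian measures differ by at most [H r]. *)
Lemma open_to_convex (N H : nat) (M : 'I_H -> 'M[R]_N) (E : R) (A : set 'rV[R]_H) :
  (forall A, open A -> cvx A -> `|PW M A - gam A| <= E) -> cvx A ->
  (`|(perm_prob M A)%:E - gauss_prob A| <= E%:E)%E.
Proof.
move=> hE cA.
have sq r : 0 < r -> exists a b : R, [/\ (a%:E <= gauss_prob A <= b%:E)%E,
    b <= a + H%:R * r, PW M A <= b + E & a <= PW M A + E].
  move=> r0; pose U := cub r A; pose V := ero r U.
  have oU : open U by exact: cub_open.
  have cU : cvx U by exact: cub_cvx.
  have oV : open V by exact: ero_open.
  have cV : cvx V by exact: ero_cvx.
  exists (gam V), (gam U); split.
  - rewrite -!gauss_prob_open//; apply/andP; split; apply: le_gauss_prob.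
      exact: ero_cub.
    exact: sub_cub.
  - by apply: gam_ero => //; exact: ltW.
  - have := hE U oU cU; rewrite ler_norml => /andP[_ h].
    have : PW M A <= PW M U by apply: le_pavg => s; apply: indic_mono; exact: sub_cub.
    lra.
  - have := hE V oV cV; rewrite ler_norml => /andP[h _].
    have : PW M V <= PW M A by apply: le_pavg => s; apply: indic_mono; exact: ero_cub.
    lra.
(* One sandwich, at an arbitrary radius, shows that the Gaussian probability is finite. *)
have [a0 [b0 [ab0 _ _ _]]] := sq 1 ltr01.
have [g gE] : exists g : R, gauss_prob A = g%:E.
  by move: ab0; case: (gauss_prob A) => [g _|/andP[]|/andP[]]//; exists g.
have -> : perm_prob M A = PW M A by [].
rewrite gE -EFinB abse_EFin lee_fin.
apply/ler_addgt0Pr => e e0.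
(* The radius makes H r <= e; adding 1 keeps the denominator positive for H = 0. *)
have p : 0 < e / (H%:R + 1) by rewrite divr_gt0// ltr_wpDl.
have [a [b [ab ba pb ap]]] := sq _ p.
have : H%:R * (e / (H%:R + 1)) <= e.
  rewrite mulrCA ler_piMr ?(ltW e0)// ler_pdivrMr ?ltr_wpDl// mul1r lerDl//.
move: ab; rewrite gE !lee_fin => /andP[ag gb].
by rewrite ler_norml => he; apply/andP; split; lra.
Qed.

End convex_sets.

Section rates.
Context {R : realType}.

(** In dimension 0 both bounds of the theorem are 0, since a nonzero power of 0 is 0; the two
    probabilities must therefore agree exactly, and they do because the space is a point. *)
Lemma zero_dim_error (N : nat) (M : 'I_0 -> 'M[R]_N) (A : set 'rV[R]_0) :
  (`|(perm_prob M A)%:E - gauss_prob A| = 0)%E.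
Proof.
have e (u v : 'rV[R]_0) : u = v by apply: rvP => -[].
have -> : perm_prob M A = \1_A (0 : 'rV[R]_0).
  by rewrite -[RHS](@pavg_cst R N); apply: eq_pavg => s; rewrite (e (Gamma M s) 0).
by rewrite /gauss_prob/=; set v := \row_i _; rewrite (e v 0) subrr normr0.
Qed.

Lemma powR13 (H : nat) : (0 < H)%N ->
  (H%:R `^ (1/4)) ^+ 4 = H%:R :> R /\ (H%:R `^ (13/4)) = H%:R ^+ 3 * (H%:R `^ (1/4)) :> R.
Proof.
move=> H0; have Hn : (H%:R : R) != 0 by rewrite pnatr_eq0 -lt0n.
split.
  by rewrite -powR_mulrn ?powR_ge0// -powRrM (_ : 1 / 4 * 4%:R = 1) ?powRr1//; field.
rewrite (_ : 13 / 4 = 3%:R + 1 / 4 :> R); last by field.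
by rewrite powRD ?Hn ?implybT// powR_mulrn.
Qed.

Lemma powR_half (N : nat) : (0 < N)%N ->
  N%:R * (N%:R `^ (- (1/2))) ^+ 2 = 1 :> R.
Proof.
move=> N0; have Nn : (N%:R : R) != 0 by rewrite pnatr_eq0 -lt0n.
rewrite -powR_mulrn ?powR_ge0// -powRrM (_ : - (1 / 2) * 2%:R = -1); last by field.
by rewrite powR_inv1// divff.
Qed.

End rates.

Theorem theoremS2 (R : realType) :
  (exists C : R, 0 < C /\
    forall (N H : nat) (M : 'I_H -> 'M[R]_N) (B : R),
      (2 <= N)%N -> conditionS1 M ->
      (forall h i j, `|M h i j| <= B) ->
      forall A : set 'rV[R]_H, borel_set A -> convex_set A ->
        (`| (perm_prob M A)%:E - gauss_prob A | <=
          (C * H%:R `^ (13/4) * N%:R * B * (B ^+ 2 + N%:R^-1)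
           + C * H%:R `^ (3/4) * B
           + C * H%:R `^ (13/8) * N%:R `^ (1/4) * B `^ (3/2)
           + C * H%:R `^ (11/8) * N%:R `^ (1/2) * B ^+ 2)%:E)%E)
  /\
  (forall K : R, exists CK : R, 0 < CK /\
    forall (N H : nat) (M : 'I_H -> 'M[R]_N) (B : R),
      (2 <= N)%N -> conditionS1 M ->
      (forall h i j, `|M h i j| <= B) ->
      B <= K * N%:R `^ (-(1/2)) ->
      forall A : set 'rV[R]_H, borel_set A -> convex_set A ->
        (`| (perm_prob M A)%:E - gauss_prob A | <=
          (CK * H%:R `^ (13/4) * N%:R `^ (-(1/2)))%:E)%E).
Proof.
have [C C0 hC] := @open_convex_rate R.
have key (N H : nat) (M : 'I_H -> 'M[R]_N) (B : R) : (2 <= N)%N -> (0 < H)%N ->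
    conditionS1 M -> (forall h i j, `|M h i j| <= B) -> forall A, convex_set A ->
    (`|(perm_prob M A)%:E - gauss_prob A| <= (C * (H%:R `^ (13/4) * (N%:R * B ^+ 3)))%:E)%E.
  move=> N1 H0 S1 MB A /convex_set_cvx cA; have [nu4 ->] := @powR13 R H H0.
  apply: open_to_convex cA => A'; apply: hC => //; exact: powR_ge0.
split.
  exists C; split=> // N H M B N1 S1 MB A _ cA.
  case: H M S1 MB A cA => [|H] M S1 MB A cA.
    by rewrite zero_dim_error lee_fin !powR0 ?mulf_neq0// !(mulr0, mul0r, addr0).
  have B0 : 0 <= B := ltW (bound_gt0 N1 (ltn0Sn H) MB S1).
  apply: le_trans (key _ _ _ _ N1 (ltn0Sn H) S1 MB A cA) _; rewrite lee_fin.
  set a := H.+1%:R `^ _.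
  rewrite -!addrA (_ : C * (a * _) = C * a * N%:R * B * B ^+ 2); last by ring.
  apply: ler_wpDr.
    by rewrite !addr_ge0// !mulr_ge0 ?powR_ge0 ?exprn_ge0 ?(ltW C0).
  apply: ler_wpM2l; last by rewrite lerDl invr_ge0.
  by rewrite !mulr_ge0 ?powR_ge0 ?(ltW C0).
(* |K|^3 arises from cubing the bound on [B]; the summand 1 keeps the constant positive when [K] is
   0. *)
move=> K; exists (C * (`|K| ^+ 3 + 1)); split.
  by rewrite mulr_gt0// ltr_wpDl// exprn_ge0.
move=> N H M B N1 S1 MB BK A _ cA.
case: H M S1 MB A cA => [|H] M S1 MB A cA.
  by rewrite zero_dim_error lee_fin !powR0 ?mulf_neq0// !(mulr0, mul0r, addr0).
have B0 : 0 <= B := ltW (bound_gt0 N1 (ltn0Sn H) MB S1).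
apply: le_trans (key _ _ _ _ N1 (ltn0Sn H) S1 MB A cA) _; rewrite lee_fin.
have NR : 0 <= (N%:R : R) by rewrite ler0n.
have th := @powR_half R N (ltnW N1).
have t0 : 0 <= (N%:R : R) `^ (- (1/2)) by exact: powR_ge0.
move: th t0 BK; set t := N%:R `^ _; set a := H.+1%:R `^ _ => th t0 BK.
have a0 : 0 <= a by exact: powR_ge0.
have B3 : N%:R * B ^+ 3 <= `|K| ^+ 3 * t.
  apply: le_trans (_ : N%:R * (`|K| * t) ^+ 3 <= _).
    rewrite ler_wpM2l// lerXn2r ?nnegrE ?mulr_ge0//.
    by apply: le_trans BK _; rewrite ler_wpM2r// ler_norm.
  rewrite (_ : N%:R * _ = `|K| ^+ 3 * t * (N%:R * t ^+ 2)); last by ring.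
  by rewrite th mulr1.
rewrite -[leRHS]mulrA mulrC [_ * (a * t)]mulrC.
rewrite (_ : a * t * _ = a * ((`|K| ^+ 3 + 1) * t) * C); last by ring.
rewrite ler_pM2r// ler_wpM2l// mulrDl mul1r; apply: le_trans B3 _.
by rewrite lerDl.
Qed.
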